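(* Let $\alpha>0$ be fixed and let $c<1/\sqrt{2}$. Then for every sufficiently large $N\geq 1$ (depending on $\alpha$ and $c$), \[ \max_{\sqrt{N}\leq \ell\leq N\log N}\left|\zeta\left(\tfrac12+i\alpha\ell\right)\right|\;\geq\;\exp\left(c\sqrt{\frac{\log N\,\log\log\log N}{\log\log N}}\right), \] where the maximum is over integers $\ell$ in the indicated range.
   Context: $\zeta$ denotes the Riemann zeta function. *)

(* Defs.v *)
From Stdlib Require Import Reals.
From Coquelicot Require Import Coquelicot.
Open Scope R_scope.

(* n-th term ((n+1)-th in 1-based indexing) of the Dirichlet eta series at
   s = 1/2 + i t :   (-1)^n (n+1)^(-s)
   = (-1)^n (n+1)^(-1/2) (cos (t ln (n+1)) - i sin (t ln (n+1))). *)
Definition eta_term (t : R) (n : nat) : C :=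
  let m := INR (S n) in
  ((-1) ^ n * Rpower m (-1/2) * cos (t * ln m),
   - ((-1) ^ n * Rpower m (-1/2) * sin (t * ln m))).

Fixpoint eta_partial (t : R) (N : nat) : C :=
  match N with
  | O => (0, 0)
  | S k => Cplus (eta_partial t k) (eta_term t k)
  end.

(* Dirichlet eta function on the critical line: the limit of the partial sums
   (the series converges for Re s > 0; real and imaginary parts separately). *)
Definition eta_half (t : R) : C :=
  (real (Lim_seq (fun N => fst (eta_partial t N))),
   real (Lim_seq (fun N => snd (eta_partial t N)))).

Definition two_pow_one_minus_s (t : R) : C :=
  (sqrt 2 * cos (t * ln 2), - (sqrt 2 * sin (t * ln 2))).

(* Riemann zeta on the critical line, via the analytic continuation
   zeta(s) = eta(s) / (1 - 2^(1-s))  (valid for Re s > 0, s <> 1;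
   the denominator never vanishes on Re s = 1/2). *)
Definition zeta_half (t : R) : C :=
  Cdiv (eta_half t) (Cminus (RtoC 1) (two_pow_one_minus_s t)).

(* Main.v *)
(* The resonance method, with every sum finite.  For 1 <= l < N the value
   zeta(1/2 + i alpha l) agrees with S(alpha l), where S(t) = sum_(m <= X) m^(-1/2-it) and
   X is of order N, up to O(1 + sqrt N / l).  For trigonometric polynomials R_1, R_2 with
   nonnegative coefficients, sum_(a, b < N) S(alpha(a-b)) R_1(a-b) conj R_2(a-b) is a
   combination with nonnegative coefficients of Fejer kernels, hence at least the part of
   it where the phases align; it is also at most 2N sum_(l < N) |S R_1 R_2|.  The phases
   alpha log m are rounded to the grid (2 pi / 8N) Z, which merges both integers of nearly
   equal size and the m, n for which alpha log(m/n) is nearly a multiple of 2 pi; R_1 and R_2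
   are 8N-periodic, so Parseval bounds the range l >= sqrt N, and a discrete mean value
   theorem for S bounds the range l < sqrt N as long as the resonators have at most
   N^(1/2 - eps) frequencies.

   The frequencies of R_2 are the products of exactly w_j primes from each of about
   log log log N / eps blocks (e^(U_j) log N, e^(U_(j+1)) log N], with U_j a geometric
   progression of ratio 1 + eps and w_j of order 1/U_j; those of R_1 have i primes fewer in
   each block.  Then the number of k with n/k a frequency of R_1 is a product of binomial
   coefficients, and the ratio of the masses of R_1 and R_2 is controlled by elementary
   symmetric functions of the 1/p.  Mertens' theorem suffices to evaluate the blocks. *)
Require Import Defs.
From Stdlib Require Import Reals Lra Lia List ZArith Classical.
From Coquelicot Require Import Coquelicot.
From mathcomp Require ssreflect ssrfun ssrbool eqtype ssrnat seq div bigop prime binomial fintype.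
Import ListNotations.
Open Scope R_scope.

(** * Finite sums *)

(** Origin of 1/sqrt 2. Put L = log N, y = log L, z = log y. The primes p with log p between y + U
    and y + (1 + eps) U have s = sum of 1/p about eps U / y. Products of w of them, with w U = W,
    make about e^W frequencies, and lowering the number of primes by i gains about (w s)^(i/2) / i!,
    which is largest near i = sqrt(w s), where it is about e^i. Since w s = eps W / y does not
    involve U, one value of i and one budget W serve all blocks. With J blocks, eps J close to z and
    total cost J W close to L / 2, the exponent satisfies (J i)^2 = J^2 eps W / y, which is close to
    L z / (2 y). The cap L / 2 comes from l < sqrt N. No bound for zeta is assumed there, so the
    resonators are estimated by the sum of their coefficients, which loses a factor equal to the
    number of frequencies, and the mean value theorem wins back only sqrt N up to logarithms. The
    range of U runs from y^eps to y^(1 - eps): below it the error terms in Mertens' theorem would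
    dominate, above it log p would no longer be close to y. *)

Fixpoint Rsum {A} (f : A -> R) (l : list A) : R :=
  match l with
  | [] => 0
  | a :: l' => f a + Rsum f l'
  end.

Lemma Rsum_app {A} (f : A -> R) l l' : Rsum f (l ++ l') = Rsum f l + Rsum f l'.
Proof. induction l as [|a l IH]; simpl; lra. Qed.

Lemma Rsum_map {A B} (g : A -> B) (f : B -> R) l :
  Rsum f (map g l) = Rsum (fun a => f (g a)) l.
Proof. induction l as [|a l IH]; simpl; congruence. Qed.

Lemma Rsum_ext {A} (f g : A -> R) l :
  (forall a, In a l -> f a = g a) -> Rsum f l = Rsum g l.
Proof.
  induction l as [|a l IH]; simpl; intros H; [reflexivity|].
  rewrite H by auto. rewrite IH; auto.
Qed.

Lemma Rsum_le {A} (f g : A -> R) l :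
  (forall a, In a l -> f a <= g a) -> Rsum f l <= Rsum g l.
Proof.
  induction l as [|a l IH]; simpl; intros H; [lra|].
  apply Rplus_le_compat; auto.
Qed.

Lemma Rsum_plus {A} (f g : A -> R) l :
  Rsum (fun a => f a + g a) l = Rsum f l + Rsum g l.
Proof. induction l as [|a l IH]; simpl; lra. Qed.

Lemma Rsum_minus {A} (f g : A -> R) l :
  Rsum (fun a => f a - g a) l = Rsum f l - Rsum g l.
Proof. induction l as [|a l IH]; simpl; lra. Qed.

Lemma Rsum_scal {A} (c : R) (f : A -> R) l :
  Rsum (fun a => c * f a) l = c * Rsum f l.
Proof. induction l as [|a l IH]; simpl; lra. Qed.

Lemma Rsum_scal_r {A} (c : R) (f : A -> R) l :
  Rsum (fun a => f a * c) l = Rsum f l * c.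
Proof. induction l as [|a l IH]; simpl; lra. Qed.

Lemma Rsum_const {A} (c : R) (l : list A) : Rsum (fun _ => c) l = INR (length l) * c.
Proof.
  induction l as [|a l IH]; simpl length; [simpl; lra|]. rewrite S_INR; simpl; lra.
Qed.

Lemma Rsum_zero {A} (f : A -> R) l : (forall a, In a l -> f a = 0) -> Rsum f l = 0.
Proof.
  intros H. rewrite (Rsum_ext f (fun _ => 0)) by auto. rewrite Rsum_const; lra.
Qed.

Lemma Rsum_nonneg {A} (f : A -> R) l : (forall a, In a l -> 0 <= f a) -> 0 <= Rsum f l.
Proof.
  intros H. replace 0 with (Rsum (fun _ : A => 0) l) by (rewrite Rsum_const; lra).
  now apply Rsum_le.
Qed.

Lemma Rsum_swap {A B} (f : A -> B -> R) l l' :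
  Rsum (fun a => Rsum (f a) l') l = Rsum (fun b => Rsum (fun a => f a b) l) l'.
Proof.
  induction l as [|a l IH]; simpl.
  - now rewrite Rsum_zero.
  - now rewrite IH, Rsum_plus.
Qed.

Lemma Rsum_mult {A B} (f : A -> R) (g : B -> R) l l' :
  Rsum f l * Rsum g l' = Rsum (fun a => Rsum (fun b => f a * g b) l') l.
Proof.
  rewrite <- Rsum_scal_r. apply Rsum_ext; intros a _. now rewrite Rsum_scal.
Qed.

Lemma Rabs_Rsum_le {A} (f : A -> R) l : Rabs (Rsum f l) <= Rsum (fun a => Rabs (f a)) l.
Proof.
  induction l as [|a l IH]; simpl; [rewrite Rabs_R0; lra|].
  eapply Rle_trans; [apply Rabs_triang|]. lra.
Qed.

Lemma Rsum_le_const {A} (f : A -> R) c l :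
  (forall a, In a l -> f a <= c) -> Rsum f l <= INR (length l) * c.
Proof. intros H. rewrite <- Rsum_const. now apply Rsum_le. Qed.

Lemma Rsum_in_le {A} (f : A -> R) l a :
  (forall b, In b l -> 0 <= f b) -> In a l -> f a <= Rsum f l.
Proof.
  induction l as [|b l IH]; simpl; [easy|]. intros H [->|Ha].
  - assert (0 <= Rsum f l) by (apply Rsum_nonneg; auto). lra.
  - assert (0 <= f b) by auto. assert (f a <= Rsum f l) by auto. lra.
Qed.

Lemma Rsum_flat_map {A B} (g : A -> list B) (f : B -> R) l :
  Rsum f (flat_map g l) = Rsum (fun a => Rsum f (g a)) l.
Proof. induction l as [|a l IH]; simpl; [easy|]. now rewrite Rsum_app, IH. Qed.

Lemma Rsum_filter {A} (p : A -> bool) (f : A -> R) l :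
  Rsum f (filter p l) = Rsum (fun a => if p a then f a else 0) l.
Proof. induction l as [|a l IH]; simpl; [easy|]. destruct (p a); simpl; lra. Qed.

Lemma Rsum_seq_S (f : nat -> R) a n : Rsum f (seq a (S n)) = Rsum f (seq a n) + f (a + n)%nat.
Proof. rewrite seq_S, Rsum_app. simpl. lra. Qed.

Lemma Rsum_incl {A} (f : A -> R) l l' :
  NoDup l -> incl l l' -> (forall a, In a l' -> 0 <= f a) -> Rsum f l <= Rsum f l'.
Proof.
  revert l'. induction l as [|a l IH]; intros l' Hnd Hi Hf; simpl.
  - now apply Rsum_nonneg.
  - inversion Hnd as [|x y Ha Hl]; subst.
    destruct (in_split a l') as [l1 [l2 ->]]; [apply Hi; now left|].
    assert (IH' : Rsum f l <= Rsum f (l1 ++ l2)).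
    { apply IH; auto.
      - intros b Hb. assert (Hb' := Hi b (or_intror Hb)).
        apply in_app_iff in Hb'. apply in_app_iff.
        destruct Hb' as [?|[<-|?]]; auto. contradiction.
      - intros b Hb. apply Hf. apply in_app_iff in Hb. apply in_app_iff.
        destruct Hb; [left|right; right]; auto. }
    rewrite Rsum_app in *. simpl. lra.
Qed.

Lemma Rsum_sq_nonneg {A} (f : A -> R) l : 0 <= Rsum (fun a => f a ^ 2) l.
Proof. apply Rsum_nonneg; intros; nra. Qed.

Lemma Rsum_Cauchy {A} (f g : A -> R) l :
  Rsum (fun a => f a * g a) l
    <= sqrt (Rsum (fun a => f a ^ 2) l) * sqrt (Rsum (fun a => g a ^ 2) l).
Proof.
  rewrite <- sqrt_mult by apply Rsum_sq_nonneg.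
  apply Rle_trans with (Rabs (Rsum (fun a => f a * g a) l)); [apply Rle_abs|].
  rewrite <- sqrt_Rsqr_abs. apply sqrt_le_1_alt. unfold Rsqr.
  induction l as [|a l IH]; cbn [Rsum]; [lra|].
  pose proof (Rsum_sq_nonneg f l) as HF. pose proof (Rsum_sq_nonneg g l) as HG.
  set (F := Rsum (fun a => f a ^ 2) l) in *. set (G := Rsum (fun a => g a ^ 2) l) in *.
  set (P := Rsum (fun a => f a * g a) l) in *.
  set (x := f a); set (y := g a).
  assert (H : 2 * P * (x * y) <= F * y ^ 2 + G * x ^ 2).
  { (* Discriminant of the quadratic form [F y^2 - 2 P x y + G x^2]. *)
    destruct (Req_dec F 0) as [F0|F0].
    - rewrite F0 in *. assert (P = 0) by nra. rewrite H. nra.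
    - assert (0 < F) by lra.
      apply Rmult_le_reg_l with F; [lra|].
      assert (0 <= (F * y - P * x) ^ 2) by apply pow2_ge_0.
      assert (P * P * x ^ 2 <= F * G * x ^ 2) by (apply Rmult_le_compat_r; [apply pow2_ge_0|lra]).
      nra. }
  nra.
Qed.

(** * Finite sums of complex numbers *)

Definition Csum {A} (f : A -> C) (l : list A) : C :=
  (Rsum (fun a => fst (f a)) l, Rsum (fun a => snd (f a)) l).

Lemma Csum_nil {A} (f : A -> C) : Csum f [] = 0%C.
Proof. reflexivity. Qed.

Lemma Csum_cons {A} (f : A -> C) a l : Csum f (a :: l) = Cplus (f a) (Csum f l).
Proof. reflexivity. Qed.

Lemma Csum_app {A} (f : A -> C) l l' : Csum f (l ++ l') = Cplus (Csum f l) (Csum f l').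
Proof. unfold Csum, Cplus; simpl. now rewrite !Rsum_app. Qed.

Lemma Csum_ext {A} (f g : A -> C) l :
  (forall a, In a l -> f a = g a) -> Csum f l = Csum g l.
Proof. intros H. unfold Csum. f_equal; apply Rsum_ext; intros; now rewrite H. Qed.

Lemma Csum_scal {A} (c : C) (f : A -> C) l :
  Csum (fun a => Cmult c (f a)) l = Cmult c (Csum f l).
Proof.
  induction l as [|a l IH]; [rewrite !Csum_nil; ring|].
  rewrite !Csum_cons, IH. ring.
Qed.

Lemma Csum_scal_r {A} (c : C) (f : A -> C) l :
  Csum (fun a => Cmult (f a) c) l = Cmult (Csum f l) c.
Proof.
  rewrite Cmult_comm, <- Csum_scal. apply Csum_ext; intros; ring.
Qed.

Lemma Csum_seq_S (f : nat -> C) a n :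
  Csum f (seq a (S n)) = Cplus (Csum f (seq a n)) (f (a + n)%nat).
Proof. unfold Csum, Cplus; simpl fst; simpl snd. now rewrite !Rsum_seq_S. Qed.

Lemma Cmod_Csum {A} (f : A -> C) l : Cmod (Csum f l) <= Rsum (fun a => Cmod (f a)) l.
Proof.
  induction l as [|a l IH].
  - rewrite Csum_nil, Cmod_0. simpl; lra.
  - rewrite Csum_cons. simpl. eapply Rle_trans; [apply Cmod_triangle|]. lra.
Qed.

Definition cis (x : R) : C := (cos x, sin x).

Lemma cis_plus x y : cis (x + y) = Cmult (cis x) (cis y).
Proof. unfold cis, Cmult; simpl. rewrite cos_plus, sin_plus. f_equal; ring. Qed.

Lemma cis_opp x : cis (- x) = Cconj (cis x).
Proof. unfold cis, Cconj; simpl. now rewrite cos_neg, sin_antisym. Qed.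

Lemma Cmod_cis x : Cmod (cis x) = 1.
Proof.
  unfold Cmod, cis; simpl fst; simpl snd.
  pose proof (sin2_cos2 x) as H. unfold Rsqr in H.
  replace (cos x ^ 2 + sin x ^ 2) with 1 by nra. apply sqrt_1.
Qed.

Lemma cis_period x (k : Z) : cis (x + 2 * IZR k * PI) = cis x.
Proof.
  assert (Hn : forall n, cis (x + 2 * INR n * PI) = cis x)
    by (intros n; unfold cis; now rewrite cos_period, sin_period).
  assert (Hn' : forall y n, cis (y - 2 * INR n * PI) = cis y).
  { intros y n. unfold cis.
    rewrite <- (cos_period (y - 2 * INR n * PI) n), <- (sin_period (y - 2 * INR n * PI) n).
    f_equal; f_equal; ring. }
  destruct (Z_le_gt_dec 0 k) as [Hk|Hk].
  - rewrite <- (Z2Nat.id k), <- INR_IZR_INZ by lia. apply Hn.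
  - replace (x + 2 * IZR k * PI) with (x - 2 * INR (Z.to_nat (- k)) * PI).
    + apply Hn'.
    + rewrite INR_IZR_INZ, Z2Nat.id, opp_IZR by lia. ring.
Qed.

Lemma div_le_of a b c : 0 < c -> a <= b * c -> a / c <= b.
Proof. intros Hc H. now apply Rle_div_l. Qed.

Lemma le_div_of a b c : 0 < c -> a * c <= b -> a <= b / c.
Proof. intros Hc H. now apply Rle_div_r. Qed.

Lemma inv_le_1 x : 1 <= x -> / x <= 1.
Proof. intros H. apply Rle_trans with (/ 1); [apply Rinv_le_contravar; lra|rewrite Rinv_1; lra]. Qed.

Lemma one_le_sqrt x : 1 <= x -> 1 <= sqrt x.
Proof.
  intros H. apply Rle_trans with (sqrt 1); [rewrite sqrt_1; lra|now apply sqrt_le_1_alt].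
Qed.

Lemma exp_le_exp x y : x <= y -> exp x <= exp y.
Proof. intros [H| ->]; [left; now apply exp_increasing|lra]. Qed.

(** * Zeta as a Dirichlet polynomial *)

(* [S_X(t) = sum_(m <= X) m^(-1/2-it)] *)
Definition dirichlet (X : nat) (t : R) : C :=
  Csum (fun m => Cmult (RtoC (/ sqrt (INR m))) (cis (- (t * ln (INR m))))) (seq 1 X).

(** If a(k+1) = r(k) a(k), then c = 1/(r - 1) satisfies the hypothesis: [a] is [c] times its own
    difference, and Abel summation moves the difference onto [c]. An oscillating sum is thus
    controlled by boundary terms and the variation of [c]. *)
Lemma sum_by_parts_bound (a c : nat -> C) (x n : nat) :
  (forall k, (x <= k)%nat -> a k = Cmult (c k) (Cminus (a (S k)) (a k))) ->
  Cmod (Csum a (seq x n)) <=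
    Cmod (c (x + n)%nat) * Cmod (a (x + n)%nat) + Cmod (c x) * Cmod (a x)
    + Rsum (fun k => Cmod (a (S k)) * Cmod (Cminus (c (S k)) (c k))) (seq x n).
Proof.
  intros H.
  assert (E : Csum a (seq x n) =
    Cminus (Cminus (Cmult (c (x + n)%nat) (a (x + n)%nat)) (Cmult (c x) (a x)))
      (Csum (fun k => Cmult (a (S k)) (Cminus (c (S k)) (c k))) (seq x n))).
  { induction n as [|n IH].
    - simpl seq. rewrite !Csum_nil, Nat.add_0_r. ring.
    - rewrite !Csum_seq_S, IH. rewrite (H (x + n)%nat) at 2 by lia.
      rewrite Nat.add_succ_r. ring. }
  rewrite E. unfold Cminus at 1 2.
  eapply Rle_trans; [apply Cmod_triangle|].
  rewrite Cmod_opp. apply Rplus_le_compat.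
  - eapply Rle_trans; [apply Cmod_triangle|]. rewrite Cmod_opp, !Cmod_mult. lra.
  - eapply Rle_trans; [apply Cmod_Csum|]. apply Rsum_le; intros k _.
    rewrite Cmod_mult. lra.
Qed.

Lemma ln_succ_bounds (n : nat) : (1 <= n)%nat ->
  / (INR n + 1) <= ln (INR (S n)) - ln (INR n) <= / INR n.
Proof.
  intros Hn. assert (0 < INR n) by (apply lt_0_INR; lia).
  rewrite S_INR. rewrite <- ln_div by lra. split.
  - assert (E : exp (- / (INR n + 1)) >= 1 - / (INR n + 1)).
    { apply Rle_ge. replace (1 - / (INR n + 1)) with (1 + - / (INR n + 1)) by ring.
      apply exp_ineq1_le. }
    replace (1 - / (INR n + 1)) with (/ ((INR n + 1) / INR n)) in E by (field; lra).
    rewrite <- (ln_exp (/ (INR n + 1))).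
    apply ln_le; [apply exp_pos|].
    rewrite <- (Rinv_inv (exp _)). rewrite <- exp_Ropp.
    rewrite <- (Rinv_inv ((INR n + 1) / INR n)).
    apply Rinv_le_contravar; [|lra].
    apply Rinv_0_lt_compat, Rdiv_lt_0_compat; lra.
  - rewrite <- (ln_exp (/ INR n)). apply ln_le.
    + apply Rdiv_lt_0_compat; lra.
    + replace ((INR n + 1) / INR n) with (1 + / INR n) by (field; lra). apply exp_ineq1_le.
Qed.

Lemma Cmod_cis_minus x y : Cmod (Cminus (cis x) (cis y)) <= Rabs (x - y).
Proof.
  (* [|e^(ix) - e^(iy)| = 2 |sin ((x-y)/2)|] *)
  assert (E : Cmod (Cminus (cis x) (cis y)) = 2 * Rabs (sin ((x - y) / 2))).
  { unfold Cmod, cis, Cminus, Cplus, Copp; simpl fst; simpl snd.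
    replace (2 * Rabs (sin ((x - y) / 2))) with (Rabs (2 * sin ((x - y) / 2)))
      by (rewrite Rabs_mult, (Rabs_pos_eq 2); lra).
    rewrite <- sqrt_Rsqr_abs. f_equal. unfold Rsqr.
    pose proof (cos_2a_sin ((x - y) / 2)) as H.
    replace (2 * ((x - y) / 2)) with (x - y) in H by field.
    rewrite cos_minus in H.
    pose proof (sin2_cos2 x) as Hx. pose proof (sin2_cos2 y) as Hy. unfold Rsqr in *. nra. }
  rewrite E.
  assert (H : Rabs (sin ((x - y) / 2)) <= Rabs ((x - y) / 2)).
  { destruct (MVT_gen sin 0 ((x - y) / 2) cos) as [z [_ Hz]].
    - intros z _. auto_derive; [easy|ring].
    - intros z _. apply continuity_sin.
    - rewrite sin_0, !Rminus_0_r in Hz. rewrite Hz, Rabs_mult.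
      assert (Rabs (cos z) <= 1) by (apply Rabs_le, COS_bound).
      pose proof (Rabs_pos ((x - y) / 2)). nra. }
  unfold Rdiv in H at 2. rewrite Rabs_mult, (Rabs_pos_eq (/ 2)) in H by lra. lra.
Qed.

(* [ratio t n] is [(n/(n+1))^(1/2+it)], the quotient of consecutive terms [n^(-1/2-it)]. *)
Definition ratio (t : R) (n : nat) : C :=
  Cmult (RtoC (sqrt (INR n / INR (S n)))) (cis (- (t * (ln (INR (S n)) - ln (INR n))))).

Definition zterm (t : R) (n : nat) : C :=
  Cmult (RtoC (/ sqrt (INR n))) (cis (- (t * ln (INR n)))).

Lemma zterm_S t n : (1 <= n)%nat -> zterm t (S n) = Cmult (ratio t n) (zterm t n).
Proof.
  intros Hn. assert (0 < INR n) by (apply lt_0_INR; lia).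
  assert (0 < INR (S n)) by (apply lt_0_INR; lia).
  unfold zterm, ratio.
  replace (- (t * ln (INR (S n)))) with
    (- (t * (ln (INR (S n)) - ln (INR n))) + - (t * ln (INR n))) by ring.
  rewrite cis_plus.
  replace (/ sqrt (INR (S n))) with (sqrt (INR n / INR (S n)) * / sqrt (INR n)).
  - rewrite RtoC_mult. ring.
  - rewrite sqrt_div_alt by lra.
    assert (0 < sqrt (INR n)) by (apply sqrt_lt_R0; lra).
    assert (0 < sqrt (INR (S n))) by (apply sqrt_lt_R0; lra). field. split; lra.
Qed.

Lemma Cmod_zterm t n : (1 <= n)%nat -> Cmod (zterm t n) = / sqrt (INR n).
Proof.
  intros Hn. unfold zterm. rewrite Cmod_mult, Cmod_cis, Rmult_1_r, Cmod_R.
  apply Rabs_pos_eq. left. apply Rinv_0_lt_compat, sqrt_lt_R0, lt_0_INR. lia.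
Qed.

Lemma half_le_sqrt_ratio n : (1 <= n)%nat -> 7 / 10 <= sqrt (INR n / INR (S n)) <= 1.
Proof.
  intros Hn. assert (1 <= INR n) by (apply (le_INR 1); lia). rewrite S_INR.
  assert (1 / 2 <= INR n / (INR n + 1) <= 1).
  { split; [apply le_div_of|apply div_le_of]; lra. }
  split.
  - apply Rsqr_incr_0_var; [|apply sqrt_pos]. rewrite Rsqr_sqrt by lra. unfold Rsqr; lra.
  - apply Rle_trans with (sqrt 1); [apply sqrt_le_1_alt|rewrite sqrt_1]; lra.
Qed.

(** Modulus and argument are varied separately. The argument changes by t times the second
    difference of the logarithm, the modulus through b'^2 - b^2 = 1/((n+1)(n+2)); both are
    O(1/n^2). *)
Lemma ratio_diff t n : 0 <= t -> (1 <= n)%nat ->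
  Cmod (Cminus (ratio t (S n)) (ratio t n)) <= (1 + t) / (INR n * INR n).
Proof.
  intros Ht Hn. unfold ratio.
  set (b := sqrt (INR n / INR (S n))). set (b' := sqrt (INR (S n) / INR (S (S n)))).
  set (u := ln (INR (S n)) - ln (INR n)). set (u' := ln (INR (S (S n))) - ln (INR (S n))).
  assert (Hp : 1 <= INR n) by (apply (le_INR 1); lia).
  pose proof (half_le_sqrt_ratio n Hn) as Hb. fold b in Hb.
  pose proof (half_le_sqrt_ratio (S n) ltac:(lia)) as Hb'. fold b' in Hb'.
  pose proof (ln_succ_bounds n Hn) as Hu. fold u in Hu.
  pose proof (ln_succ_bounds (S n) ltac:(lia)) as Hu'. fold u' in Hu'.
  rewrite S_INR in Hu'.
  replace (Cminus (Cmult b' (cis (- (t * u')))) (Cmult b (cis (- (t * u)))))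
    with (Cplus (Cmult (RtoC (b' - b)) (cis (- (t * u'))))
            (Cmult (RtoC b) (Cminus (cis (- (t * u'))) (cis (- (t * u))))))
    by (rewrite RtoC_minus; ring).
  eapply Rle_trans; [apply Cmod_triangle|].
  rewrite !Cmod_mult, Cmod_cis, !Cmod_R, (Rabs_pos_eq b) by lra.
  pose proof (Cmod_cis_minus (- (t * u')) (- (t * u))) as Hc.
  replace (- (t * u') - - (t * u)) with (t * (u - u')) in Hc by ring.
  rewrite Rabs_mult, (Rabs_pos_eq t) in Hc by lra.
  assert (Hd : / INR n - / (INR n + 1 + 1) <= 2 / (INR n * INR n)).
  { apply Rmult_le_reg_r with (INR n * INR n * (INR n + 1 + 1)); [nra|]. field_simplify; nra. }
  assert (H1 : Rabs (u - u') <= 1 / (INR n * INR n)).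
  { assert (E : u - u' = ln (1 + / (INR n * (INR n + 2)))).
    { unfold u, u'. rewrite !S_INR.
      replace (ln (INR n + 1) - ln (INR n) - (ln (INR n + 1 + 1) - ln (INR n + 1)))
        with ((ln (INR n + 1) + ln (INR n + 1)) - (ln (INR n) + ln (INR n + 1 + 1))) by ring.
      rewrite <- !ln_mult, <- ln_div by nra. f_equal. field. lra. }
    assert (Hi : 0 < / (INR n * (INR n + 2))) by (apply Rinv_0_lt_compat; nra).
    rewrite E, Rabs_pos_eq.
    - apply Rle_trans with (/ (INR n * (INR n + 2))).
      + rewrite <- (ln_exp (/ (INR n * (INR n + 2)))) at 2. apply ln_le; [lra|]. apply exp_ineq1_le.
      + unfold Rdiv. rewrite Rmult_1_l. apply Rinv_le_contravar; nra.
    - rewrite <- ln_1. apply ln_le; lra. }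
  assert (H2 : Rabs (b' - b) <= 1 / (INR n * INR n)).
  { assert (E : (b' - b) * (b' + b) = / ((INR n + 1) * (INR n + 1 + 1))).
    { replace ((b' - b) * (b' + b)) with (b' * b' - b * b) by ring.
      unfold b, b'. rewrite !sqrt_sqrt.
      - rewrite !S_INR. field. lra.
      - apply Rdiv_le_0_compat; rewrite ?S_INR; lra.
      - apply Rdiv_le_0_compat; rewrite ?S_INR; lra. }
    assert (Hi : 0 < / ((INR n + 1) * (INR n + 1 + 1))) by (apply Rinv_0_lt_compat; nra).
    assert (/ ((INR n + 1) * (INR n + 1 + 1)) <= / (INR n * INR n))
      by (apply Rinv_le_contravar; nra).
    rewrite Rabs_pos_eq by nra. unfold Rdiv. nra. }
  assert (b * Cmod (Cminus (cis (- (t * u'))) (cis (- (t * u)))) <= t * (1 / (INR n * INR n))).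
  { pose proof (Cmod_ge_0 (Cminus (cis (- (t * u'))) (cis (- (t * u))))).
    assert (t * Rabs (u - u') <= t * (1 / (INR n * INR n))) by (apply Rmult_le_compat_l; lra).
    nra. }
  replace ((1 + t) / (INR n * INR n)) with (1 / (INR n * INR n) + t * (1 / (INR n * INR n)))
    by (field; lra).
  lra.
Qed.

Lemma sin_ge_half x : 0 <= x <= 1 -> x / 2 <= sin x.
Proof.
  intros Hx. destruct (MVT_gen sin 0 x cos) as [z [Hz Ez]].
  - intros z _. auto_derive; [easy|ring].
  - intros z _. apply continuity_sin.
  - rewrite sin_0, !Rminus_0_r in Ez. rewrite Ez.
    rewrite Rmin_left, Rmax_right in Hz by lra.
    assert (1 / 2 <= cos z).
    { rewrite <- cos_PI3. apply cos_decr_1; pose proof PI2_3_2; pose proof PI_4; lra. }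
    nra.
Qed.

Lemma ratio_arg_bounds t n : 0 <= t -> (1 <= n)%nat -> t <= INR n ->
  t / (2 * INR n) <= t * (ln (INR (S n)) - ln (INR n)) <= 1.
Proof.
  intros Ht Hn Htn. assert (1 <= INR n) by (apply (le_INR 1); lia).
  destruct (ln_succ_bounds n Hn) as [H1 H2]. split.
  - unfold Rdiv. apply Rmult_le_compat_l; [lra|].
    apply Rle_trans with (/ (INR n + 1)); [apply Rinv_le_contravar; lra|lra].
  - apply Rle_trans with (t * / INR n); [apply Rmult_le_compat_l; lra|].
    apply Rmult_le_reg_r with (INR n); [lra|]. field_simplify; lra.
Qed.

(** The imaginary part alone suffices: for t <= n the rotation angle stays in [t/(2n), 1], where the
    sine is at least half the angle, and the modulus is at least 7/10. *)
Lemma ratio_minus_1 t n : 0 <= t -> (1 <= n)%nat -> t <= INR n ->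
  t / (6 * INR n) <= Cmod (Cminus (ratio t n) 1).
Proof.
  intros Ht Hn Htn. assert (1 <= INR n) by (apply (le_INR 1); lia).
  pose proof (ratio_arg_bounds t n Ht Hn Htn) as Hu.
  pose proof (half_le_sqrt_ratio n Hn) as Hb.
  eapply Rle_trans; [|eapply Rle_trans; [apply Rmax_r|apply Rmax_Cmod]].
  unfold ratio, cis, Cmult, Cminus, Cplus, Copp, RtoC; simpl fst; simpl snd.
  set (u := t * _) in *. set (b := sqrt _) in *.
  replace (b * sin (- u) + 0 * cos (- u) + - 0) with (- (b * sin u))
    by (rewrite sin_neg; ring).
  rewrite Rabs_Ropp.
  assert (0 <= t / (2 * INR n)) by (apply Rdiv_le_0_compat; lra).
  pose proof (sin_ge_half u ltac:(lra)).
  rewrite Rabs_pos_eq by nra.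
  replace (t / (6 * INR n)) with (t / (2 * INR n) / 3) by (field; lra).
  nra.
Qed.

(** The angle is at most 1, so the real part of the ratio is nonnegative. Hence alternating signs
    keep consecutive terms from cancelling the denominator 1 + ratio, uniformly in t. *)
Lemma ratio_plus_1 t n : 0 <= t -> (1 <= n)%nat -> t <= INR n ->
  1 <= Cmod (Cplus 1 (ratio t n)).
Proof.
  intros Ht Hn Htn. assert (1 <= INR n) by (apply (le_INR 1); lia).
  pose proof (ratio_arg_bounds t n Ht Hn Htn) as Hu.
  pose proof (half_le_sqrt_ratio n Hn) as Hb.
  eapply Rle_trans; [|eapply Rle_trans; [apply Rmax_l|apply Rmax_Cmod]].
  unfold ratio, cis, Cmult, Cminus, Cplus, Copp, RtoC; simpl fst; simpl snd.
  set (u := t * _) in *. set (b := sqrt _) in *.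
  rewrite cos_neg. replace (1 + (b * cos u - 0 * sin (- u))) with (1 + b * cos u) by ring.
  assert (0 <= t / (2 * INR n)) by (apply Rdiv_le_0_compat; lra).
  assert (0 <= cos u) by (apply cos_ge_0; pose proof PI2_3_2; lra).
  rewrite Rabs_pos_eq; nra.
Qed.

Lemma sum_inv_sqrt (x n : nat) :
  Rsum (fun k => / sqrt (INR (S k))) (seq x n) <= 2 * sqrt (INR (x + n)).
Proof.
  induction n as [|n IH].
  - simpl. pose proof (sqrt_pos (INR (x + 0))). lra.
  - rewrite Rsum_seq_S, Nat.add_succ_r.
    set (k := (x + n)%nat) in *.
    assert (H0 : 0 <= INR k) by apply pos_INR.
    assert (Hk : 0 < INR (S k)) by (apply lt_0_INR; lia).
    set (a := sqrt (INR k)) in *. set (b := sqrt (INR (S k))) in *.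
    assert (Hb : 0 < b) by (apply sqrt_lt_R0; lra).
    assert (Ha : 0 <= a) by apply sqrt_pos.
    assert (Ea : a * a = INR k) by (apply sqrt_sqrt; lra).
    assert (Eb : b * b = INR k + 1) by (unfold b; rewrite sqrt_sqrt, S_INR; lra).
    apply Rle_trans with (2 * a + / b); [lra|].
    apply Rmult_le_reg_r with b; [lra|]. field_simplify; [|lra].
    (* [2 a b + 1 <= 2 b^2] because [(a - b)^2 >= 0] and [b^2 = a^2 + 1] *)
    assert (0 <= (a - b) ^ 2) by apply pow2_ge_0. nra.
Qed.

(* Kusmin--Landau by summation by parts: the ratio of consecutive terms stays away from 1. *)
Lemma dirichlet_tail (alpha : R) : 0 < alpha -> exists K, 0 < K /\
  forall (t : R) (X n : nat), alpha <= t -> t <= INR X -> (1 <= X)%nat ->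
    Cmod (Csum (zterm t) (seq X n)) <= K * sqrt (INR (X + n)) / t.
Proof.
  (* Each of the two boundary terms contributes 6; the variation of [c] contributes 72, doubled by
     the sum of 1/sqrt k; and (1 + t)/t <= 1 + 1/alpha. *)
  intros Ha. exists (12 + 144 * (1 + / alpha)).
  assert (Hia : 0 < / alpha) by now apply Rinv_0_lt_compat.
  split; [lra|]. intros t X n Hat HtX HX.
  assert (Ht : 0 < t) by lra.
  set (c := fun k => Cinv (Cminus (ratio t k) 1)).
  assert (Hpos : forall k, (X <= k)%nat -> 1 <= INR k /\ t <= INR k).
  { intros k Hk. split; [apply (le_INR 1); lia|].
    apply Rle_trans with (INR X); [lra|apply le_INR; lia]. }
  assert (Hmin : forall k, (X <= k)%nat ->
            0 < t / (6 * INR k) <= Cmod (Cminus (ratio t k) 1)).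
  { intros k Hk. destruct (Hpos k Hk). split; [apply Rdiv_lt_0_compat; lra|].
    apply ratio_minus_1; [lra|lia|lra]. }
  assert (Hne : forall k, (X <= k)%nat -> Cminus (ratio t k) 1 <> 0%C).
  { intros k Hk E. specialize (Hmin k Hk). rewrite E, Cmod_0 in Hmin. lra. }
  assert (Hc : forall k, (X <= k)%nat -> Cmod (c k) <= 6 * INR k / t).
  { intros k Hk. destruct (Hpos k Hk). unfold c. rewrite Cmod_inv by auto.
    replace (6 * INR k / t) with (/ (t / (6 * INR k))) by (field; lra).
    apply Rinv_le_contravar; apply Hmin; auto. }
  assert (Hcd : forall k, (X <= k)%nat ->
    Cmod (Cminus (c (S k)) (c k)) <= 72 * ((1 + t) / (t * t))).
  { intros k Hk. destruct (Hpos k Hk) as [H1 H2].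
    assert (E : Cminus (c (S k)) (c k) =
      Cmult (Cmult (c (S k)) (c k)) (Copp (Cminus (ratio t (S k)) (ratio t k)))).
    { unfold c. field. split; apply Hne; lia. }
    rewrite E, !Cmod_mult, Cmod_opp.
    pose proof (Hc k Hk). pose proof (Hc (S k) ltac:(lia)) as HcS.
    pose proof (ratio_diff t k ltac:(lra) ltac:(lia)) as Hr.
    assert (HcS' : Cmod (c (S k)) <= 12 * INR k / t).
    { eapply Rle_trans; [exact HcS|]. rewrite S_INR. unfold Rdiv.
      apply Rmult_le_compat_r; [left; now apply Rinv_0_lt_compat|lra]. }
    apply Rle_trans with ((12 * INR k / t) * (6 * INR k / t) * ((1 + t) / (INR k * INR k))).
    - apply Rmult_le_compat; auto using Cmod_ge_0.
      + apply Rmult_le_pos; apply Cmod_ge_0.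
      + apply Rmult_le_compat; auto using Cmod_ge_0.
    - right. field. lra. }
  eapply Rle_trans; [apply (sum_by_parts_bound (zterm t) c)|].
  { intros k Hk. rewrite zterm_S by lia. unfold c.
    replace (Cminus (Cmult (ratio t k) (zterm t k)) (zterm t k))
      with (Cmult (Cminus (ratio t k) 1) (zterm t k)) by ring.
    rewrite Cmult_assoc, Cinv_l by auto. ring. }
  assert (Hb : forall k, (X <= k)%nat -> Cmod (c k) * Cmod (zterm t k) <= 6 * sqrt (INR k) / t).
  { intros k Hk. destruct (Hpos k Hk). rewrite Cmod_zterm by lia.
    assert (0 < sqrt (INR k)) by (apply sqrt_lt_R0; lra).
    apply Rle_trans with (6 * INR k / t * / sqrt (INR k)).
    - apply Rmult_le_compat_r; [left; now apply Rinv_0_lt_compat|auto].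
    - rewrite <- (sqrt_sqrt (INR k)) at 1 by lra. right. field. lra. }
  pose proof (Hb X ltac:(lia)) as HX1. pose proof (Hb (X + n)%nat ltac:(lia)) as HX2.
  assert (Hs : sqrt (INR X) <= sqrt (INR (X + n))) by (apply sqrt_le_1_alt, le_INR; lia).
  assert (HS : Rsum (fun k => Cmod (zterm t (S k)) * Cmod (Cminus (c (S k)) (c k))) (seq X n)
     <= 72 * ((1 + t) / (t * t)) * (2 * sqrt (INR (X + n)))).
  { apply Rle_trans with
      (Rsum (fun k => 72 * ((1 + t) / (t * t)) * / sqrt (INR (S k))) (seq X n)).
    - apply Rsum_le. intros k Hk. apply in_seq in Hk. rewrite Cmod_zterm by lia.
      rewrite Rmult_comm. apply Rmult_le_compat_r; [|apply Hcd; lia].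
      left. apply Rinv_0_lt_compat, sqrt_lt_R0, lt_0_INR. lia.
    - rewrite Rsum_scal. apply Rmult_le_compat_l; [|apply sum_inv_sqrt].
      apply Rmult_le_pos; [lra|]. apply Rdiv_le_0_compat; nra. }
  assert (Hta : (1 + t) / (t * t) <= (1 + / alpha) * / t).
  { replace ((1 + t) / (t * t)) with ((1 + / t) * / t) by (field; lra).
    apply Rmult_le_compat_r; [left; now apply Rinv_0_lt_compat|].
    apply Rplus_le_compat_l. apply Rinv_le_contravar; lra. }
  assert (Hq : 0 <= sqrt (INR (X + n))) by apply sqrt_pos.
  assert (Hit : 0 < / t) by now apply Rinv_0_lt_compat.
  set (q := sqrt (INR (X + n))) in *. unfold Rdiv in *.
  assert (72 * ((1 + t) * / (t * t)) * (2 * q) <= 72 * ((1 + / alpha) * / t) * (2 * q))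
    by (apply Rmult_le_compat_r; lra).
  assert (6 * sqrt (INR X) * / t <= 6 * q * / t) by (apply Rmult_le_compat_r; lra).
  nra.
Qed.

Lemma sum_inv_sq (x n : nat) : (1 <= x)%nat ->
  Rsum (fun k => 1 / (INR k * INR k)) (seq (S x) n) <= 1 / INR x - 1 / INR (x + n).
Proof.
  intros Hx. assert (1 <= INR x) by (apply (le_INR 1); lia).
  induction n as [|n IH].
  - simpl. rewrite Nat.add_0_r. lra.
  - rewrite Rsum_seq_S, Nat.add_succ_r, Nat.add_succ_l.
    set (k := (x + n)%nat) in *.
    assert (1 <= INR k) by (apply (le_INR 1); lia).
    assert (1 / (INR (S k) * INR (S k)) + 1 / INR (S k) <= 1 / INR k).
    { rewrite S_INR. apply Rmult_le_reg_r with (INR k * ((INR k + 1) * (INR k + 1))); [nra|].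
      field_simplify; nra. }
    lra.
Qed.

(** With signs the quotient of consecutive terms is -ratio, and [c] = -1/(1 + ratio) is bounded by
    1. The bound 6 is 1 + 1 from the boundary and 4 from the variation, since (1 + t) times the sum
    of 1/k^2 from X on is at most (1 + X) (2/X). *)
Lemma alternating_tail (t : R) (X n : nat) : 0 <= t -> t <= INR X -> (1 <= X)%nat ->
  Cmod (Csum (fun k => Cmult (RtoC ((-1) ^ k)) (zterm t k)) (seq X n)) <= 6.
Proof.
  intros Ht HtX HX.
  set (a := fun k => Cmult (RtoC ((-1) ^ k)) (zterm t k)).
  set (c := fun k => Copp (Cinv (Cplus 1 (ratio t k)))).
  assert (Hpos : forall k, (X <= k)%nat -> 1 <= INR k /\ t <= INR k).
  { intros k Hk. split; [apply (le_INR 1); lia|].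
    apply Rle_trans with (INR X); [lra|apply le_INR; lia]. }
  assert (Hmin : forall k, (X <= k)%nat -> 1 <= Cmod (Cplus 1 (ratio t k))).
  { intros k Hk. apply ratio_plus_1; [lra|lia|]. apply Hpos; auto. }
  assert (Hne : forall k, (X <= k)%nat -> Cplus 1 (ratio t k) <> 0%C).
  { intros k Hk E. specialize (Hmin k Hk). rewrite E, Cmod_0 in Hmin. lra. }
  assert (Hc : forall k, (X <= k)%nat -> Cmod (c k) <= 1).
  { intros k Hk. unfold c. rewrite Cmod_opp, Cmod_inv by auto.
    apply inv_le_1. auto. }
  assert (Ha : forall k, (X <= k)%nat -> Cmod (a k) <= 1).
  { intros k Hk. destruct (Hpos k Hk) as [H1 _]. unfold a.
    rewrite Cmod_mult, Cmod_R, pow_1_abs, Rmult_1_l, Cmod_zterm by lia.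
    now apply inv_le_1, one_le_sqrt. }
  assert (Hcd : forall k, (X <= k)%nat ->
    Cmod (Cminus (c (S k)) (c k)) <= (1 + t) * (1 / (INR k * INR k))).
  { intros k Hk. destruct (Hpos k Hk) as [H1 H2].
    assert (E : Cminus (c (S k)) (c k) =
      Cmult (Cmult (c (S k)) (c k)) (Cminus (ratio t (S k)) (ratio t k))).
    { unfold c. field. split; apply Hne; lia. }
    rewrite E, !Cmod_mult.
    pose proof (Hc k Hk). pose proof (Hc (S k) ltac:(lia)) as HcS.
    pose proof (ratio_diff t k ltac:(lra) ltac:(lia)) as Hr.
    replace ((1 + t) * (1 / (INR k * INR k))) with (1 * 1 * ((1 + t) / (INR k * INR k)))
      by (field; lra).
    apply Rmult_le_compat; auto using Cmod_ge_0.
    - apply Rmult_le_pos; apply Cmod_ge_0.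
    - apply Rmult_le_compat; auto using Cmod_ge_0. }
  eapply Rle_trans; [apply (sum_by_parts_bound a c)|].
  { intros k Hk. unfold a. rewrite zterm_S by lia. unfold c.
    replace ((-1) ^ S k) with (- (-1) ^ k) by (simpl; ring). rewrite RtoC_opp.
    field. auto. }
  assert (Hb : forall k, (X <= k)%nat -> Cmod (c k) * Cmod (a k) <= 1).
  { intros k Hk. rewrite <- (Rmult_1_l 1).
    apply Rmult_le_compat; auto using Cmod_ge_0. }
  pose proof (Hb X ltac:(lia)). pose proof (Hb (X + n)%nat ltac:(lia)).
  assert (HS : Rsum (fun k => Cmod (a (S k)) * Cmod (Cminus (c (S k)) (c k))) (seq X n)
     <= (1 + t) * (2 / INR X)).
  { apply Rle_trans with (Rsum (fun k => (1 + t) * (1 / (INR k * INR k))) (seq X n)).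
    - apply Rsum_le. intros k Hk. apply in_seq in Hk.
      rewrite <- (Rmult_1_l ((1 + t) * _)).
      apply Rmult_le_compat; auto using Cmod_ge_0; [apply Ha; lia|apply Hcd; lia].
    - rewrite Rsum_scal. apply Rmult_le_compat_l; [lra|].
      destruct n as [|n].
      + simpl. apply Rdiv_le_0_compat; [lra|]. apply lt_0_INR. lia.
      + simpl seq. cbn [Rsum]. pose proof (sum_inv_sq X n HX) as HS.
        assert (1 <= INR X) by (apply (le_INR 1); lia).
        assert (0 < 1 / INR (X + n)) by (apply Rdiv_lt_0_compat; [lra|apply lt_0_INR; lia]).
        assert (1 / (INR X * INR X) <= 1 / INR X).
        { unfold Rdiv. rewrite !Rmult_1_l. apply Rinv_le_contravar; nra. }
        replace (2 / INR X) with (1 / INR X + 1 / INR X) by (field; lra). lra. }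
  assert ((1 + t) * (2 / INR X) <= 4).
  { assert (1 <= INR X) by (apply (le_INR 1); lia).
    apply Rmult_le_reg_r with (INR X); [lra|]. field_simplify; [|lra]. nra. }
  lra.
Qed.

(** * From the eta series to zeta on the critical line *)

Lemma dirichlet_zterm X t : dirichlet X t = Csum (zterm t) (seq 1 X).
Proof. reflexivity. Qed.

Lemma Rpower_neg_half x : 0 < x -> Rpower x (-1 / 2) = / sqrt x.
Proof.
  intros Hx. rewrite <- Rpower_sqrt by lra. rewrite <- Rpower_Ropp. f_equal. field.
Qed.

Lemma eta_term_zterm t n : eta_term t n = Cmult (RtoC ((-1) ^ n)) (zterm t (S n)).
Proof.
  unfold eta_term, zterm, cis, Cmult, RtoC. cbn [fst snd].
  rewrite Rpower_neg_half by (apply lt_0_INR; lia).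
  rewrite cos_neg, sin_neg. f_equal; ring.
Qed.

Lemma eta_partial_add t M n :
  eta_partial t (M + n) = Cplus (eta_partial t M)
    (Copp (Csum (fun k => Cmult (RtoC ((-1) ^ k)) (zterm t k)) (seq (S M) n))).
Proof.
  induction n as [|n IH].
  - rewrite Nat.add_0_r. simpl seq. rewrite Csum_nil. ring.
  - rewrite Nat.add_succ_r, Csum_seq_S. cbn [eta_partial].
    rewrite IH, eta_term_zterm. change (S M + n)%nat with (S (M + n)).
    replace ((-1) ^ S (M + n)) with (- (-1) ^ (M + n)) by (simpl; ring).
    rewrite RtoC_opp. ring.
Qed.

Lemma two_pow_cis t : two_pow_one_minus_s t = Cmult (RtoC (sqrt 2)) (cis (- (t * ln 2))).
Proof.
  unfold two_pow_one_minus_s, cis, Cmult, RtoC; cbn [fst snd].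
  rewrite cos_neg, sin_neg. f_equal; ring.
Qed.

Lemma zterm_double t m : (1 <= m)%nat ->
  Cmult 2 (zterm t (2 * m)) = Cmult (two_pow_one_minus_s t) (zterm t m).
Proof.
  intros Hm. assert (0 < INR m) by (apply lt_0_INR; lia).
  unfold zterm. rewrite mult_INR. change (INR 2) with 2.
  rewrite ln_mult, sqrt_mult by lra.
  replace (- (t * (ln 2 + ln (INR m)))) with (- (t * ln 2) + - (t * ln (INR m))) by ring.
  rewrite cis_plus.
  rewrite two_pow_cis.
  assert (0 < sqrt 2) by (apply sqrt_lt_R0; lra).
  assert (0 < sqrt (INR m)) by (apply sqrt_lt_R0; lra).
  replace (/ (sqrt 2 * sqrt (INR m))) with (sqrt 2 / 2 * / sqrt (INR m)).
  - rewrite RtoC_mult, RtoC_div. field. intros E. lra.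
  - rewrite <- (sqrt_sqrt 2) at 2 by lra. field. lra.
Qed.

(** Changing the sign of the even terms subtracts them twice, and 2 (2m)^(-s) = 2^(1-s) m^(-s). At
    even length this is an exact identity between finite sums. *)
Lemma eta_partial_even t X :
  eta_partial t (2 * X) =
    Cminus (dirichlet (2 * X) t) (Cmult (two_pow_one_minus_s t) (dirichlet X t)).
Proof.
  rewrite !dirichlet_zterm. induction X as [|X IH].
  - simpl. rewrite Csum_nil. unfold Cminus, Cmult, Copp, Cplus, RtoC. simpl. f_equal; ring.
  - replace (2 * S X)%nat with (S (S (2 * X))) by lia.
    rewrite (Csum_seq_S _ 1 (S (2 * X))), (Csum_seq_S _ 1 (2 * X)), (Csum_seq_S _ 1 X).
    cbn [eta_partial]. rewrite IH, !eta_term_zterm.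
    replace (1 + S (2 * X))%nat with (2 * (1 + X))%nat by lia.
    replace (S (S (2 * X))) with (2 * (1 + X))%nat by lia.
    replace (1 + 2 * X)%nat with (S (2 * X)) by lia.
    replace ((-1) ^ (2 * X)) with 1 by (now rewrite pow_1_even).
    replace ((-1) ^ S (2 * X)) with (- (1)) by (rewrite pow_1_odd; ring).
    rewrite Cmult_plus_distr_l, <- zterm_double by lia.
    rewrite RtoC_opp. ring.
Qed.

(** [Lim_seq] is monotone under eventual comparison for every sequence, so bounds on all late
    partial sums pass directly to [eta_half]; they also exclude the infinite values, which [real]
    would send to 0. *)
Lemma real_Lim_seq_between (u : nat -> R) (n : nat) (a b : R) :
  (forall k, (n <= k)%nat -> a <= u k <= b) -> a <= real (Lim_seq u) <= b.
Proof.
  intros H.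
  assert (H1 : Rbar_le (Lim_seq u) (Lim_seq (fun _ => b)))
    by (apply Lim_seq_le_loc; exists n; intros; now apply H).
  assert (H2 : Rbar_le (Lim_seq (fun _ => a)) (Lim_seq u))
    by (apply Lim_seq_le_loc; exists n; intros; now apply H).
  rewrite Lim_seq_const in H1, H2. destruct (Lim_seq u); simpl in *; easy.
Qed.

Lemma Cmod_le_sum (z : C) : Cmod z <= Rabs (fst z) + Rabs (snd z).
Proof.
  replace z with (Cplus (RtoC (fst z)) (Cmult Ci (RtoC (snd z)))).
  - eapply Rle_trans; [apply Cmod_triangle|].
    rewrite Cmod_mult, !Cmod_R.
    replace (Cmod Ci) with 1.
    + simpl. rewrite !Rmult_0_l, !Rmult_1_l, Rminus_0_r, !Rplus_0_r, !Rplus_0_l. lra.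
    + unfold Cmod, Ci; simpl. rewrite Rmult_0_l, Rplus_0_l, !Rmult_1_l. symmetry; apply sqrt_1.
  - destruct z. unfold Cplus, Cmult, Ci, RtoC; simpl. f_equal; ring.
Qed.

Lemma fst_le_Cmod (z : C) : Rabs (fst z) <= Cmod z.
Proof. eapply Rle_trans; [apply Rmax_l|apply Rmax_Cmod]. Qed.

Lemma snd_le_Cmod (z : C) : Rabs (snd z) <= Cmod z.
Proof. eapply Rle_trans; [apply Rmax_r|apply Rmax_Cmod]. Qed.

Lemma eta_half_approx t X : 0 <= t -> t <= INR X -> (1 <= X)%nat ->
  Cmod (Cminus (eta_half t) (eta_partial t (2 * X))) <= 12.
Proof.
  intros Ht HtX HX. set (M := (2 * X)%nat).
  assert (H : forall k, (M <= k)%nat -> Cmod (Cminus (eta_partial t k) (eta_partial t M)) <= 6).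
  { intros k Hk. replace k with (M + (k - M))%nat by lia. rewrite eta_partial_add.
    match goal with |- Cmod ?z <= _ => replace z with
      (Copp (Csum (fun k => Cmult (RtoC ((-1) ^ k)) (zterm t k)) (seq (S M) (k - M)))) by ring end.
    rewrite Cmod_opp. apply alternating_tail; [lra| |lia].
    apply Rle_trans with (INR X); [lra|apply le_INR; unfold M; lia]. }
  assert (H1 : forall k, (M <= k)%nat ->
    fst (eta_partial t M) - 6 <= fst (eta_partial t k) <= fst (eta_partial t M) + 6).
  { intros k Hk. pose proof (fst_le_Cmod (Cminus (eta_partial t k) (eta_partial t M))) as E.
    apply Rle_trans with (2 := H k Hk) in E. unfold Cminus, Cplus, Copp in E; cbn [fst snd] in E.
    apply Rabs_le_between in E. lra. }
  assert (H2 : forall k, (M <= k)%nat ->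
    snd (eta_partial t M) - 6 <= snd (eta_partial t k) <= snd (eta_partial t M) + 6).
  { intros k Hk. pose proof (snd_le_Cmod (Cminus (eta_partial t k) (eta_partial t M))) as E.
    apply Rle_trans with (2 := H k Hk) in E. unfold Cminus, Cplus, Copp in E; cbn [fst snd] in E.
    apply Rabs_le_between in E. lra. }
  apply real_Lim_seq_between in H1. apply real_Lim_seq_between in H2.
  eapply Rle_trans; [apply Cmod_le_sum|].
  unfold eta_half, Cminus, Cplus, Copp; cbn [fst snd].
  (* Real and imaginary limits are taken separately, so the tail bound 6 is paid once for each. *)
  apply Rle_trans with (6 + 6); [|lra]. apply Rplus_le_compat; apply Rabs_le; lra.
Qed.

(** On the critical line |2^(1-s)| = sqrt 2, which is at least 4/3. *)
Lemma Cmod_two_pow_minus_1 t : 1 / 3 <= Cmod (Cminus 1 (two_pow_one_minus_s t)).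
Proof.
  assert (E : Cmod (two_pow_one_minus_s t) = sqrt 2)
    by (rewrite two_pow_cis, Cmod_mult, Cmod_cis, Cmod_R, Rmult_1_r; apply Rabs_pos_eq, sqrt_pos).
  assert (H : Cmod (two_pow_one_minus_s t) <= Cmod 1 + Cmod (Cminus 1 (two_pow_one_minus_s t))).
  { replace (two_pow_one_minus_s t) with
      (Cplus 1 (Copp (Cminus 1 (two_pow_one_minus_s t)))) at 1 by ring.
    eapply Rle_trans; [apply Cmod_triangle|]. rewrite Cmod_opp. lra. }
  rewrite E, Cmod_1 in H.
  assert (4 / 3 <= sqrt 2).
  { apply Rsqr_incr_0_var; [|apply sqrt_pos]. rewrite Rsqr_sqrt by lra. unfold Rsqr; lra. }
  lra.
Qed.

(** Allows the length of the Dirichlet polynomial to be changed: from X to 2X in the eta identity,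
    and from order N down to order sqrt N for the short range of l. *)
Lemma dirichlet_diff (alpha : R) : 0 < alpha -> exists K, 0 < K /\
  forall (t : R) (Y X : nat), alpha <= t -> t <= INR Y -> (1 <= Y <= X)%nat ->
    Cmod (Cminus (dirichlet X t) (dirichlet Y t)) <= K * sqrt (INR X) / t.
Proof.
  intros Ha. destruct (dirichlet_tail alpha Ha) as [K [HK H]].
  exists (2 * K). split; [lra|]. intros t Y X Hat HtY HYX.
  rewrite !dirichlet_zterm. replace X with (Y + (X - Y))%nat at 1 by lia.
  rewrite seq_app, Csum_app.
  replace (Cminus (Cplus (Csum (zterm t) (seq 1 Y)) (Csum (zterm t) (seq (1 + Y) (X - Y))))
    (Csum (zterm t) (seq 1 Y))) with (Csum (zterm t) (seq (1 + Y) (X - Y))) by ring.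
  destruct (Nat.eq_dec Y X) as [->|Hne].
  - rewrite Nat.sub_diag. simpl seq. rewrite Csum_nil, Cmod_0.
    apply Rdiv_le_0_compat; [|lra]. apply Rmult_le_pos; [lra|apply sqrt_pos].
  - eapply Rle_trans; [apply H; [lra| |lia]|].
    + apply Rle_trans with (INR Y); [lra|apply le_INR; lia].
    + replace (1 + Y + (X - Y))%nat with (S X) by lia.
      unfold Rdiv. apply Rmult_le_compat_r; [left; apply Rinv_0_lt_compat; lra|].
      assert (Hs : sqrt (INR (S X)) <= 2 * sqrt (INR X)).
      { assert (1 <= INR X) by (apply (le_INR 1); lia).
        replace 2 with (sqrt 4).
        - rewrite <- sqrt_mult by lra. apply sqrt_le_1_alt. rewrite S_INR. lra.
        - replace 4 with (2 * 2) by ring. apply sqrt_square; lra. }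
      nra.
Qed.

(** With q = 2^(1-s), the eta sum of length 2X is (1 - q) S_X + (S_2X - S_X). Dividing by 1 - q, of
    modulus at least 1/3, triples the eta tail 12 and the difference of the two polynomials. *)
Lemma zeta_half_approx (alpha : R) : 0 < alpha -> exists K, 0 < K /\
  forall (t : R) (X : nat), alpha <= t -> t <= INR X -> (1 <= X)%nat ->
    Cmod (Cminus (zeta_half t) (dirichlet X t)) <= K * (1 + sqrt (INR X) / t).
Proof.
  intros Ha. destruct (dirichlet_diff alpha Ha) as [K [HK H]].
  exists (36 + 6 * K). split; [lra|]. intros t X Hat HtX HX.
  set (q := two_pow_one_minus_s t). pose proof (Cmod_two_pow_minus_1 t) as Hq. fold q in Hq.
  assert (Hq0 : Cminus 1 q <> 0%C) by (intros E; rewrite E, Cmod_0 in Hq; lra).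
  assert (E : Cminus (zeta_half t) (dirichlet X t) =
    Cdiv (Cplus (Cminus (eta_half t) (eta_partial t (2 * X)))
                (Cminus (dirichlet (2 * X) t) (dirichlet X t))) (Cminus 1 q)).
  { unfold zeta_half. fold q. rewrite eta_partial_even. fold q. field. auto. }
  rewrite E, Cmod_div by auto.
  apply div_le_of; [lra|].
  eapply Rle_trans; [apply Cmod_triangle|].
  pose proof (eta_half_approx t X ltac:(lra) HtX HX) as H1.
  pose proof (H t X (2 * X)%nat Hat HtX ltac:(lia)) as H2.
  assert (Hs : sqrt (INR (2 * X)) <= 2 * sqrt (INR X)).
  { pose proof (pos_INR X).
    replace 2 with (sqrt 4).
    - rewrite <- sqrt_mult by lra. apply sqrt_le_1_alt. rewrite mult_INR. simpl INR. lra.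
    - replace 4 with (2 * 2) by ring. apply sqrt_square; lra. }
  assert (0 < / t) by (apply Rinv_0_lt_compat; lra).
  assert (Hs' : K * sqrt (INR (2 * X)) / t <= 2 * K * (sqrt (INR X) / t)).
  { unfold Rdiv. replace (2 * K * (sqrt (INR X) * / t)) with (K * (2 * sqrt (INR X)) * / t) by ring.
    apply Rmult_le_compat_r; [lra|]. apply Rmult_le_compat_l; lra. }
  assert (0 <= sqrt (INR X) / t) by (apply Rdiv_le_0_compat; [apply sqrt_pos|lra]).
  set (r := sqrt (INR X) / t) in *.
  assert (0 <= K * r) by (apply Rmult_le_pos; lra).
  assert ((36 + 6 * K) * (1 + r) * (1 / 3) <= (36 + 6 * K) * (1 + r) * Cmod (Cminus 1 q))
    by (apply Rmult_le_compat_l; [apply Rmult_le_pos; lra|lra]).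
  lra.
Qed.

(** * A discrete mean value theorem *)

Lemma Cmod_sq (z : C) : Cmod z ^ 2 = fst z ^ 2 + snd z ^ 2.
Proof. unfold Cmod. rewrite pow2_sqrt; [reflexivity|nra]. Qed.

Lemma Cmod_Csum_sq {A} (c phi : A -> R) (l : list A) :
  Cmod (Csum (fun a => Cmult (RtoC (c a)) (cis (phi a))) l) ^ 2 =
  Rsum (fun a => Rsum (fun b => c a * c b * cos (phi a - phi b)) l) l.
Proof.
  rewrite Cmod_sq. unfold Csum, cis, Cmult, RtoC. cbn [fst snd].
  rewrite (Rsum_ext (fun a => c a * cos (phi a) - 0 * sin (phi a)) (fun a => c a * cos (phi a)))
    by (intros; ring).
  rewrite (Rsum_ext (fun a => c a * sin (phi a) + 0 * cos (phi a)) (fun a => c a * sin (phi a)))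
    by (intros; ring).
  rewrite <- !Rsqr_pow2. unfold Rsqr. rewrite !Rsum_mult, <- Rsum_plus.
  apply Rsum_ext; intros a _. rewrite <- Rsum_plus.
  apply Rsum_ext; intros b _. rewrite cos_minus. ring.
Qed.

Lemma ln_le_sub1 x : 0 < x -> ln x <= x - 1.
Proof.
  intros Hx. replace x with (1 + (x - 1)) at 1 by ring.
  rewrite <- (ln_exp (x - 1)) at 2. apply ln_le; [lra|]. apply exp_ineq1_le.
Qed.

Lemma ln_ge_1_sub_inv x : 0 < x -> 1 - / x <= ln x.
Proof.
  intros Hx. assert (0 < / x) by now apply Rinv_0_lt_compat.
  pose proof (ln_le_sub1 (/ x) H). rewrite ln_Rinv in H0 by lra. lra.
Qed.

(** * The cosine kernel and its sums over logarithms of integers *)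

Definition dirichlet_kernel (H : nat) (theta : R) : R :=
  Rsum (fun l => cos (INR l * theta)) (seq 0 H).

Lemma dirichlet_kernel_le H theta : Rabs (dirichlet_kernel H theta) <= INR H.
Proof.
  unfold dirichlet_kernel. eapply Rle_trans; [apply Rabs_Rsum_le|].
  rewrite <- (Rmult_1_r (INR H)). rewrite <- (length_seq H 0) at 2.
  apply Rsum_le_const. intros a _. apply Rabs_le, COS_bound.
Qed.

Lemma dirichlet_kernel_period H theta (q : Z) :
  dirichlet_kernel H (theta - 2 * IZR q * PI) = dirichlet_kernel H theta.
Proof.
  apply Rsum_ext; intros l _.
  pose proof (cis_period (INR l * theta) (- (Z.of_nat l * q))) as E.
  injection E as E _. rewrite <- E. f_equal.
  rewrite opp_IZR, mult_IZR, <- INR_IZR_INZ. ring.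
Qed.

Lemma dirichlet_kernel_sin H theta :
  2 * sin (theta / 2) * dirichlet_kernel H theta =
  sin ((INR H - 1 / 2) * theta) + sin (theta / 2).
Proof.
  unfold dirichlet_kernel. induction H as [|H IH].
  - simpl. replace ((0 - 1 / 2) * theta) with (- (theta / 2)) by field. rewrite sin_neg. ring.
  - rewrite Rsum_seq_S, Rmult_plus_distr_l, IH. rewrite Nat.add_0_l, S_INR.
    replace ((INR H + 1 - 1 / 2) * theta) with (INR H * theta + theta / 2) by field.
    replace ((INR H - 1 / 2) * theta) with (INR H * theta - theta / 2) by field.
    rewrite sin_plus, sin_minus. ring.
Qed.

Lemma sin_ge_quarter x : 0 <= x <= PI / 2 -> x / 4 <= sin x.
Proof.
  intros Hx. pose proof PI_4. pose proof PI2_3_2. destruct (Rle_dec x 1).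
  - pose proof (sin_ge_half x ltac:(lra)). lra.
  - pose proof (sin_ge_half 1 ltac:(lra)).
    assert (sin 1 <= sin x) by (apply sin_incr_1; lra). lra.
Qed.

(* [min(H, 8/|u|)] is at most the harmonic mean [16 / (8/H + |u|)]. *)
Definition bump (H : nat) (u : R) : R := 16 / (8 / INR H + Rabs u).

Lemma bump_pos H u : (1 <= H)%nat -> 0 < bump H u.
Proof.
  intros HH. assert (0 < INR H) by (apply lt_0_INR; lia).
  apply Rdiv_lt_0_compat; [lra|]. pose proof (Rabs_pos u).
  assert (0 < 8 / INR H) by (apply Rdiv_lt_0_compat; lra). lra.
Qed.

(** The trivial bound gives (8/H) |D| <= 8 and the closed form gives |u| |D| <= 8; adding the two
    yields the majorant. *)
Lemma dirichlet_kernel_bump H u : (1 <= H)%nat -> Rabs u <= PI ->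
  Rabs (dirichlet_kernel H u) <= bump H u.
Proof.
  intros HH Hu. assert (HH' : 1 <= INR H) by (apply (le_INR 1); lia).
  pose proof (dirichlet_kernel_le H u) as H1.
  assert (H2 : Rabs u * Rabs (dirichlet_kernel H u) <= 8).
  { pose proof (dirichlet_kernel_sin H u) as E.
    assert (Hs : Rabs u / 8 <= Rabs (sin (u / 2))).
    { unfold Rabs at 1. unfold Rabs in Hu. destruct (Rcase_abs u).
      - pose proof (sin_ge_quarter (- u / 2) ltac:(lra)) as Hs.
        replace (- u / 2) with (- (u / 2)) in Hs by field. rewrite sin_neg in Hs.
        rewrite <- Rabs_Ropp. eapply Rle_trans; [|apply Rle_abs]. lra.
      - pose proof (sin_ge_quarter (u / 2) ltac:(lra)) as Hs.
        eapply Rle_trans; [|apply Rle_abs]. lra. }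
    assert (Hd : 2 * Rabs (sin (u / 2)) * Rabs (dirichlet_kernel H u) <= 2).
    { replace (2 * Rabs (sin (u / 2)) * Rabs (dirichlet_kernel H u))
        with (Rabs (2 * sin (u / 2) * dirichlet_kernel H u))
        by (rewrite !Rabs_mult, (Rabs_pos_eq 2); lra).
      rewrite E. pose proof (SIN_bound ((INR H - 1 / 2) * u)).
      pose proof (SIN_bound (u / 2)). apply Rabs_le; lra. }
    pose proof (Rabs_pos (dirichlet_kernel H u)). nra. }
  unfold bump. pose proof (Rabs_pos u).
  assert (H3 : 8 / INR H * INR H = 8) by (field; lra).
  assert (0 < 8 / INR H) by (apply Rdiv_lt_0_compat; lra).
  apply le_div_of; [lra|]. 
  pose proof (Rabs_pos (dirichlet_kernel H u)). nra.
Qed.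

(** The bound on [q] limits how many multiples of 2 pi have to be considered, so that the reduction
    modulo 2 pi can be replaced by a finite sum over all candidates. *)
Lemma nearest_period theta : exists q : Z,
  Rabs (theta - 2 * IZR q * PI) <= PI /\ Rabs (IZR q) <= Rabs theta + 1.
Proof.
  pose proof PI_RGT_0 as HP. pose proof PI2_3_2 as HP'.
  set (x := theta / (2 * PI) + 1 / 2).
  exists (up x - 1)%Z. destruct (archimed x) as [H1 H2]. rewrite minus_IZR.
  assert (E : theta = (x - 1 / 2) * (2 * PI)) by (unfold x; field; lra).
  split.
  - rewrite E. apply Rabs_le. split; nra.
  - assert (Hx : Rabs (x - 1 / 2) <= Rabs theta / 2).
    { rewrite E at 1. rewrite Rabs_mult, (Rabs_pos_eq (2 * PI)) by lra.
      pose proof (Rabs_pos (x - 1 / 2)). nra. }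
    pose proof (Rabs_pos theta).
    apply Rabs_le_between in Hx. apply Rabs_le. lra.
Qed.

Lemma sum_inv_dist (M : R) (Y : nat) : 0 <= M <= INR Y ->
  Rsum (fun m => / (1 + Rabs (INR m - M))) (seq 1 Y) <= 4 * ln (INR Y + 2).
Proof.
  intros HM.
  (* An odd antiderivative of 1/(1 + |u|); over a unit step it grows by at least half the value at
     the left end, and the sum telescopes. *)
  set (phi := fun u : R => if Rle_dec 0 u then ln (1 + u) else - ln (1 - u)).
  assert (Hphi : forall u, / 2 * / (1 + Rabs u) <= phi (u + 1) - phi u).
  { intros u. unfold phi. destruct (Rle_dec 0 u) as [Hu|Hu].
    - rewrite Rabs_pos_eq by lra. destruct (Rle_dec 0 (u + 1)); [|lra].
      rewrite <- ln_div by lra.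
      eapply Rle_trans; [|apply ln_ge_1_sub_inv; apply Rdiv_lt_0_compat; lra].
      rewrite <- Rinv_mult. replace (1 - / ((1 + (u + 1)) / (1 + u))) with (/ (2 + u)) by (field; lra).
      apply Rinv_le_contravar; lra.
    - rewrite Rabs_left by lra. destruct (Rle_dec 0 (u + 1)).
      + replace (ln (1 + (u + 1)) - - ln (1 - u)) with (ln (1 + (u + 1)) + ln (1 - u)) by ring.
        rewrite <- ln_mult by lra.
        apply Rle_trans with (/ 2 * 1).
        * apply Rmult_le_compat_l; [lra|]. apply inv_le_1. lra.
        * apply Rle_trans with (1 - / 2); [lra|].
          eapply Rle_trans; [apply ln_ge_1_sub_inv; lra|]. apply ln_le; nra.
      + replace (- ln (1 - (u + 1)) - - ln (1 - u)) with (ln (1 - u) - ln (- u)) by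
          (replace (1 - (u + 1)) with (- u) by ring; ring).
        rewrite <- ln_div by lra.
        eapply Rle_trans; [|apply ln_ge_1_sub_inv; apply Rdiv_lt_0_compat; lra].
        replace (1 - / ((1 - u) / - u)) with (/ (1 + - u)) by (field; lra).
        assert (0 < / (1 + - u)) by (apply Rinv_0_lt_compat; lra). lra. }
  assert (Htel : forall n, Rsum (fun m => / 2 * / (1 + Rabs (INR m - M))) (seq 1 n)
     <= phi (INR (S n) - M) - phi (1 - M)).
  { induction n as [|n IH].
    - simpl. lra.
    - rewrite Rsum_seq_S. change (1 + n)%nat with (S n). specialize (Hphi (INR (S n) - M)).
      replace (INR (S (S n)) - M) with (INR (S n) - M + 1) by (rewrite (S_INR (S n)); ring).
      lra. }
  specialize (Htel Y). rewrite Rsum_scal in Htel.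
  assert (H0 : 0 <= INR Y) by apply pos_INR.
  assert (phi (INR (S Y) - M) <= ln (INR Y + 2)).
  { unfold phi. rewrite S_INR. destruct (Rle_dec 0 (INR Y + 1 - M)); [|lra]. apply ln_le; lra. }
  assert (- phi (1 - M) <= ln (INR Y + 2)).
  { unfold phi. destruct (Rle_dec 0 (1 - M)).
    - apply Rle_trans with (- ln 1).
      + apply Ropp_le_contravar, ln_le; lra.
      + rewrite ln_1, Ropp_0, <- ln_1. apply ln_le; lra.
    - rewrite Ropp_involutive. apply ln_le; lra. }
  lra.
Qed.

(** On (0, Y] the logarithm has slope at least 1/Y, and lowering M to Y only brings it closer to m.
    The cap matters because M will be e^(tau/alpha), which can be far outside the range of
    summation. *)
Lemma ln_dist (m Y M : R) : 0 < m <= Y -> 0 < M ->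
  Rabs (m - Rmin M Y) / Y <= Rabs (ln m - ln M).
Proof.
  intros Hm HM. destruct (Rle_dec m (Rmin M Y)) as [H|H].
  - rewrite Rabs_left1 by lra. rewrite <- Rabs_Ropp.
    eapply Rle_trans; [|apply Rle_abs].
    pose proof (Rmin_r M Y). pose proof (Rmin_l M Y). set (M' := Rmin M Y) in *.
    apply Rle_trans with (ln M' - ln m).
    + rewrite <- ln_div by lra.
      eapply Rle_trans; [|apply ln_ge_1_sub_inv; apply Rdiv_lt_0_compat; lra].
      replace (1 - / (M' / m)) with (- (m - M') / M') by (field; lra).
      unfold Rdiv. apply Rmult_le_compat_l; [lra|]. apply Rinv_le_contravar; lra.
    + assert (ln M' <= ln M) by (apply ln_le; lra). lra.
  - assert (HM' : Rmin M Y = M) by (unfold Rmin in *; destruct (Rle_dec M Y); lra).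
    rewrite HM' in *. rewrite Rabs_pos_eq by lra.
    eapply Rle_trans; [|apply Rle_abs].
    rewrite <- ln_div by lra.
    eapply Rle_trans; [|apply ln_ge_1_sub_inv; apply Rdiv_lt_0_compat; lra].
    replace (1 - / (m / M)) with ((m - M) / m) by (field; lra).
    unfold Rdiv. apply Rmult_le_compat_l; [lra|]. apply Rinv_le_contravar; lra.
Qed.

(** The phase vanishes at m = e^(tau/alpha). Since Y <= c H, the phase moves by at least a constant
    multiple of 1/H per unit step of m, so the bump is O(H / (1 + distance)) and a harmonic sum
    remains. *)
Lemma sum_bump_log (alpha c : R) : 0 < alpha -> 0 < c -> exists K, 0 < K /\
  forall (H Y : nat) (tau : R), (1 <= H)%nat -> (1 <= Y)%nat -> INR Y <= c * INR H ->
    Rsum (fun m => bump H (alpha * ln (INR m) - tau)) (seq 1 Y)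
      <= K * INR H * ln (INR Y + 2).
Proof.
  intros Ha Hc. set (kappa := Rmin 8 (alpha / c)).
  assert (Hk : 0 < kappa) by (apply Rmin_glb_lt; [lra|now apply Rdiv_lt_0_compat]).
  exists (16 / kappa * 4). split; [apply Rmult_lt_0_compat; [apply Rdiv_lt_0_compat|]; lra|].
  intros H Y tau HH HY HYH.
  assert (HH' : 1 <= INR H) by (apply (le_INR 1); lia).
  assert (HY' : 1 <= INR Y) by (apply (le_INR 1); lia).
  set (M := exp (tau / alpha)). assert (HM : 0 < M) by apply exp_pos.
  set (M' := Rmin M (INR Y)).
  apply Rle_trans with (Rsum (fun m => 16 / kappa * INR H * / (1 + Rabs (INR m - M'))) (seq 1 Y)).
  - apply Rsum_le. intros m Hm. apply in_seq in Hm.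
    assert (Hm1 : 0 < INR m <= INR Y) by (split; [apply lt_0_INR|apply le_INR]; lia).
    pose proof (ln_dist (INR m) (INR Y) M Hm1 HM) as Hd. fold M' in Hd.
    assert (E : alpha * ln (INR m) - tau = alpha * (ln (INR m) - ln M)).
    { unfold M. rewrite ln_exp. field. lra. }
    unfold bump. rewrite E, Rabs_mult, (Rabs_pos_eq alpha) by lra.
    set (d := Rabs (INR m - M')) in *. assert (Hd0 : 0 <= d) by apply Rabs_pos.
    assert (Hlow : kappa / INR H * (1 + d) <= 8 / INR H + alpha * Rabs (ln (INR m) - ln M)).
    { assert (H1 : kappa <= 8) by apply Rmin_l.
      assert (H2 : kappa <= alpha / c) by apply Rmin_r.
      assert (Hi : 0 < / INR H) by (apply Rinv_0_lt_compat; lra).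
      assert (kappa * / INR H <= 8 * / INR H) by (apply Rmult_le_compat_r; lra).
      assert (kappa / INR H * d <= alpha * (d / INR Y)).
      { replace (kappa / INR H * d) with (kappa * d / INR H) by (field; lra).
        apply div_le_of; [lra|].
        replace (alpha * (d / INR Y) * INR H) with (d * (alpha * INR H / INR Y)) by (field; lra).
        rewrite Rmult_comm. apply Rmult_le_compat_l; [lra|].
        apply le_div_of; [lra|].
        apply Rle_trans with (kappa * (c * INR H)); [apply Rmult_le_compat_l; lra|].
        apply Rle_trans with (alpha / c * (c * INR H)); [apply Rmult_le_compat_r; nra|].
        right. field. lra. }
      assert (alpha * (d / INR Y) <= alpha * Rabs (ln (INR m) - ln M))
        by (apply Rmult_le_compat_l; lra).
      unfold Rdiv in *. lra. }
    assert (0 < kappa / INR H) by (apply Rdiv_lt_0_compat; lra).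
    apply Rle_trans with (16 / (kappa / INR H * (1 + d))).
    + unfold Rdiv at 1 3. apply Rmult_le_compat_l; [lra|]. apply Rinv_le_contravar; [nra|lra].
    + right. field. lra.
  - rewrite Rsum_scal.
    replace (16 / kappa * 4 * INR H * ln (INR Y + 2))
      with (16 / kappa * INR H * (4 * ln (INR Y + 2))) by ring.
    apply Rmult_le_compat_l.
    + apply Rmult_le_pos; [apply Rdiv_le_0_compat|]; lra.
    + apply sum_inv_dist. unfold M'. split.
      * apply Rmin_glb; lra.
      * apply Rmin_r.
Qed.

Definition Zrange (J : nat) : list Z := map (fun j => Z.of_nat j - Z.of_nat J)%Z (seq 0 (2 * J + 1)).

Lemma in_Zrange J q : Rabs (IZR q) <= INR J -> In q (Zrange J).
Proof.
  intros Hq. rewrite INR_IZR_INZ in Hq. apply Rabs_le_between in Hq.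
  rewrite <- opp_IZR in Hq. destruct Hq as [H1 H2].
  apply le_IZR in H1. apply le_IZR in H2.
  apply in_map_iff. exists (Z.to_nat (q + Z.of_nat J)). split; [lia|].
  apply in_seq. lia.
Qed.

Lemma ln_nonneg_nat n : (1 <= n)%nat -> 0 <= ln (INR n).
Proof.
  intros Hn. rewrite <- ln_1. apply ln_le; [lra|]. apply (le_INR 1); lia.
Qed.

Lemma harmonic_le (Y : nat) : Rsum (fun n => / INR n) (seq 1 Y) <= 2 * ln (INR Y + 2).
Proof.
  assert (H : forall n, Rsum (fun k => / INR k) (seq 1 n) <= 2 * (ln (INR n + 1))).
  { induction n as [|n IH].
    - simpl. rewrite Rplus_0_l, ln_1. lra.
    - rewrite Rsum_seq_S. change (1 + n)%nat with (S n).
      rewrite S_INR. pose proof (pos_INR n).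
      pose proof (ln_ge_1_sub_inv ((INR n + 1 + 1) / (INR n + 1))
        ltac:(apply Rdiv_lt_0_compat; lra)) as Hl.
      rewrite ln_div in Hl by lra.
      replace (1 - / ((INR n + 1 + 1) / (INR n + 1))) with (/ (INR n + 1 + 1)) in Hl by (field; lra).
      assert (/ (INR n + 1) <= 2 * / (INR n + 1 + 1)).
      { replace (2 * / (INR n + 1 + 1)) with (/ ((INR n + 1 + 1) / 2)) by (field; lra).
        apply Rinv_le_contravar; lra. }
      lra. }
  eapply Rle_trans; [apply H|]. pose proof (pos_INR Y).
  apply Rmult_le_compat_l; [lra|]. apply ln_le; lra.
Qed.

(** Sampling at integers sees phases modulo 2 pi only, so besides m near n the pairs with alpha
    log(m/n) near 2 pi q have to be counted. Bounding 1/sqrt(mn) by the mean of 1/m and 1/n reduces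
    this to one n at a time. The three logarithms come from the number of q, from [sum_bump_log] and
    from the harmonic sum. *)
Lemma dirichlet_mean_square (alpha c : R) : 0 < alpha -> 0 < c -> exists K, 0 < K /\
  forall H Y : nat, (1 <= H)%nat -> (1 <= Y)%nat -> INR Y <= c * INR H ->
    Rsum (fun l => Cmod (dirichlet Y (alpha * INR l)) ^ 2) (seq 0 H)
      <= K * INR H * ln (INR Y + 2) ^ 3.
Proof.
  intros Ha Hc. destruct (sum_bump_log alpha c Ha Hc) as [K [HK HB]].
  exists (K * 2 * (2 * alpha + 7)). split; [apply Rmult_lt_0_compat; lra|].
  intros H Y HH HY HYH.
  assert (HH' : 1 <= INR H) by (apply (le_INR 1); lia).
  assert (HY' : 1 <= INR Y) by (apply (le_INR 1); lia).
  set (L := ln (INR Y + 2)).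
  assert (HL : 1 <= L).
  { unfold L. rewrite <- (ln_exp 1) at 1. apply ln_le; [apply exp_pos|]. pose proof exp_le_3. lra. }
  set (g := fun m n => Rabs (dirichlet_kernel H (alpha * ln (INR m) - alpha * ln (INR n)))).
  assert (Hinner : forall n, (1 <= n <= Y)%nat ->
    Rsum (fun m => g m n) (seq 1 Y) <= (2 * alpha + 7) * L * (K * INR H * L)).
  { intros n Hn.
    (* Phases differ by at most [alpha * L], so the nearest period has index at most
       [alpha * L + 1], which is below [J]; the 2J + 1 candidates number at most
       [(2 * alpha + 7) * L] since [L >= 1]. *)
    destruct (nfloor_ex (alpha * L + 2)) as [J HJ]; [nra|].
    apply Rle_trans with (Rsum (fun m => Rsum (fun q : Z =>
       bump H (alpha * ln (INR m) - (alpha * ln (INR n) + 2 * IZR q * PI))) (Zrange J)) (seq 1 Y)).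
    - apply Rsum_le. intros m Hm. apply in_seq in Hm.
      set (th := alpha * ln (INR m) - alpha * ln (INR n)).
      destruct (nearest_period th) as [q [Hq1 Hq2]].
      assert (Hth : Rabs th <= alpha * L).
      { unfold th. rewrite <- Rmult_minus_distr_l, Rabs_mult, (Rabs_pos_eq alpha) by lra.
        apply Rmult_le_compat_l; [lra|].
        pose proof (ln_nonneg_nat m ltac:(lia)). pose proof (ln_nonneg_nat n ltac:(lia)).
        assert (forall k, (1 <= k <= Y)%nat -> ln (INR k) <= L).
        { intros k Hk. apply ln_le; [apply lt_0_INR; lia|].
          assert (INR k <= INR Y) by (apply le_INR; lia). lra. }
        pose proof (H2 m ltac:(lia)). pose proof (H2 n ltac:(lia)). apply Rabs_le; lra. }
      apply Rle_trans with (bump H (alpha * ln (INR m) - (alpha * ln (INR n) + 2 * IZR q * PI))).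
      + unfold g. fold th. rewrite <- (dirichlet_kernel_period H th q).
        replace (alpha * ln (INR m) - (alpha * ln (INR n) + 2 * IZR q * PI))
          with (th - 2 * IZR q * PI) by (unfold th; ring).
        now apply dirichlet_kernel_bump.
      + apply (Rsum_in_le (fun q => bump H (alpha * ln (INR m) - (alpha * ln (INR n) + 2 * IZR q * PI)))).
        * intros b _. left. now apply bump_pos.
        * apply in_Zrange. lra.
    - rewrite Rsum_swap.
      eapply Rle_trans; [apply (Rsum_le_const _ (K * INR H * L))|].
      + intros q _. now apply HB.
      + apply Rmult_le_compat_r; [apply Rmult_le_pos; [apply Rmult_le_pos|]; lra|].
        unfold Zrange. rewrite length_map, length_seq, plus_INR, mult_INR. simpl INR. nra. }
  assert (E : Rsum (fun l => Cmod (dirichlet Y (alpha * INR l)) ^ 2) (seq 0 H) =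
    Rsum (fun m => Rsum (fun n => / sqrt (INR m) * / sqrt (INR n) *
      dirichlet_kernel H (alpha * ln (INR m) - alpha * ln (INR n))) (seq 1 Y)) (seq 1 Y)).
  { rewrite (Rsum_ext _ (fun l => Rsum (fun m => Rsum (fun n => / sqrt (INR m) * / sqrt (INR n) *
       cos (INR l * (alpha * ln (INR m) - alpha * ln (INR n)))) (seq 1 Y)) (seq 1 Y))).
    - rewrite Rsum_swap. apply Rsum_ext; intros m _.
      rewrite Rsum_swap. apply Rsum_ext; intros n _.
      unfold dirichlet_kernel. now rewrite <- Rsum_scal.
    - intros l _. unfold dirichlet. rewrite Cmod_Csum_sq.
      apply Rsum_ext; intros m _. apply Rsum_ext; intros n _.
      f_equal. rewrite <- (cos_neg (INR l * _)). f_equal. ring. }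
  rewrite E.
  apply Rle_trans with (Rsum (fun m => Rsum (fun n => (/ 2 * / INR m) * g m n + (/ 2 * / INR n) * g m n)
    (seq 1 Y)) (seq 1 Y)).
  { apply Rsum_le. intros m Hm. apply in_seq in Hm. apply Rsum_le. intros n Hn. apply in_seq in Hn.
    assert (Hm' : 0 < INR m) by (apply lt_0_INR; lia).
    assert (Hn' : 0 < INR n) by (apply lt_0_INR; lia).
    set (a := / sqrt (INR m)). set (b := / sqrt (INR n)).
    assert (Ea : / INR m = a * a) by (unfold a; rewrite <- Rinv_mult, sqrt_sqrt; lra).
    assert (Eb : / INR n = b * b) by (unfold b; rewrite <- Rinv_mult, sqrt_sqrt; lra).
    assert (0 < a) by (apply Rinv_0_lt_compat, sqrt_lt_R0; lra).
    assert (0 < b) by (apply Rinv_0_lt_compat, sqrt_lt_R0; lra).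
    rewrite Ea, Eb.
    assert (a * b * dirichlet_kernel H (alpha * ln (INR m) - alpha * ln (INR n)) <= a * b * g m n)
      by (apply Rmult_le_compat_l; [nra|apply Rle_abs]).
    assert (Hg : 0 <= g m n) by apply Rabs_pos.
    assert (0 <= (a - b) ^ 2 * g m n) by (apply Rmult_le_pos; [apply pow2_ge_0|lra]).
    nra. }
  assert (Hsym : forall m n, g m n = g n m).
  { intros m n. unfold g. f_equal. unfold dirichlet_kernel. apply Rsum_ext; intros l _.
    rewrite <- cos_neg. f_equal. ring. }
  rewrite (Rsum_ext _ (fun m => / 2 * / INR m * Rsum (fun n => g m n) (seq 1 Y) +
     Rsum (fun n => / 2 * / INR n * g m n) (seq 1 Y)))
    by (intros; now rewrite Rsum_plus, Rsum_scal).
  rewrite Rsum_plus, (Rsum_swap (fun m n => / 2 * / INR n * g m n)).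
  assert (Hhalf : Rsum (fun m => / 2 * / INR m * Rsum (fun n => g n m) (seq 1 Y)) (seq 1 Y)
     <= / 2 * ((2 * alpha + 7) * L * (K * INR H * L)) * (2 * L)).
  { apply Rle_trans with
      (Rsum (fun m => / 2 * ((2 * alpha + 7) * L * (K * INR H * L)) * / INR m) (seq 1 Y)).
    - apply Rsum_le. intros m Hm. apply in_seq in Hm.
      rewrite !(Rmult_assoc (/ 2)). apply Rmult_le_compat_l; [lra|].
      rewrite Rmult_comm. apply Rmult_le_compat_r.
      + left. apply Rinv_0_lt_compat, lt_0_INR. lia.
      + apply Hinner. lia.
    - rewrite Rsum_scal. apply Rmult_le_compat_l.
      + repeat apply Rmult_le_pos; lra.
      + apply harmonic_le. }
  rewrite (Rsum_ext (fun b => Rsum (fun a => / 2 * / INR b * g a b) (seq 1 Y))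
             (fun m => / 2 * / INR m * Rsum (fun n => g n m) (seq 1 Y)))
    by (intros; now rewrite Rsum_scal).
  rewrite (Rsum_ext (fun m => / 2 * / INR m * Rsum (fun n => g m n) (seq 1 Y))
             (fun m => / 2 * / INR m * Rsum (fun n => g n m) (seq 1 Y))).
  - eapply Rle_trans; [apply Rplus_le_compat; apply Hhalf|]. right. field.
  - intros m _. f_equal. apply Rsum_ext. intros n _. apply Hsym.
Qed.

(** * The resonance inequality *)

Definition phase_bin (B : nat) (x : R) : nat :=
  Z.to_nat (Int_part (INR B * frac_part (x / (2 * PI)))).

Lemma phase_bin_spec (x : R) (B : nat) : (1 <= B)%nat ->
  (phase_bin B x < B)%nat /\ exists (q : Z) (e : R),
    0 <= e < 1 /\ x = 2 * PI * (INR (phase_bin B x) + e) / INR B + 2 * IZR q * PI.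
Proof.
  intros HB. assert (HB' : 1 <= INR B) by (apply (le_INR 1); lia).
  pose proof PI_RGT_0 as HP. unfold phase_bin.
  set (y := x / (2 * PI)). destruct (base_fp y) as [H1 H2].
  set (f := frac_part y) in *.
  destruct (base_Int_part (INR B * f)) as [H3 H4]. set (z := Int_part (INR B * f)) in *.
  assert (Hz : (-1 < z)%Z) by (apply lt_IZR; simpl; nra).
  assert (Ez : INR (Z.to_nat z) = IZR z) by (rewrite INR_IZR_INZ, Z2Nat.id; [easy|lia]).
  split.
  - apply INR_lt. rewrite Ez. nra.
  - exists (Int_part y), (INR B * f - IZR z). rewrite Ez. split; [lra|].
    replace x with (2 * PI * y) by (unfold y; field; lra).
    replace (2 * PI * (IZR z + (INR B * f - IZR z)) / INR B) with (2 * PI * f) by (field; lra).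
    unfold f, frac_part. ring.
Qed.

(** * Parseval on the grid of phases *)

Definition trig_poly (B : nat) (r : nat -> R) (u : R) : C :=
  Csum (fun j => Cmult (RtoC (r j)) (cis (- (u * (2 * PI * INR j / INR B))))) (seq 0 B).

Lemma dirichlet_kernel_0 H : dirichlet_kernel H 0 = INR H.
Proof.
  unfold dirichlet_kernel. rewrite (Rsum_ext _ (fun _ => 1)).
  - rewrite Rsum_const, length_seq. ring.
  - intros; now rewrite Rmult_0_r, cos_0.
Qed.

(** B times the angle is a multiple of 2 pi, so the numerator in [dirichlet_kernel_sin] vanishes,
    while |i - j| < B keeps [sin (th / 2)] away from 0. *)
Lemma dirichlet_kernel_orthogonal (B i j : nat) : (i < B)%nat -> (j < B)%nat ->
  dirichlet_kernel B (2 * PI * INR i / INR B - 2 * PI * INR j / INR B)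
    = if Nat.eq_dec i j then INR B else 0.
Proof.
  intros Hi Hj. destruct (Nat.eq_dec i j) as [->|Hne].
  { rewrite Rminus_diag. apply dirichlet_kernel_0. }
  pose proof PI_RGT_0 as HP.
  assert (HB : 0 < INR B) by (apply lt_0_INR; lia).
  set (th := 2 * PI * INR i / INR B - 2 * PI * INR j / INR B).
  pose proof (dirichlet_kernel_sin B th) as E.
  assert (Es : sin ((INR B - 1 / 2) * th) = - sin (th / 2)).
  { pose proof (cis_period (- (th / 2)) (Z.of_nat i - Z.of_nat j)) as Ec.
    injection Ec as _ Ec. rewrite sin_neg in Ec. rewrite <- Ec. f_equal.
    rewrite minus_IZR, <- !INR_IZR_INZ. unfold th. field. lra. }
  rewrite Es in E.
  assert (Hs : sin (th / 2) <> 0).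
  { assert (Hth : th / 2 = PI * ((INR i - INR j) / INR B)) by (unfold th; field; lra).
    apply lt_INR in Hi. apply lt_INR in Hj. pose proof (pos_INR i). pose proof (pos_INR j).
    destruct (Rtotal_order (INR i) (INR j)) as [Hlt|[Heq|Hgt]].
    - rewrite <- (Ropp_involutive (th / 2)), sin_neg. apply Ropp_neq_0_compat, Rgt_not_eq.
      assert (0 < (INR j - INR i) / INR B < 1).
      { split; [apply Rdiv_lt_0_compat; lra|]. apply Rmult_lt_reg_r with (INR B); [lra|].
        field_simplify; lra. }
      assert (Hth' : - (th / 2) = PI * ((INR j - INR i) / INR B)) by (rewrite Hth; field; lra).
      rewrite Hth'. apply sin_gt_0; nra.
    - apply INR_eq in Heq. contradiction.
    - apply Rgt_not_eq.
      assert (0 < (INR i - INR j) / INR B < 1).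
      { split; [apply Rdiv_lt_0_compat; lra|]. apply Rmult_lt_reg_r with (INR B); [lra|].
        field_simplify; lra. }
      rewrite Hth. apply sin_gt_0; nra. }
  assert (E' : (2 * sin (th / 2)) * dirichlet_kernel B th = 0) by lra.
  apply Rmult_integral in E'. destruct E'; lra.
Qed.

Lemma Rsum_delta (B j : nat) (f : nat -> R) : (j < B)%nat ->
  Rsum (fun i => if Nat.eq_dec j i then f i else 0) (seq 0 B) = f j.
Proof.
  intros Hj. replace B with (j + (1 + (B - j - 1)))%nat by lia.
  rewrite !seq_app, !Rsum_app. simpl seq at 2. cbn [Rsum].
  rewrite Rsum_zero, (Rsum_zero _ (seq (0 + j + 1) _)).
  - simpl. destruct (Nat.eq_dec j j); [ring|easy].
  - intros a Ha. apply in_seq in Ha. destruct (Nat.eq_dec j a); [lia|easy].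
  - intros a Ha. apply in_seq in Ha. destruct (Nat.eq_dec j a); [lia|easy].
Qed.

Lemma trig_poly_parseval (B : nat) (r : nat -> R) : (1 <= B)%nat ->
  Rsum (fun l => Cmod (trig_poly B r (INR l)) ^ 2) (seq 0 B)
    = INR B * Rsum (fun j => r j ^ 2) (seq 0 B).
Proof.
  intros HB.
  rewrite (Rsum_ext _ (fun l => Rsum (fun i => Rsum (fun j => r i * r j *
    cos (INR l * (2 * PI * INR i / INR B - 2 * PI * INR j / INR B))) (seq 0 B)) (seq 0 B))).
  - rewrite Rsum_swap, <- Rsum_scal. apply Rsum_ext; intros i Hi. apply in_seq in Hi.
    rewrite Rsum_swap.
    rewrite (Rsum_ext _ (fun j => if Nat.eq_dec i j then r i * r j * INR B else 0)).
    + rewrite Rsum_delta by lia. ring.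
    + intros j Hj. apply in_seq in Hj. rewrite Rsum_scal.
      fold (dirichlet_kernel B (2 * PI * INR i / INR B - 2 * PI * INR j / INR B)).
      rewrite dirichlet_kernel_orthogonal by lia.
      destruct (Nat.eq_dec i j); ring.
  - intros l _. unfold trig_poly. rewrite Cmod_Csum_sq.
    apply Rsum_ext; intros i _. apply Rsum_ext; intros j _.
    f_equal. rewrite <- (cos_neg (INR l * _)). f_equal. ring.
Qed.

(** For fixed a, the b below a and the b from a on each give distinct values of |a - b| less than N;
    the factor 2 counts these two halves. *)
Lemma sum_differences_le (h : R -> R) (N : nat) :
  (forall u, 0 <= h u) -> (forall u, h (- u) = h u) ->
  Rsum (fun a => Rsum (fun b => h (INR a - INR b)) (seq 0 N)) (seq 0 N)
    <= 2 * INR N * Rsum (fun l => h (INR l)) (seq 0 N).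
Proof.
  intros Hpos Heven. set (T := Rsum (fun l => h (INR l)) (seq 0 N)).
  replace (2 * INR N * T) with (INR (length (seq 0 N)) * (2 * T)) by (rewrite length_seq; ring).
  apply Rsum_le_const. intros a Ha. apply in_seq in Ha.
  replace N with (a + (N - a))%nat at 1 by lia. rewrite seq_app, Rsum_app, Nat.add_0_l.
  assert (H1 : Rsum (fun b => h (INR a - INR b)) (seq 0 a) <= T).
  { rewrite (Rsum_ext _ (fun b => h (INR (a - b)%nat))).
    - rewrite <- (Rsum_map (fun b => (a - b)%nat) (fun l => h (INR l))).
      apply Rsum_incl; auto.
      + apply NoDup_map_NoDup_ForallPairs; [|apply seq_NoDup].
        intros x y Hx Hy E. apply in_seq in Hx. apply in_seq in Hy. lia.
      + intros x Hx. apply in_map_iff in Hx. destruct Hx as [y [<- Hy]].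
        apply in_seq in Hy. apply in_seq. lia.
    - intros b Hb. apply in_seq in Hb. now rewrite minus_INR by lia. }
  assert (H2 : Rsum (fun b => h (INR a - INR b)) (seq a (N - a)) <= T).
  { rewrite (Rsum_ext _ (fun b => h (INR (b - a)%nat))).
    - rewrite <- (Rsum_map (fun b => (b - a)%nat) (fun l => h (INR l))).
      apply Rsum_incl; auto.
      + apply NoDup_map_NoDup_ForallPairs; [|apply seq_NoDup].
        intros x y Hx Hy E. apply in_seq in Hx. apply in_seq in Hy. lia.
      + intros x Hx. apply in_map_iff in Hx. destruct Hx as [y [<- Hy]].
        apply in_seq in Hy. apply in_seq. lia.
    - intros b Hb. apply in_seq in Hb. rewrite minus_INR by lia.
      rewrite <- Heven. f_equal. ring. }
  lra.
Qed.

(** * Fejer kernels, resonators and phase bins *)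

Definition fejer (N : nat) (psi : R) : R :=
  Rsum (fun a => Rsum (fun b => cos ((INR a - INR b) * psi)) (seq 0 N)) (seq 0 N).

(** [fejer] is the squared modulus of the sum of e^(i a psi) over a < N, and [dirichlet_kernel] is
    the real part of that sum. *)
Lemma fejer_ge_kernel N psi : dirichlet_kernel N psi ^ 2 <= fejer N psi.
Proof.
  assert (E : fejer N psi = dirichlet_kernel N psi ^ 2 + Rsum (fun a => sin (INR a * psi)) (seq 0 N) ^ 2).
  { unfold fejer, dirichlet_kernel. rewrite <- !Rsqr_pow2. unfold Rsqr.
    rewrite !Rsum_mult, <- Rsum_plus. apply Rsum_ext; intros a _.
    rewrite <- Rsum_plus. apply Rsum_ext; intros b _.
    rewrite Rmult_minus_distr_r, cos_minus. ring. }
  rewrite E. pose proof (pow2_ge_0 (Rsum (fun a => sin (INR a * psi)) (seq 0 N))). lra.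
Qed.

Lemma fejer_nonneg N psi : 0 <= fejer N psi.
Proof. pose proof (fejer_ge_kernel N psi). pose proof (pow2_ge_0 (dirichlet_kernel N psi)). lra. Qed.

Lemma fejer_large N psi (q : Z) : (1 <= N)%nat ->
  Rabs (psi - 2 * IZR q * PI) <= / INR N -> INR N ^ 2 / 4 <= fejer N psi.
Proof.
  intros HN Hpsi. assert (HN' : 1 <= INR N) by (apply (le_INR 1); lia).
  eapply Rle_trans; [|apply fejer_ge_kernel].
  rewrite <- (dirichlet_kernel_period N psi q).
  set (x := psi - 2 * IZR q * PI) in *.
  assert (H : INR N / 2 <= dirichlet_kernel N x).
  { unfold dirichlet_kernel. replace (INR N / 2) with (Rsum (fun _ : nat => 1 / 2) (seq 0 N))
      by (rewrite Rsum_const, length_seq; field).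
    apply Rsum_le. intros a Ha. apply in_seq in Ha.
    assert (Hax : Rabs (INR a * x) <= 1).
    { rewrite Rabs_mult, (Rabs_pos_eq (INR a)) by apply pos_INR.
      replace 1 with (INR N * / INR N) by (field; lra).
      apply Rmult_le_compat; auto using pos_INR, Rabs_pos. apply le_INR; lia. }
    (* For a < N the angle is at most 1, hence below pi/3, where the cosine is 1/2. *)
    pose proof PI2_3_2. pose proof PI_4. rewrite <- cos_PI3.
    unfold Rabs in Hax. destruct (Rcase_abs (INR a * x)).
    - rewrite <- (cos_neg (INR a * x)). apply cos_decr_1; lra.
    - apply cos_decr_1; lra. }
  nra.
Qed.

(** The square root of the total mass of the bin, not the sum of the 1/sqrt m: then the squares add
    up to the sum of 1/m however many frequencies collide, and Cauchy--Schwarz still recovers the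
    diagonal terms. *)
Definition bin_coef (bin : nat -> nat) (M : list nat) (j : nat) : R :=
  sqrt (Rsum (fun m => / INR m) (filter (fun m => if Nat.eq_dec (bin m) j then true else false) M)).

Lemma inv_INR_nonneg m : 0 <= / INR m.
Proof.
  destruct m; [simpl; rewrite Rinv_0; lra|]. left. apply Rinv_0_lt_compat, lt_0_INR. lia.
Qed.

Lemma bin_coef_nonneg bin M j : 0 <= bin_coef bin M j.
Proof. apply sqrt_pos. Qed.

Lemma bin_coef_sq_sum bin M B : (forall m, (bin m < B)%nat) ->
  Rsum (fun j => bin_coef bin M j ^ 2) (seq 0 B) = Rsum (fun m => / INR m) M.
Proof.
  intros Hb.
  rewrite (Rsum_ext _ (fun j => Rsum (fun m => if Nat.eq_dec (bin m) j then / INR m else 0) M)).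
  - rewrite Rsum_swap. apply Rsum_ext; intros m _.
    now rewrite (Rsum_delta B (bin m) (fun _ => / INR m)) by auto.
  - intros j _. unfold bin_coef. rewrite pow2_sqrt, Rsum_filter.
    + apply Rsum_ext; intros m _. now destruct (Nat.eq_dec (bin m) j).
    + apply Rsum_nonneg; intros; apply inv_INR_nonneg.
Qed.

(** Subadditivity of the square root undoes the binning, then Cauchy--Schwarz applies. This trivial
    bound for a resonator is where the number of its frequencies enters. *)
Lemma bin_coef_sum_le bin M B : (forall m, (bin m < B)%nat) ->
  Rsum (bin_coef bin M) (seq 0 B) <= sqrt (INR (length M) * Rsum (fun m => / INR m) M).
Proof.
  intros Hb.
  assert (Hsub : forall l : list nat,
    sqrt (Rsum (fun m => / INR m) l) <= Rsum (fun m => sqrt (/ INR m)) l).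
  { induction l as [|a l IH]; simpl; [rewrite sqrt_0; lra|].
    assert (H1 : 0 <= Rsum (fun m => / INR m) l) by (apply Rsum_nonneg; intros; apply inv_INR_nonneg).
    pose proof (inv_INR_nonneg a) as H2.
    apply Rle_trans with (sqrt (/ INR a) + sqrt (Rsum (fun m => / INR m) l)); [|lra].
    pose proof (sqrt_pos (/ INR a)). pose proof (sqrt_pos (Rsum (fun m => / INR m) l)).
    apply Rsqr_incr_0_var; [|lra]. rewrite Rsqr_sqrt by lra.
    rewrite Rsqr_plus, !Rsqr_sqrt by lra. nra. }
  apply Rle_trans with (Rsum (fun m => 1 * sqrt (/ INR m)) M).
  - apply Rle_trans with (Rsum (fun j => Rsum (fun m =>
      if Nat.eq_dec (bin m) j then sqrt (/ INR m) else 0) M) (seq 0 B)).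
    + apply Rsum_le; intros j _. unfold bin_coef.
      eapply Rle_trans; [apply Hsub|]. rewrite Rsum_filter.
      right. apply Rsum_ext; intros m _. now destruct (Nat.eq_dec (bin m) j).
    + rewrite Rsum_swap. right. apply Rsum_ext; intros m _.
      rewrite (Rsum_delta B (bin m) (fun _ => sqrt (/ INR m))) by auto. ring.
  - eapply Rle_trans; [apply Rsum_Cauchy|].
    rewrite <- sqrt_mult by apply Rsum_sq_nonneg. right. f_equal. f_equal.
    + rewrite Rsum_const. ring.
    + apply Rsum_ext; intros m _. apply pow2_sqrt, inv_INR_nonneg.
Qed.

Lemma Cmod_trig_poly_le B r u : (forall j, 0 <= r j) ->
  Cmod (trig_poly B r u) <= Rsum r (seq 0 B).
Proof.
  intros Hr. unfold trig_poly. eapply Rle_trans; [apply Cmod_Csum|].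
  right. apply Rsum_ext; intros j _.
  rewrite Cmod_mult, Cmod_cis, Cmod_R, Rabs_pos_eq; auto. ring.
Qed.

Lemma Cmod_conj z : Cmod (Cconj z) = Cmod z.
Proof. unfold Cmod, Cconj; simpl. f_equal. ring. Qed.

Lemma Cconj_Csum {A} (f : A -> C) l : Cconj (Csum f l) = Csum (fun a => Cconj (f a)) l.
Proof.
  unfold Csum, Cconj; simpl. f_equal.
  induction l as [|a l IH]; simpl; [ring|rewrite <- IH; ring].
Qed.

Lemma Cconj_scal_cis (c x : R) : Cconj (Cmult (RtoC c) (cis x)) = Cmult (RtoC c) (cis (- x)).
Proof. rewrite cis_opp. unfold Cconj, Cmult, RtoC, cis; simpl. f_equal; ring. Qed.

Lemma trig_poly_opp B r u : trig_poly B r (- u) = Cconj (trig_poly B r u).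
Proof.
  unfold trig_poly. rewrite Cconj_Csum. apply Csum_ext; intros j _.
  rewrite Cconj_scal_cis. do 2 f_equal. ring.
Qed.

Lemma dirichlet_opp X t : dirichlet X (- t) = Cconj (dirichlet X t).
Proof.
  unfold dirichlet. rewrite Cconj_Csum. apply Csum_ext; intros j _.
  rewrite Cconj_scal_cis. do 2 f_equal. ring.
Qed.

Lemma Csum_mult3 {A B D} (f : A -> C) (g : B -> C) (h : D -> C) l1 l2 l3 :
  Cmult (Cmult (Csum f l1) (Csum g l2)) (Csum h l3) =
  Csum (fun a => Csum (fun b => Csum (fun d => Cmult (Cmult (f a) (g b)) (h d)) l3) l2) l1.
Proof.
  rewrite <- Csum_scal_r, <- Csum_scal_r. apply Csum_ext; intros a _.
  rewrite <- (Csum_scal (f a) g), <- Csum_scal_r. apply Csum_ext; intros b _.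
  now rewrite Csum_scal.
Qed.

Definition phase (alpha : R) (B k i j : nat) : R :=
  alpha * ln (INR k) + 2 * PI * INR i / INR B - 2 * PI * INR j / INR B.

Lemma resonance_expand (alpha : R) (X B : nat) (r1 r2 : nat -> R) (u : R) :
  fst (Cmult (Cmult (dirichlet X (alpha * u)) (trig_poly B r1 u)) (Cconj (trig_poly B r2 u))) =
  Rsum (fun k => Rsum (fun i => Rsum (fun j =>
    / sqrt (INR k) * (r1 i * r2 j) *
    cos (u * phase alpha B k i j))
    (seq 0 B)) (seq 0 B)) (seq 1 X).
Proof.
  unfold dirichlet, trig_poly. rewrite Cconj_Csum, Csum_mult3.
  unfold Csum at 1. cbn [fst]. apply Rsum_ext; intros k _.
  unfold Csum at 1. cbn [fst]. apply Rsum_ext; intros i _.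
  unfold Csum at 1. cbn [fst]. apply Rsum_ext; intros j _.
  rewrite Cconj_scal_cis.
  set (x := - (alpha * u * ln (INR k))). set (y := - (u * (2 * PI * INR i / INR B))).
  set (z := - - (u * (2 * PI * INR j / INR B))).
  replace (u * _) with (- (x + y + z)) by (unfold x, y, z, phase; ring).
  rewrite cos_neg.
  match goal with |- fst ?w = _ => replace w with
    (Cmult (RtoC (/ sqrt (INR k) * (r1 i * r2 j))) (cis (x + y + z)))
    by (rewrite !cis_plus, !RtoC_mult; ring) end.
  unfold Cmult, cis, RtoC; cbn [fst snd]. ring.
Qed.

(** After exchanging sums, each pair a, b contributes the real part of S R_1 conj R_2 at u = a - b.
    All coefficients are real, so the modulus is even in u and [sum_differences_le] applies. *)
Lemma resonance_upper (alpha : R) (X N B : nat) (r1 r2 : nat -> R) :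
  Rsum (fun k => Rsum (fun i => Rsum (fun j => / sqrt (INR k) * (r1 i * r2 j) *
    fejer N (phase alpha B k i j))
    (seq 0 B)) (seq 0 B)) (seq 1 X)
  <= 2 * INR N * Rsum (fun l => Cmod (dirichlet X (alpha * INR l)) *
       Cmod (trig_poly B r1 (INR l)) * Cmod (trig_poly B r2 (INR l))) (seq 0 N).
Proof.
  set (h := fun u => Cmod (dirichlet X (alpha * u)) * Cmod (trig_poly B r1 u) * Cmod (trig_poly B r2 u)).
  eapply Rle_trans; [|apply (sum_differences_le h N)].
  - rewrite (Rsum_ext _ (fun k => Rsum (fun i => Rsum (fun j => Rsum (fun a => Rsum (fun b =>
      / sqrt (INR k) * (r1 i * r2 j) * cos ((INR a - INR b) * phase alpha B k i j))
      (seq 0 N)) (seq 0 N)) (seq 0 B)) (seq 0 B))).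
    + assert (E : forall k i, Rsum (fun j => Rsum (fun a => Rsum (fun b =>
        / sqrt (INR k) * (r1 i * r2 j) * cos ((INR a - INR b) * phase alpha B k i j))
        (seq 0 N)) (seq 0 N)) (seq 0 B) =
        Rsum (fun a => Rsum (fun b => Rsum (fun j =>
        / sqrt (INR k) * (r1 i * r2 j) * cos ((INR a - INR b) * phase alpha B k i j))
        (seq 0 B)) (seq 0 N)) (seq 0 N)).
      { intros k i. rewrite Rsum_swap. apply Rsum_ext; intros a _. apply Rsum_swap. }
      rewrite (Rsum_ext _ (fun k => Rsum (fun a => Rsum (fun b => Rsum (fun i => Rsum (fun j =>
        / sqrt (INR k) * (r1 i * r2 j) * cos ((INR a - INR b) * phase alpha B k i j))
        (seq 0 B)) (seq 0 B)) (seq 0 N)) (seq 0 N))).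
      * rewrite Rsum_swap. apply Rsum_le; intros a _. rewrite Rsum_swap.
        apply Rsum_le; intros b _. rewrite <- resonance_expand.
        eapply Rle_trans; [apply Rle_abs|]. eapply Rle_trans; [apply fst_le_Cmod|].
        rewrite !Cmod_mult, Cmod_conj. apply Rle_refl.
      * intros k _. rewrite (Rsum_ext _ _ _ (fun i _ => E k i)).
        rewrite Rsum_swap. apply Rsum_ext; intros a _. apply Rsum_swap.
    + intros k _. apply Rsum_ext; intros i _. apply Rsum_ext; intros j _.
      unfold fejer. rewrite <- Rsum_scal. apply Rsum_ext; intros a _.
      now rewrite Rsum_scal.
  - intros u. unfold h. repeat apply Rmult_le_pos; apply Cmod_ge_0.
  - intros u. unfold h. rewrite !trig_poly_opp, Ropp_mult_distr_r_reverse, dirichlet_opp.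
    now rewrite !Cmod_conj.
Qed.

(** Additivity of the logarithm leaves only the difference of two rounding errors, at most 2 pi / (8
    N) modulo 2 pi. As pi <= 4 this is at most 1/N, inside the peak of the Fejer kernel; this is why
    the grid has 8N points. *)
Lemma bins_resonate (alpha : R) (N : nat) (bin : nat -> nat) (k m : nat) : (1 <= N)%nat ->
  (1 <= k)%nat -> (1 <= m)%nat ->
  (forall m, exists (q : Z) (e : R), 0 <= e < 1 /\
     alpha * ln (INR m) = 2 * PI * (INR (bin m) + e) / INR (8 * N) + 2 * IZR q * PI) ->
  INR N ^ 2 / 4 <= fejer N (phase alpha (8 * N) k (bin m) (bin (k * m)%nat)).
Proof.
  intros HN Hk Hm Hbin. assert (HN' : 1 <= INR N) by (apply (le_INR 1); lia).
  destruct (Hbin m) as [q [e [He E]]]. destruct (Hbin (k * m)%nat) as [q' [e' [He' E']]].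
  rewrite mult_INR, ln_mult in E' by (apply lt_0_INR; lia).
  apply (fejer_large N _ (q' - q)); [lia|]. unfold phase.
  assert (H8 : INR (8 * N) = 8 * INR N) by (rewrite mult_INR; simpl; ring).
  rewrite H8 in *.
  replace (_ - 2 * IZR (q' - q) * PI) with (2 * PI * (e' - e) / (8 * INR N)).
  - pose proof PI_RGT_0. pose proof PI_4.
    assert (Rabs (2 * PI * (e' - e)) <= 8) by (apply Rabs_le; nra).
    unfold Rdiv. rewrite Rabs_mult, (Rabs_pos_eq (/ (8 * INR N))).
    + replace (/ INR N) with (8 * / (8 * INR N)) by (field; lra).
      apply Rmult_le_compat_r; [left; apply Rinv_0_lt_compat; lra|lra].
    + left; apply Rinv_0_lt_compat; lra.
  - rewrite minus_IZR.
    replace (alpha * ln (INR k)) with (alpha * (ln (INR k) + ln (INR m)) - alpha * ln (INR m)) by ring.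
    rewrite E, E'. field. lra.
Qed.

(** Each pair (k, m) contributes k^(-1/2) m^(-1/2) (km)^(-1/2) = 1/(km). For fixed k the pairs are
    grouped by the bins of m and km; as m determines km injectively, the product of the two bin
    coefficients dominates the group. Everything else is dropped by nonnegativity. *)
Lemma resonance_lower (alpha : R) (X N : nat) (bin : nat -> nat)
    (Rd F : list nat) (Q : list (nat * nat)) : (1 <= N)%nat ->
  (forall m, (bin m < 8 * N)%nat) ->
  (forall m, exists (q : Z) (e : R), 0 <= e < 1 /\
     alpha * ln (INR m) = 2 * PI * (INR (bin m) + e) / INR (8 * N) + 2 * IZR q * PI) ->
  NoDup Q ->
  (forall k m, In (k, m) Q -> (1 <= k <= X)%nat /\ (1 <= m)%nat /\ In m Rd /\ In (k * m)%nat F) ->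
  INR N ^ 2 / 4 * Rsum (fun p => / INR (fst p * snd p)) Q <=
  Rsum (fun k => Rsum (fun i => Rsum (fun j =>
    / sqrt (INR k) * (bin_coef bin Rd i * bin_coef bin F j) *
    fejer N (phase alpha (8 * N) k i j))
    (seq 0 (8 * N))) (seq 0 (8 * N))) (seq 1 X).
Proof.
  intros HN Hb Hbin Hnd HQ. set (B := (8 * N)%nat) in *.
  set (Qk := fun k => map snd (filter (fun p => if Nat.eq_dec (fst p) k then true else false) Q)).
  assert (HQk : forall k m, In m (Qk k) <-> In (k, m) Q).
  { intros k m. unfold Qk. rewrite in_map_iff. split.
    - intros [[k' m'] [<- H]]. apply filter_In in H. destruct H as [H H'].
      simpl in *. destruct (Nat.eq_dec k' k); [now subst|easy].
    - intros H. exists (k, m). split; [easy|]. apply filter_In. split; [easy|].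
      simpl. now destruct (Nat.eq_dec k k). }
  assert (HQnd : forall k, NoDup (Qk k)).
  { intros k. unfold Qk. apply NoDup_map_NoDup_ForallPairs; [|now apply NoDup_filter].
    intros [k1 m1] [k2 m2] H1 H2 E. apply filter_In in H1. apply filter_In in H2.
    destruct H1 as [_ H1], H2 as [_ H2]. simpl in *.
    destruct (Nat.eq_dec k1 k); [|easy]. destruct (Nat.eq_dec k2 k); [|easy]. congruence. }
  assert (E : Rsum (fun p => / INR (fst p * snd p)) Q =
    Rsum (fun k => Rsum (fun m => / INR (k * m)) (Qk k)) (seq 1 X)).
  { rewrite (Rsum_ext (fun k => Rsum (fun m => / INR (k * m)) (Qk k))
      (fun k => Rsum (fun p => if Nat.eq_dec (fst p) k then / INR (fst p * snd p) else 0) Q)).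
    - rewrite Rsum_swap. apply Rsum_ext; intros [k m] Hp.
      destruct (HQ k m Hp) as [Hk _].
      cbn [fst snd]. pose proof (Rsum_delta (S X) k (fun _ => / INR (k * m)) ltac:(lia)) as Hd.
      change (seq 0 (S X)) with (0%nat :: seq 1 X) in Hd. cbn [Rsum] in Hd.
      destruct (Nat.eq_dec k 0); [lia|]. lra.
    - intros k _. unfold Qk. rewrite Rsum_map, Rsum_filter. apply Rsum_ext.
      intros [k' m'] _. cbn [fst snd]. destruct (Nat.eq_dec k' k); [now subst|easy]. }
  rewrite E, <- Rsum_scal. apply Rsum_le; intros k Hk. apply in_seq in Hk.
  assert (Hk0 : 0 < INR k) by (apply lt_0_INR; lia).
  assert (Hsk : 0 < sqrt (INR k)) by now apply sqrt_lt_R0.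
  set (inbin := fun i j m => if Nat.eq_dec (bin m) i then
     if Nat.eq_dec (bin (k * m)%nat) j then true else false else false).
  (* Cauchy--Schwarz inside each pair of bins *)
  assert (Hcs : forall i j,
    Rsum (fun m => sqrt (/ INR m) * sqrt (/ INR (k * m))) (filter (inbin i j) (Qk k))
      <= bin_coef bin Rd i * bin_coef bin F j).
  { intros i j. eapply Rle_trans; [apply Rsum_Cauchy|].
    assert (Hnd' : NoDup (filter (inbin i j) (Qk k))) by now apply NoDup_filter.
    apply Rmult_le_compat; try apply sqrt_pos; apply sqrt_le_1_alt.
    - rewrite (Rsum_ext _ (fun m => / INR m)) by (intros; apply pow2_sqrt, inv_INR_nonneg).
      apply Rsum_incl; auto.
      + intros m Hm. apply filter_In in Hm. destruct Hm as [Hm Hi].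
        apply HQk, HQ in Hm. apply filter_In. split; [easy|].
        unfold inbin in Hi. now destruct (Nat.eq_dec (bin m) i).
      + intros; apply inv_INR_nonneg.
    - rewrite (Rsum_ext _ (fun m => / INR (k * m))) by (intros; apply pow2_sqrt, inv_INR_nonneg).
      rewrite <- (Rsum_map (fun m => (k * m)%nat) (fun n => / INR n)).
      apply Rsum_incl.
      + apply NoDup_map_NoDup_ForallPairs; auto. intros x y _ _ Exy. nia.
      + intros n Hn. apply in_map_iff in Hn. destruct Hn as [m [<- Hm]].
        apply filter_In in Hm. destruct Hm as [Hm Hi].
        apply HQk, HQ in Hm. apply filter_In. split; [easy|].
        unfold inbin in Hi. destruct (Nat.eq_dec (bin m) i); [|easy].
        now destruct (Nat.eq_dec (bin (k * m)%nat) j).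
      + intros; apply inv_INR_nonneg. }
  apply Rle_trans with (Rsum (fun i => Rsum (fun j =>
    / sqrt (INR k) * (INR N ^ 2 / 4) *
    Rsum (fun m => sqrt (/ INR m) * sqrt (/ INR (k * m))) (filter (inbin i j) (Qk k)))
    (seq 0 B)) (seq 0 B)).
  - right. set (v := fun m => / sqrt (INR k) * (INR N ^ 2 / 4) * (sqrt (/ INR m) * sqrt (/ INR (k * m)))).
    rewrite (Rsum_ext (fun i => Rsum _ _) (fun i => Rsum (fun m =>
      if Nat.eq_dec (bin m) i then v m else 0) (Qk k))).
    + rewrite Rsum_swap, <- Rsum_scal. apply Rsum_ext; intros m Hm.
      rewrite (Rsum_delta B (bin m) (fun _ => v m)) by auto.
      apply HQk, HQ in Hm. destruct Hm as [_ [Hm _]].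
      assert (Hm0 : 0 < INR m) by (apply lt_0_INR; lia).
      assert (Hsm : 0 < sqrt (INR m)) by now apply sqrt_lt_R0.
      unfold v. rewrite mult_INR, !sqrt_inv, sqrt_mult by lra.
      rewrite <- (sqrt_sqrt (INR k)) at 1 by lra. rewrite <- (sqrt_sqrt (INR m)) at 1 by lra.
      field. split; lra.
    + intros i _. rewrite (Rsum_ext _ (fun j => Rsum (fun m =>
        if Nat.eq_dec (bin (k * m)%nat) j then (if Nat.eq_dec (bin m) i then v m else 0) else 0) (Qk k))).
      * rewrite Rsum_swap. apply Rsum_ext; intros m _.
        now rewrite (Rsum_delta B (bin (k * m)%nat) (fun _ => if Nat.eq_dec (bin m) i then v m else 0)) by auto.
      * intros j _. rewrite <- Rsum_scal, Rsum_filter. apply Rsum_ext; intros m _.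
        unfold inbin, v. destruct (Nat.eq_dec (bin m) i), (Nat.eq_dec (bin (k * m)%nat) j); reflexivity.
  - apply Rsum_le; intros i _. apply Rsum_le; intros j _.
    specialize (Hcs i j).
    assert (Hpos : 0 <= bin_coef bin Rd i * bin_coef bin F j)
      by (apply Rmult_le_pos; apply bin_coef_nonneg).
    assert (Hik : 0 < / sqrt (INR k)) by now apply Rinv_0_lt_compat.
    rewrite (Rmult_assoc (/ sqrt (INR k))), (Rmult_assoc (/ sqrt (INR k)) (_ * _)).
    apply Rmult_le_compat_l; [lra|].
    (* One m with these two bins certifies that the phase of the whole pair of bins is aligned;
       without any, nonnegativity of the Fejer kernel is enough. *)
    destruct (filter (inbin i j) (Qk k)) as [|m l] eqn:Ef.
    + cbn [Rsum]. rewrite Rmult_0_r. apply Rmult_le_pos; [easy|apply fejer_nonneg].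
    + assert (Hm : In m (filter (inbin i j) (Qk k))) by (rewrite Ef; now left).
      apply filter_In in Hm. destruct Hm as [Hm Hi]. apply HQk, HQ in Hm.
      unfold inbin in Hi. destruct (Nat.eq_dec (bin m) i) as [<-|]; [|easy].
      destruct (Nat.eq_dec (bin (k * m)%nat) j) as [<-|]; [|easy].
      pose proof (bins_resonate alpha N bin k m HN ltac:(lia) ltac:(lia) Hbin) as Hf. fold B in Hf.
      rewrite Rmult_comm. apply Rmult_le_compat; auto.
      * apply Rsum_nonneg; intros; apply Rmult_le_pos; apply sqrt_pos.
      * pose proof (pow2_ge_0 (INR N)). lra.
Qed.

Lemma nat_ceil (x : R) : 0 <= x -> exists n : nat, x <= INR n < x + 1.
Proof.
  intros Hx. destruct (nfloor_ex x Hx) as [n Hn].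
  destruct (Req_dec x (INR n)) as [E|E].
  - exists n. lra.
  - exists (S n). rewrite S_INR. lra.
Qed.

Lemma Cmod_dirichlet_0 X : Cmod (dirichlet X 0) <= 2 * sqrt (INR X).
Proof.
  unfold dirichlet. eapply Rle_trans; [apply Cmod_Csum|].
  rewrite <- seq_shift, Rsum_map.
  rewrite (Rsum_ext _ (fun k => / sqrt (INR (S k)))).
  - apply (sum_inv_sqrt 0).
  - intros k _. rewrite Cmod_mult, Cmod_cis, Cmod_R, Rmult_1_r. apply Rabs_pos_eq.
    left. apply Rinv_0_lt_compat, sqrt_lt_R0, lt_0_INR. lia.
Qed.

Lemma one_le_ln x : 3 <= x -> 1 <= ln x.
Proof.
  intros Hx. rewrite <- (ln_exp 1). apply ln_le; [apply exp_pos|]. pose proof exp_le_3. lra.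
Qed.

(** The mean value theorem needs a length comparable with the number H of points, but here the
    length is of order H^2. The polynomial is first truncated at [c0 * H], at a cost O(sqrt N / l),
    which sums to sqrt N log N; Cauchy--Schwarz handles the truncated one. *)
Lemma dirichlet_short_sum (alpha : R) (c0 : nat) : 0 < alpha -> 1 + alpha <= INR c0 ->
  exists K, 0 < K /\ forall N H : nat, (1 <= N)%nat -> sqrt (INR N) <= INR H < sqrt (INR N) + 1 ->
    Rsum (fun l => Cmod (dirichlet (c0 * N) (alpha * INR l))) (seq 0 H)
      <= K * sqrt (INR N) * ln (INR (c0 * N) + 2) ^ 2.
Proof.
  intros Ha Hc0.
  destruct (dirichlet_diff alpha Ha) as [K1 [HK1 HD]].
  destruct (dirichlet_mean_square alpha (INR c0) Ha ltac:(lra)) as [K2 [HK2 HM]].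
  set (sc := sqrt (INR c0)).
  assert (Hsc : 0 < sc) by (apply sqrt_lt_R0; lra).
  exists (2 * (sqrt K2 + 1) + 2 * sc + K1 / alpha * sc * 2).
  assert (HKa : 0 < K1 / alpha * sc * 2)
    by (repeat apply Rmult_lt_0_compat; try lra; now apply Rinv_0_lt_compat).
  assert (Hs2 : 0 <= sqrt K2) by apply sqrt_pos.
  split; [lra|].
  intros N H HN HH.
  assert (HN' : 1 <= INR N) by (apply (le_INR 1); lia).
  set (s := sqrt (INR N)) in *.
  assert (Hs : 1 <= s) by now apply one_le_sqrt.
  assert (Ess : s * s = INR N) by (apply sqrt_sqrt; lra).
  assert (HH1 : (1 <= H)%nat) by (apply INR_le; simpl; lra).
  assert (HHN : (H <= N)%nat).
  { destruct (le_lt_dec H N) as [|Hlt]; [easy|].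
    assert (INR N + 1 <= INR H) by (rewrite <- S_INR; apply le_INR; lia). nra. }
  assert (Hc1 : (1 <= c0)%nat) by (apply INR_le; simpl; lra).
  set (X := (c0 * N)%nat). set (Y := (c0 * H)%nat).
  assert (HYX : (1 <= Y <= X)%nat) by (unfold X, Y; nia).
  assert (HX : sqrt (INR X) = sc * s) by (unfold X; rewrite mult_INR; apply sqrt_mult; lra).
  set (L := ln (INR X + 2)).
  assert (HY3 : 1 <= INR Y <= INR X) by (split; [apply (le_INR 1)|apply le_INR]; lia).
  assert (HLY : 1 <= ln (INR Y + 2) <= L) by (split; [apply one_le_ln|apply ln_le]; lra).
  assert (HHX : INR H <= INR X) by (apply le_INR; unfold X; nia).
  assert (HLH : ln (INR H + 2) <= L) by (apply ln_le; [pose proof (pos_INR H)|]; lra).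
  assert (HH2 : INR H <= 2 * s) by lra.
  assert (HSY : Rsum (fun l => 1 * Cmod (dirichlet Y (alpha * INR l))) (seq 0 H)
     <= 2 * s * (sqrt K2 + 1) * L ^ 2).
  { eapply Rle_trans; [apply Rsum_Cauchy|].
    rewrite (Rsum_ext (fun _ => 1 ^ 2) (fun _ => 1)) by (intros; ring).
    rewrite Rsum_const, length_seq, Rmult_1_r.
    assert (HM' := HM H Y HH1 ltac:(lia) ltac:(unfold Y; rewrite mult_INR; lra)).
    apply Rle_trans with (sqrt (INR H) * sqrt (INR H * ((sqrt K2 + 1) * L ^ 2) ^ 2)).
    - apply Rmult_le_compat_l; [apply sqrt_pos|]. apply sqrt_le_1_alt.
      eapply Rle_trans; [apply HM'|].
      replace (K2 * INR H * ln (INR Y + 2) ^ 3) with (INR H * (K2 * ln (INR Y + 2) ^ 3)) by ring.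
      apply Rmult_le_compat_l; [apply pos_INR|].
      rewrite Rpow_mult_distr, <- pow_mult.
      apply Rmult_le_compat; [lra|apply pow_le; lra| |].
      + rewrite <- (sqrt_sqrt K2) at 1 by lra. nra.
      + apply Rle_trans with (L ^ 3); [apply pow_incr; lra|].
        apply Rle_pow; [lra|lia].
    - assert (0 <= (sqrt K2 + 1) * L ^ 2) by (apply Rmult_le_pos; [lra|apply pow_le; lra]).
      rewrite sqrt_mult, sqrt_pow2 by (try apply pos_INR; try apply pow2_ge_0; lra).
      rewrite <- Rmult_assoc, sqrt_sqrt by apply pos_INR.
      replace (2 * s * (sqrt K2 + 1) * L ^ 2) with (2 * s * ((sqrt K2 + 1) * L ^ 2)) by ring.
      apply Rmult_le_compat_r; lra. }
  assert (Hone : forall l, In l (seq 1 (H - 1)) -> Cmod (dirichlet X (alpha * INR l)) <=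
     1 * Cmod (dirichlet Y (alpha * INR l)) + K1 / alpha * (sc * s) * / INR l).
  { intros l Hl. apply in_seq in Hl.
    assert (1 <= INR l) by (apply (le_INR 1); lia).
    assert (INR l <= INR H) by (apply le_INR; lia).
    assert (HtY : alpha * INR l <= INR Y) by (unfold Y; rewrite mult_INR; nra).
    pose proof (HD (alpha * INR l) Y X ltac:(nra) HtY HYX) as Hd. rewrite HX in Hd.
    replace (K1 * (sc * s) / (alpha * INR l)) with (K1 / alpha * (sc * s) * / INR l) in Hd
      by (field; lra).
    replace (dirichlet X (alpha * INR l)) with (Cplus (dirichlet Y (alpha * INR l))
      (Cminus (dirichlet X (alpha * INR l)) (dirichlet Y (alpha * INR l)))) at 1 by ring.
    eapply Rle_trans; [apply Cmod_triangle|]. lra. }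
  (* The point l = 0 is split off: the truncation estimate needs t >= alpha, while at 0 the trivial
     bound 2 sqrt X already has the right order. *)
  replace H with (1 + (H - 1))%nat in HSY |- * by lia.
  rewrite seq_app, Rsum_app in HSY |- *. simpl (0 + 1)%nat in *.
  apply Rsum_le in Hone. rewrite Rsum_plus, !Rsum_scal in Hone.
  simpl (seq 0 1) in *. cbn [Rsum] in *. simpl (INR 0) in *. rewrite !Rmult_0_r in *.
  pose proof (Cmod_dirichlet_0 X) as H0. rewrite HX in H0.
  pose proof (Cmod_ge_0 (dirichlet Y 0)).
  assert (Hh : Rsum (fun l => / INR l) (seq 1 (H - 1)) <= 2 * L).
  { eapply Rle_trans; [apply harmonic_le|].
    assert (ln (INR (H - 1) + 2) <= ln (INR H + 2)).
    { assert (INR (H - 1) <= INR H) by (apply le_INR; lia).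
      pose proof (pos_INR (H - 1)). apply ln_le; lra. }
    lra. }
  assert (HL2 : L <= L ^ 2) by nra.
  assert (Hss : 0 < sc * s) by (apply Rmult_lt_0_compat; lra).
  assert (K1 / alpha * (sc * s) * Rsum (fun l => / INR l) (seq 1 (H - 1))
    <= K1 / alpha * (sc * s) * (2 * L ^ 2)).
  { apply Rmult_le_compat_l; [|lra]. apply Rmult_le_pos; [|lra].
    apply Rdiv_le_0_compat; lra. }
  assert (2 * (sc * s) <= 2 * (sc * s) * L ^ 2) by nra.
  change (ln (INR (c0 * N) + 2)) with L. fold X.
  replace ((2 * (sqrt K2 + 1) + 2 * sc + K1 / alpha * sc * 2) * s * L ^ 2) with
    (2 * s * (sqrt K2 + 1) * L ^ 2 + 2 * (sc * s) * L ^ 2 + K1 / alpha * (sc * s) * (2 * L ^ 2)) by ring.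
  rewrite Rsum_scal in HSY. lra.
Qed.

(** Combines the lower and upper bounds for the Fejer sum. The factor 64 is 4 from the Fejer peak
    N^2/4, times 2 from counting differences, times 8 from the period 8N in Parseval. *)
Theorem resonance_principle (alpha : R) : 0 < alpha -> exists K, 0 < K /\
  forall (N : nat) (V : R) (Rd F : list nat) (Q : list (nat * nat)), (1 <= N)%nat -> 0 <= V ->
    (forall l : nat, sqrt (INR N) <= INR l -> (l < N)%nat -> Cmod (zeta_half (alpha * INR l)) <= V) ->
    NoDup Q ->
    (forall k m, In (k, m) Q -> (1 <= k <= N)%nat /\ (1 <= m)%nat /\ In m Rd /\ In (k * m)%nat F) ->
    Rsum (fun p => / INR (fst p * snd p)) Q <=
      (64 * V + K + K * sqrt (INR (length Rd) * INR (length F)) * ln (INR N + 2) ^ 2 / sqrt (INR N))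
      * sqrt (Rsum (fun m => / INR m) Rd * Rsum (fun m => / INR m) F).
Proof.
  (* The length [c0 * N] exceeds every point [alpha * l] with l < N, as the approximation of zeta
     requires. *)
  intros Ha. destruct (nat_ceil (1 + alpha) ltac:(lra)) as [c0 [Hc0 _]].
  destruct (zeta_half_approx alpha Ha) as [K1 [HK1 HZ]].
  destruct (dirichlet_short_sum alpha c0 Ha Hc0) as [K2 [HK2 HS]].
  assert (Hcp : 0 < INR c0) by lra.
  set (sc := sqrt (INR c0)). assert (Hsc : 0 < sc) by (apply sqrt_lt_R0; lra).
  set (K3 := K1 * (1 + sc / alpha)).
  assert (HK3 : 0 < K3).
  { apply Rmult_lt_0_compat; [lra|]. assert (0 < sc / alpha) by now apply Rdiv_lt_0_compat. lra. }
  set (lc := 1 + ln (INR c0)).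
  assert (Hlc : 1 <= lc).
  { assert (0 <= ln (INR c0)) by (rewrite <- ln_1; apply ln_le; lra). unfold lc; lra. }
  exists (64 * K3 + 8 * K2 * lc ^ 2).
  assert (HKl : 0 < 8 * K2 * lc ^ 2) by (repeat apply Rmult_lt_0_compat; lra).
  split; [lra|]. intros N V Rd F Q HN HV Hz Hnd HQ.
  assert (HN' : 1 <= INR N) by (apply (le_INR 1); lia).
  set (B := (8 * N)%nat).
  set (bin := fun m => phase_bin B (alpha * ln (INR m))).
  assert (Hbin : forall m, (bin m < B)%nat /\ exists (q : Z) (e : R),
    0 <= e < 1 /\ alpha * ln (INR m) = 2 * PI * (INR (bin m) + e) / INR B + 2 * IZR q * PI)
    by (intros m; apply (phase_bin_spec (alpha * ln (INR m)) B); unfold B; lia).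
  assert (Hb : forall m, (bin m < B)%nat) by (intros; apply Hbin).
  set (r1 := bin_coef bin Rd). set (r2 := bin_coef bin F).
  set (ER := Rsum (fun m => / INR m) Rd). set (EF := Rsum (fun m => / INR m) F).
  assert (HER : 0 <= ER) by (apply Rsum_nonneg; intros; apply inv_INR_nonneg).
  assert (HEF : 0 <= EF) by (apply Rsum_nonneg; intros; apply inv_INR_nonneg).
  set (R1 := fun l => Cmod (trig_poly B r1 (INR l))). set (R2 := fun l => Cmod (trig_poly B r2 (INR l))).
  set (G := sqrt (ER * EF)). assert (HG : 0 <= G) by apply sqrt_pos.
  set (X := (c0 * N)%nat).
  assert (Hc1 : (1 <= c0)%nat) by (apply INR_le; simpl; lra).
  pose proof (resonance_lower alpha X N bin Rd F Q HN Hb (fun m => proj2 (Hbin m)) Hnd) as Hlow.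
  assert (HQ' : forall k m, In (k, m) Q -> (1 <= k <= X)%nat /\ (1 <= m)%nat /\ In m Rd /\ In (k * m)%nat F).
  { intros k m H. destruct (HQ k m H) as [H1 H2]. split; [unfold X; nia|easy]. }
  specialize (Hlow HQ'). fold B in Hlow.
  pose proof (Rle_trans _ _ _ Hlow (resonance_upper alpha X N B r1 r2)) as Hmain. clear Hlow.
  set (Num := Rsum _ Q) in *.
  fold R1 R2 in Hmain.
  change (fun l => Cmod (dirichlet X (alpha * INR l)) * Cmod (trig_poly B r1 (INR l)) *
    Cmod (trig_poly B r2 (INR l))) with
    (fun l => Cmod (dirichlet X (alpha * INR l)) * R1 l * R2 l) in Hmain.
  assert (HR1 : forall l, 0 <= R1 l) by (intros; apply Cmod_ge_0).
  assert (HR2 : forall l, 0 <= R2 l) by (intros; apply Cmod_ge_0).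
  set (s := sqrt (INR N)) in *.
  assert (Hs : 1 <= s) by now apply one_le_sqrt.
  assert (Ess : s * s = INR N) by (apply sqrt_sqrt; lra).
  destruct (nat_ceil s ltac:(lra)) as [H HH].
  assert (HHN : (H <= N)%nat).
  { destruct (le_lt_dec H N) as [|Hlt]; [easy|].
    assert (INR N + 1 <= INR H) by (rewrite <- S_INR; apply le_INR; lia). nra. }
  assert (HH1 : (1 <= H)%nat) by (apply INR_le; simpl; lra).
  set (T := sqrt (INR (length Rd) * INR (length F))).
  assert (HT : 0 <= T) by apply sqrt_pos.
  assert (Hsplit : Rsum (fun l => Cmod (dirichlet X (alpha * INR l)) * R1 l * R2 l) (seq 0 N) <=
    T * G * (K2 * s * ln (INR X + 2) ^ 2) + (V + K3) * (INR B * G)).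
  { replace N with (H + (N - H))%nat at 1 by lia. rewrite seq_app, Rsum_app, Nat.add_0_l.
    apply Rplus_le_compat.
    - apply Rle_trans with (Rsum (fun l => T * G * Cmod (dirichlet X (alpha * INR l))) (seq 0 H)).
      + apply Rsum_le; intros l _. rewrite Rmult_assoc, Rmult_comm.
        apply Rmult_le_compat_r; [apply Cmod_ge_0|].
        apply Rle_trans with (sqrt (INR (length Rd) * ER) * sqrt (INR (length F) * EF)).
        * apply Rmult_le_compat; auto.
          -- eapply Rle_trans; [apply Cmod_trig_poly_le, bin_coef_nonneg|]. now apply bin_coef_sum_le.
          -- eapply Rle_trans; [apply Cmod_trig_poly_le, bin_coef_nonneg|]. now apply bin_coef_sum_le.
        * unfold T, G. pose proof (pos_INR (length Rd)). pose proof (pos_INR (length F)).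
          rewrite <- !sqrt_mult by (repeat apply Rmult_le_pos; lra).
          right. f_equal. ring.
      + rewrite Rsum_scal. apply Rmult_le_compat_l; [apply Rmult_le_pos; easy|].
        apply HS; auto.
    - apply Rle_trans with (Rsum (fun l => (V + K3) * (R1 l * R2 l)) (seq H (N - H))).
      + apply Rsum_le; intros l Hl. apply in_seq in Hl. rewrite Rmult_assoc.
        apply Rmult_le_compat_r; [apply Rmult_le_pos; auto|].
        assert (Hl1 : INR H <= INR l) by (apply le_INR; lia).
        assert (Hl2 : INR l <= INR N) by (apply le_INR; lia).
        assert (HtX : alpha * INR l <= INR X) by (unfold X; rewrite mult_INR; nra).
        pose proof (HZ (alpha * INR l) X ltac:(nra) HtX ltac:(unfold X; nia)) as Hd.
        pose proof (Hz l ltac:(fold s; lra) ltac:(lia)) as Hv.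
        assert (HX : sqrt (INR X) = sc * s) by (unfold X; rewrite mult_INR; apply sqrt_mult; lra).
        (* From sqrt N on, zeta and the polynomial differ by a bounded amount. *)
        assert (Hq : sqrt (INR X) / (alpha * INR l) <= sc / alpha).
        { rewrite HX. apply div_le_of; [nra|].
          replace (sc / alpha * (alpha * INR l)) with (sc * INR l) by (field; lra). nra. }
        assert (K1 * (1 + sqrt (INR X) / (alpha * INR l)) <= K3)
          by (apply Rmult_le_compat_l; lra).
        replace (dirichlet X (alpha * INR l)) with (Cminus (zeta_half (alpha * INR l))
          (Cminus (zeta_half (alpha * INR l)) (dirichlet X (alpha * INR l)))) by ring.
        unfold Cminus at 1. eapply Rle_trans; [apply Cmod_triangle|]. rewrite Cmod_opp. lra.
      + rewrite Rsum_scal. apply Rmult_le_compat_l; [lra|].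
        (* Nonnegativity allows the range to be extended to a full period of the resonators, where
           Parseval is exact. *)
        apply Rle_trans with (Rsum (fun l => R1 l * R2 l) (seq 0 B)).
        * apply Rsum_incl; [apply seq_NoDup| |].
          -- intros x Hx. apply in_seq in Hx. apply in_seq. unfold B; lia.
          -- intros; apply Rmult_le_pos; auto.
        * eapply Rle_trans; [apply Rsum_Cauchy|]. unfold R1, R2.
          rewrite !trig_poly_parseval by (unfold B; lia).
          unfold r1, r2. rewrite !bin_coef_sq_sum by auto.
          fold ER EF. pose proof (pos_INR B).
          rewrite <- sqrt_mult by (apply Rmult_le_pos; lra).
          replace (INR B * ER * (INR B * EF)) with ((INR B * INR B) * (ER * EF)) by ring.
          rewrite sqrt_mult by (apply Rmult_le_pos; lra).
          rewrite sqrt_square by lra. unfold G; lra. }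
  assert (HL : ln (INR X + 2) <= lc * ln (INR N + 2)).
  { assert (1 <= ln (INR N + 2)) by (apply one_le_ln; lra).
    apply Rle_trans with (ln (INR c0 * (INR N + 2))).
    - apply ln_le; [pose proof (pos_INR X); lra|]. unfold X. rewrite mult_INR. nra.
    - rewrite ln_mult by lra. unfold lc in *. nra. }
  assert (HL0 : 0 <= ln (INR X + 2)).
  { rewrite <- ln_1. apply ln_le; [lra|]. pose proof (pos_INR X). lra. }
  assert (HL2 : ln (INR X + 2) ^ 2 <= lc ^ 2 * ln (INR N + 2) ^ 2).
  { rewrite <- Rpow_mult_distr. apply pow_incr. lra. }
  set (M := ln (INR N + 2) ^ 2) in *.
  assert (HB8 : INR B = 8 * INR N) by (unfold B; rewrite mult_INR; simpl; ring).
  rewrite HB8 in Hsplit.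
  set (Z := Rsum _ (seq 0 N)) in *.
  assert (HZ' : Z <= T * G * (K2 * s * (lc ^ 2 * M)) + (V + K3) * (8 * INR N * G)).
  { eapply Rle_trans; [apply Hsplit|]. apply Rplus_le_compat_r.
    apply Rmult_le_compat_l; [now apply Rmult_le_pos|].
    apply Rmult_le_compat_l; [apply Rmult_le_pos; lra|easy]. }
  assert (HM0 : 0 <= M) by apply pow2_ge_0.
  assert (Hfin : Num <= 8 / INR N * Z).
  { apply Rmult_le_reg_l with (INR N ^ 2 / 4); [nra|].
    eapply Rle_trans; [apply Hmain|]. right. field. lra. }
  eapply Rle_trans; [apply Hfin|].
  apply Rle_trans with (8 / INR N * (T * G * (K2 * s * (lc ^ 2 * M)) + (V + K3) * (8 * INR N * G))).
  - apply Rmult_le_compat_l; [|easy]. apply Rdiv_le_0_compat; lra.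
  - replace (8 / INR N * (T * G * (K2 * s * (lc ^ 2 * M)) + (V + K3) * (8 * INR N * G)))
      with ((64 * V + 64 * K3 + 8 * K2 * lc ^ 2 * T * M / s) * G)
      by (rewrite <- Ess; field; lra).
    apply Rmult_le_compat_r; [easy|].
    assert (0 <= 64 * K3 * T * M / s).
    { apply Rdiv_le_0_compat; [|lra]. apply Rmult_le_pos; [apply Rmult_le_pos; [lra|easy]|easy]. }
    replace ((64 * K3 + 8 * K2 * lc ^ 2) * T * M / s)
      with (64 * K3 * T * M / s + 8 * K2 * lc ^ 2 * T * M / s) by (field; lra).
    lra.
Qed.

(** * Mertens' first theorem *)

Module PrimeArith.

Import ssreflect ssrfun ssrbool eqtype ssrnat seq div bigop prime binomial fintype.
Local Open Scope nat_scope.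

Definition primes_upto n := [seq p <- iota 0 n.+1 | prime p].

Lemma mem_primes_upto n p : (p \in primes_upto n) = prime p && (p <= n).
Proof. by rewrite mem_filter mem_iota add0n ltnS. Qed.

Lemma uniq_primes_upto n : uniq (primes_upto n).
Proof. exact: filter_uniq (iota_uniq _ _). Qed.

Lemma prime_dvd_fact p n : prime p -> (p %| n`!) = (p <= n).
Proof.
move=> p_pr; apply/idP/idP => [|p_le]; last by rewrite dvdn_fact // p_le prime_gt0.
elim: n => [|n IH]; first by rewrite dvdn1 => /eqP E; rewrite E in p_pr.
by rewrite factS Euclid_dvdM // => /orP[/dvdn_leq-> //|/IH/leqW].
Qed.

Lemma fact_prime_prod n : n`! = \prod_(p <- primes_upto n) p ^ logn p n`!.
Proof.
rewrite {1}[n`!](prod_prime_decomp (fact_gt0 n)) prime_decompE big_map /=.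
apply: perm_big; apply: uniq_perm; rewrite ?primes_uniq ?uniq_primes_upto // => p.
rewrite mem_primes mem_primes_upto fact_gt0 /=.
case: (boolP (prime p)) => //= p_pr.
by rewrite prime_dvd_fact.
Qed.

Lemma logn_fact_ge p n : prime p -> n %/ p <= logn p n`!.
Proof.
move=> p_pr; case: n => [|n]; first by rewrite div0n.
by rewrite logn_fact // big_ltn // expn1 leq_addr.
Qed.

(** Legendre's sum of n/p^k is geometric. The induction carries the last quotient n/p^K as well,
    which pays for the next term. *)
Lemma logn_fact_le p n : prime p -> p.-1 * logn p n`! <= n.
Proof.
move=> p_pr; have p_gt0 := prime_gt0 p_pr; rewrite logn_fact //.
have H K : p.-1 * (\sum_(1 <= k < K.+1) n %/ p ^ k) + n %/ p ^ K <= n.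
  elim: K => [|K IH]; first by rewrite big_geq // muln0 expn0 divn1.
  rewrite big_nat_recr //= mulnDr -addnA.
  apply: leq_trans IH; rewrite leq_add2l.
  rewrite -{2}[n %/ p ^ K.+1]mul1n -mulnDl addn1 prednK //.
  by rewrite expnSr divnMA mulnC leq_divM.
by apply: leq_trans (H n); rewrite leq_addr.
Qed.

Lemma prod_primes_dvd (s : seq nat) m :
  uniq s -> {in s, forall p, prime p && (p %| m)} -> \prod_(p <- s) p %| m.
Proof.
elim: s => [|p s IH] /=; first by rewrite big_nil dvd1n.
move=> /andP[p_s s_uniq] H; rewrite big_cons.
have /andP[p_pr p_m] := H p (mem_head _ _).
rewrite Gauss_dvd; last first.
  rewrite prime_coprime //; apply/negP => p_dvd.
  have : has (fun q => p %| q) s.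
    elim: s {IH s_uniq} p_s H p_dvd => [|q s IH] /=; first by rewrite big_nil dvdn1 => _ _ /eqP E; rewrite E in p_pr.
    rewrite inE negb_or => /andP[_ p_s] H; rewrite big_cons Euclid_dvdM //.
    case/orP => [->//|p_dvd]; rewrite IH ?orbT // => r.
    by rewrite inE => /orP[/eqP->|rs]; apply: H; rewrite !inE ?eqxx // rs !orbT.
  move=> /hasP[q qs p_q].
  have /andP[q_pr _] : prime q && (q %| m) by apply: H; rewrite inE qs orbT.
  by move: p_s; rewrite (_ : p = q) ?qs //; apply/eqP; rewrite -dvdn_prime2.
by rewrite p_m IH // => q qs; apply: H; rewrite inE qs orbT.
Qed.

Lemma leq_double m : m <= m.*2.
Proof. by rewrite -addnn leq_addr. Qed.

(** The two middle coefficients of (1 + 1)^(2m+1) are equal, so each is at most half of the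
    total. *)
Lemma bin_odd_mid m : 'C(m.*2.+1, m) <= 4 ^ m.
Proof.
have lt1 : m < m.*2.+2 by rewrite ltnS ltnW // ltnS leq_double.
have lt2 : m.+1 < m.*2.+2 by rewrite !ltnS leq_double.
have : 'C(m.*2.+1, m) + 'C(m.*2.+1, m.+1) <= 2 ^ m.*2.+1.
  rewrite -[2]/(1 + 1) expnDn.
  rewrite (bigD1 (inord m)) //= (bigD1 (inord m.+1)) /=; last first.
    by rewrite -val_eqE /= !inordK // neq_ltn ltnSn orbT.
  by rewrite !inordK // !exp1n !muln1 addnA leq_addr.
have -> : 'C(m.*2.+1, m.+1) = 'C(m.*2.+1, m).
  rewrite -bin_sub; last by rewrite ltnS leq_double.
  by rewrite subSS -addnn addnK.
rewrite addnn -muln2 expnS mulnC leq_pmul2l // -mul2n expnM //.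
Qed.

(** Erdos's induction: the primes in (m+1, 2m+1] divide the binomial coefficient C(2m+1, m), which
    is at most 4^m, and the primes up to m+1 fall to the induction hypothesis. *)
Lemma primorial_le n : \prod_(p <- primes_upto n) p <= 4 ^ n.
Proof.
elim/ltn_ind: n => -[|[|[|n]]] IH; rewrite ?big_nil //.
  by rewrite /primes_upto /= big_cons big_nil.
have step k : ~~ prime k.+1 -> primes_upto k.+1 = primes_upto k.
  move=> k_npr; rewrite /primes_upto -[k.+2]addn1 iotaD filter_cat /= add0n (negPf k_npr).
  by rewrite cats0.
(* The number treated is [n.+3], so odd [n] is the case of an even number above 2, which adds no
   prime. *)
case: (boolP (odd n)) => n_odd.
  rewrite step; last by apply/negP => /even_prime[//|] /=; rewrite !negbK n_odd.
  by apply: leq_trans (IH _ (ltnSn _)) _; rewrite leq_exp2l.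
have [m En] : exists m, n.+3 = m.*2.+1 by exists n./2.+1; rewrite -[n in LHS]odd_double_half (negPf n_odd).
rewrite En; set s := [seq p <- primes_upto m.*2.+1 | m.+1 < p].
have -> : \prod_(p <- primes_upto m.*2.+1) p = \prod_(p <- primes_upto m.+1) p * \prod_(p <- s) p.
  rewrite (bigID (fun p => p <= m.+1)) /=; congr (_ * _).
    rewrite -big_filter; apply: perm_big; apply: uniq_perm; first by rewrite filter_uniq // uniq_primes_upto.
      exact: uniq_primes_upto.
    move=> p; rewrite mem_filter !mem_primes_upto; case: (leqP p m.+1) => //= p_m; last by rewrite andbF.
    by rewrite (leq_trans p_m) // ltnS leq_double.
  by rewrite /s big_filter; apply: eq_bigl => p; rewrite ltnNge.
have m_lt : m.+1 < n.+3.
  by rewrite En ltnS; case: m En {s} => // m _; rewrite doubleS !ltnS leq_double.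
apply: leq_trans (leq_mul (IH _ m_lt) (_ : _ <= 4 ^ m)) _; last first.
  by rewrite -expnD leq_exp2l // -addnn addSn.
apply: leq_trans (bin_odd_mid m); apply: dvdn_leq; first by rewrite bin_gt0 ltnW // ltnS leq_double.
apply: prod_primes_dvd; first by rewrite filter_uniq // uniq_primes_upto.
move=> p; rewrite mem_filter mem_primes_upto => /and3P[p_gt p_pr p_le].
rewrite p_pr /=.
have : p %| 'C(m.*2.+1, m) * (m`! * (m.*2.+1 - m)`!).
  rewrite bin_fact; last by rewrite ltnW // ltnS leq_double.
  by apply: dvdn_fact; rewrite p_le prime_gt0.
rewrite !Euclid_dvdM // => /orP[//|/orP[]].
- by rewrite prime_dvd_fact // leqNgt (ltn_trans (ltnSn _) p_gt).
- rewrite prime_dvd_fact // -addnn -addSn addnK leqNgt p_gt //.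
Qed.

Lemma iota_seq a n : iota a n = List.seq a n.
Proof. by elim: n a => //= n IH a; rewrite IH. Qed.

Lemma filter_List (T : Type) (p : pred T) s : filter p s = List.filter p s.
Proof. by elim: s => //= x s ->. Qed.

Lemma primes_upto_List n : primes_upto n = List.filter prime (List.seq 1 n).
Proof. by rewrite /primes_upto filter_List iota_seq. Qed.

Lemma INR_expn p e : INR (p ^ e) = (INR p ^ e)%R.
Proof. by elim: e => // e IH; rewrite expnS mult_INR IH. Qed.

Lemma primes_upto_pos n p : List.In p (primes_upto n) -> (2 <= INR p)%R.
Proof.
rewrite primes_upto_List => /List.filter_In[_ p_pr].
by apply: (le_INR 2); apply/leP; exact: prime_gt1.
Qed.

Lemma ln_prod_primes (e : nat -> nat) n :
  ln (INR (\prod_(p <- primes_upto n) p ^ e p))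
    = Rsum (fun p => (INR (e p) * ln (INR p))%R) (primes_upto n).
Proof.
have := @primes_upto_pos n; elim: (primes_upto n) => [|p s IH] H.
  by rewrite big_nil ln_1.
have Hp : (0 < INR p)%R by have := H p (or_introl erefl); lra.
rewrite big_cons mult_INR ln_mult ?INR_expn.
- by rewrite ln_pow // IH // => q Hq; apply: H; right.
- exact: pow_lt.
- apply: lt_0_INR; apply/ltP.
  rewrite big_seq; apply: prodn_cond_gt0 => q qs; rewrite expn_gt0; apply/orP; left.
  have : (0 < INR q)%R.
    suff: List.In q s by move=> Hq; have := H q (or_intror Hq); lra.
    by elim: s qs {IH H} => //= a s IH; rewrite inE => /orP[/eqP->|/IH]; [left|right].
  by case: q {qs} => //=; lra.
Qed.

Lemma ln_fact_primes n :
  ln (INR n`!) = Rsum (fun p => (INR (logn p n`!) * ln (INR p))%R) (primes_upto n).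
Proof. by rewrite {1}fact_prime_prod ln_prod_primes. Qed.

Lemma chebyshev_theta_le n : (Rsum (fun p => ln (INR p)) (primes_upto n) <= INR n * ln 4)%R.
Proof.
have := primorial_le n; rewrite (eq_bigr (fun p => p ^ 1)); last by move=> p _; rewrite expn1.
move=> /leP /le_INR H.
rewrite (Rsum_ext _ (fun p => (INR 1 * ln (INR p))%R)); last by move=> p _ /=; rewrite Rmult_1_l.
rewrite -(ln_prod_primes (fun _ => 1)) -ln_pow; last by lra.
have -> : (4 = INR 4)%R by rewrite /=; lra.
rewrite -INR_expn; apply: ln_le => //.
apply: lt_0_INR; apply/ltP.
rewrite big_seq; apply: prodn_cond_gt0 => q; rewrite mem_primes_upto => /andP[/prime_gt0 q0 _].
by rewrite expn_gt0 q0.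
Qed.

Lemma ln_fact_bounds n : (1 <= n)%coq_nat ->
  (INR n * ln (INR n) - INR n <= ln (INR n`!) <= INR n * ln (INR n))%R.
Proof.
elim: n => [|n IH] Hn; first by lia.
case: n IH Hn => [|n] IH _; first by rewrite /= ln_1; lra.
have {}IH := IH ltac:(lia).
have H1 : (1 <= INR n.+1)%R by apply: (le_INR 1); lia.
rewrite factS mult_INR ln_mult; last 2 first.
- by apply: lt_0_INR; lia.
- by apply: lt_0_INR; apply/ltP; exact: fact_gt0.
rewrite (S_INR n.+1); set x := INR n.+1 in IH H1 *.
have Hl : (ln x <= ln (x + 1))%R by apply: ln_le; lra.
have Hu : (x * (ln (x + 1) - ln x) <= 1)%R.
  rewrite -ln_div; try lra.
  have -> : ((x + 1) / x = 1 + / x)%R by field; lra.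
  have E : (ln (1 + / x) <= / x)%R.
    rewrite -{2}(ln_exp (/ x)); apply: ln_le; last exact: exp_ineq1_le.
    have : (0 < / x)%R by apply: Rinv_0_lt_compat; lra.
    lra.
  apply: (Rle_trans _ (x * / x)); first by apply: Rmult_le_compat_l; lra.
  by right; field; lra.
by nra.
Qed.

Lemma INR_logn_fact n p : prime p ->
  (INR n / INR p - 1 <= INR (logn p n`!))%R /\ ((INR p - 1) * INR (logn p n`!) <= INR n)%R.
Proof.
move=> p_pr; have p_gt0 := prime_gt0 p_pr.
have Hp : (0 < INR p)%R by apply: lt_0_INR; apply/ltP.
split.
- apply: Rle_trans (le_INR _ _ (leP (logn_fact_ge p n p_pr))).
  have /ltP/lt_INR := ltn_ceil n p_gt0; rewrite mult_INR S_INR => H.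
  suff: (INR n / INR p <= INR (n %/ p) + 1)%R by lra.
  by apply: div_le_of; lra.
- have /leP/le_INR := logn_fact_le p n p_pr; rewrite mult_INR.
  suff -> : INR p.-1 = (INR p - 1)%R by [].
  by rewrite -{2}(prednK p_gt0) S_INR; lra.
Qed.

Lemma prime_Euclid p a b : prime p -> Nat.divide p (a * b) -> Nat.divide p a \/ Nat.divide p b.
Proof.
have E x : Nat.divide p x <-> p %| x.
  by split=> [[k ->]|/dvdnP[k ->]]; [exact: dvdn_mull|exists k].
by move=> p_pr; rewrite !E Euclid_dvdM // => /orP.
Qed.

Lemma prime_divide_prime p q : prime p -> prime q -> Nat.divide p q -> p = q.
Proof.
move=> p_pr q_pr [k Ek]; apply/eqP; rewrite -dvdn_prime2 //.
by rewrite Ek; exact: dvdn_mull.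
Qed.

Lemma prime_ge2 p : prime p -> (2 <= p)%coq_nat.
Proof. by move=> /prime_gt1/leP. Qed.

End PrimeArith.

Definition primes_between (a b : nat) : list nat := filter prime.prime (seq (S a) (b - a)).

Lemma in_primes_between a b p :
  In p (primes_between a b) <-> (a < p <= b)%nat /\ prime.prime p = true.
Proof. unfold primes_between. rewrite filter_In, in_seq. split; intros [H1 H2]; split; auto; lia. Qed.

Lemma primes_between_split a b : (a <= b)%nat ->
  primes_between 0 b = primes_between 0 a ++ primes_between a b.
Proof.
  intros H. unfold primes_between. rewrite <- filter_app, !Nat.sub_0_r. f_equal.
  replace b with (a + (b - a))%nat at 1 by lia. now rewrite seq_app.
Qed.

Lemma sum_ln_sq n : Rsum (fun k => ln (INR k) / INR k ^ 2) (seq 1 n) <= 2.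
Proof.
  assert (H : forall n, Rsum (fun k => ln (INR k) / INR k ^ 2) (seq 1 n)
                (* -(ln x + 1)/x is an antiderivative of ln x / x^2; the 2 in place of 1 leaves room
                   for the discrete step. *)
                <= 2 - (ln (INR (S n)) + 2) / INR (S n)).
  { clear n. induction n as [|n IH].
    - simpl. rewrite ln_1. lra.
    - rewrite Rsum_seq_S. change (1 + n)%nat with (S n).
      assert (H1 : 1 <= INR (S n)) by (apply (le_INR 1); lia).
      rewrite (S_INR (S n)). set (x := INR (S n)) in *.
      enough (ln x / x ^ 2 + (ln (x + 1) + 2) / (x + 1) <= (ln x + 2) / x) by lra.
      assert (Hl : x * (ln (x + 1) - ln x) <= 1).
      { rewrite <- ln_div by lra.
        pose proof (ln_le_sub1 ((x + 1) / x) ltac:(apply Rdiv_lt_0_compat; lra)) as Hl.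
        apply Rle_trans with (x * ((x + 1) / x - 1)); [apply Rmult_le_compat_l; lra|].
        right; field; lra. }
      pose proof (ln_le_sub1 x ltac:(lra)).
      apply Rmult_le_reg_r with (x ^ 2 * (x + 1)); [apply Rmult_lt_0_compat; nra|].
      replace ((ln x / x ^ 2 + (ln (x + 1) + 2) / (x + 1)) * (x ^ 2 * (x + 1)))
        with (ln x * (x + 1) + (ln (x + 1) + 2) * x ^ 2) by (field; lra).
      replace ((ln x + 2) / x * (x ^ 2 * (x + 1))) with ((ln x + 2) * x * (x + 1)) by (field; lra).
      assert (x * (x * (ln (x + 1) - ln x)) <= x * 1) by (apply Rmult_le_compat_l; lra).
      nra. }
  eapply Rle_trans; [apply H|].
  assert (1 <= INR (S n)) by (apply (le_INR 1); lia).
  assert (0 <= ln (INR (S n))) by (rewrite <- ln_1; apply ln_le; lra).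
  assert (0 <= (ln (INR (S n)) + 2) / INR (S n)) by (apply Rdiv_le_0_compat; lra).
  lra.
Qed.

(** ln n! is the sum of v_p ln p with n/p - 1 <= v_p <= n/(p-1), and lies between n ln n - n and n
    ln n. The upper error ln 4 is Chebyshev's bound for the sum of ln p; the lower error 5 is 1 from
    Stirling plus 2 times 2 from the sum of ln p / p^2. *)
Lemma mertens (n : nat) : (1 <= n)%nat ->
  ln (INR n) - 5 <= Rsum (fun p => ln (INR p) / INR p) (primes_between 0 n) <= ln (INR n) + ln 4.
Proof.
  intros Hn. assert (Hn' : 1 <= INR n) by (apply (le_INR 1); lia).
  destruct (PrimeArith.ln_fact_bounds n Hn) as [Hf1 Hf2].
  rewrite PrimeArith.ln_fact_primes in Hf1, Hf2.
  pose proof (PrimeArith.chebyshev_theta_le n) as Hth.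
  rewrite PrimeArith.primes_upto_List in *.
  change (List.filter prime.prime (List.seq 1 n)) with (filter prime.prime (seq 1 n)) in *.
  unfold primes_between. rewrite Nat.sub_0_r.
  set (P := filter prime.prime (seq 1 n)) in *.
  set (v := fun p => INR (prime.logn p (ssrnat.factorial n))) in *.
  assert (HP : forall p, In p P -> 2 <= INR p <= INR n /\
     INR n / INR p - 1 <= v p /\ (INR p - 1) * v p <= INR n /\ 0 <= ln (INR p)).
  { intros p Hp. apply filter_In in Hp. destruct Hp as [Hp Hpr]. apply in_seq in Hp.
    pose proof (PrimeArith.prime_ge2 p Hpr) as H2. apply le_INR in H2. simpl in H2.
    destruct (PrimeArith.INR_logn_fact n p Hpr) as [H3 H4].
    repeat split; auto.
    - apply le_INR; lia.
    - rewrite <- ln_1. apply ln_le; lra. }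
  split.
  - (* [1/(p-1) <= 1/p + 2/p^2] *)
    assert (H : Rsum (fun p => v p * ln (INR p)) P <=
      INR n * (Rsum (fun p => ln (INR p) / INR p) P + 2 * Rsum (fun p => ln (INR p) / INR p ^ 2) P)).
    { rewrite <- Rsum_scal, <- Rsum_plus, <- Rsum_scal. apply Rsum_le. intros p Hp.
      destruct (HP p Hp) as [H1 [_ [H3 H4]]].
      replace (INR n * (ln (INR p) / INR p + 2 * (ln (INR p) / INR p ^ 2)))
        with (INR n * (/ INR p + 2 / INR p ^ 2) * ln (INR p)) by (field; lra).
      apply Rmult_le_compat_r; [easy|].
      apply Rle_trans with (INR n / (INR p - 1)); [apply le_div_of; lra|].
      unfold Rdiv. apply Rmult_le_compat_l; [lra|].
      apply Rmult_le_reg_r with ((INR p - 1) * INR p ^ 2); [apply Rmult_lt_0_compat; nra|].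
      replace ((/ INR p + 2 * / INR p ^ 2) * ((INR p - 1) * INR p ^ 2))
        with ((INR p + 2) * (INR p - 1)) by (field; lra).
      replace (/ (INR p - 1) * ((INR p - 1) * INR p ^ 2)) with (INR p ^ 2) by (field; lra).
      nra. }
    assert (H2 : Rsum (fun p => ln (INR p) / INR p ^ 2) P <= 2).
    { eapply Rle_trans; [|apply (sum_ln_sq n)]. apply Rsum_incl.
      - apply NoDup_filter, seq_NoDup.
      - intros p Hp. now apply filter_In in Hp.
      - intros k Hk. apply in_seq in Hk. apply Rdiv_le_0_compat.
        + apply ln_nonneg_nat. lia.
        + apply pow_lt, lt_0_INR. lia. }
    set (M := Rsum (fun p => ln (INR p) / INR p) P) in *.
    apply Rmult_le_reg_l with (INR n); [lra|]. unfold v in H.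
    set (S2 := Rsum (fun p => ln (INR p) / INR p ^ 2) P) in *.
    assert (INR n * S2 <= INR n * 2) by (apply Rmult_le_compat_l; lra). lra.
  - assert (H : INR n * Rsum (fun p => ln (INR p) / INR p) P - Rsum (fun p => ln (INR p)) P
        <= Rsum (fun p => v p * ln (INR p)) P).
    { rewrite <- Rsum_scal, <- Rsum_minus. apply Rsum_le. intros p Hp.
      destruct (HP p Hp) as [H1 [H2 [_ H4]]].
      replace (INR n * (ln (INR p) / INR p) - ln (INR p)) with ((INR n / INR p - 1) * ln (INR p))
        by (field; lra).
      now apply Rmult_le_compat_r. }
    apply Rmult_le_reg_l with (INR n); [lra|].
    unfold v in H. lra.
Qed.

Lemma mertens_interval (a b : nat) : (1 <= a <= b)%nat ->
  ln (INR b) - ln (INR a) - 7 <= Rsum (fun p => ln (INR p) / INR p) (primes_between a b).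
Proof.
  intros Hab. pose proof (mertens a ltac:(lia)) as [_ Ha]. pose proof (mertens b ltac:(lia)) as [Hb _].
  rewrite (primes_between_split a b), Rsum_app in Hb by lia.
  assert (ln 4 <= 2).
  { replace 4 with (2 * 2) by ring. rewrite ln_mult by lra.
    pose proof (ln_le_sub1 2 ltac:(lra)). lra. }
  lra.
Qed.

(** * Products of primes taken from blocks *)

Definition all_prime (B : list nat) : Prop := forall p, In p B -> prime.prime p = true.

Fixpoint lprod (l : list nat) : nat :=
  match l with [] => 1 | p :: l' => (p * lprod l')%nat end.

Lemma prime_divide_lprod p l : prime.prime p = true -> all_prime l ->
  Nat.divide p (lprod l) -> In p l.
Proof.
  intros Hp. induction l as [|q l IH]; simpl; intros Hl Hd.
  - apply Nat.divide_1_r in Hd. pose proof (PrimeArith.prime_ge2 p Hp). lia.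
  - apply PrimeArith.prime_Euclid in Hd; [|easy]. destruct Hd as [Hd|Hd].
    + left. symmetry. apply PrimeArith.prime_divide_prime; auto. apply Hl. now left.
    + right. apply IH; auto. intros r Hr. apply Hl. now right.
Qed.

Lemma lprod_pos l : all_prime l -> (1 <= lprod l)%nat.
Proof.
  induction l as [|q l IH]; simpl; intros Hl; [lia|].
  assert (1 <= lprod l)%nat by (apply IH; intros r Hr; apply Hl; now right).
  pose proof (PrimeArith.prime_ge2 q (Hl q (or_introl eq_refl))). nia.
Qed.

Lemma lprod_le l P : (forall p, In p l -> (p <= P)%nat) -> (lprod l <= P ^ length l)%nat.
Proof.
  induction l as [|q l IH]; simpl; intros Hl; [lia|].
  apply Nat.mul_le_mono; auto.
Qed.

Lemma lprod_app l l' : lprod (l ++ l') = (lprod l * lprod l')%nat.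
Proof. induction l as [|q l IH]; simpl; [lia|]. rewrite IH; lia. Qed.

(* If [a] is built from primes that do not divide [y], then [a | x y] forces [a | x]. *)
Lemma lprod_divide_cancel l x y : all_prime l ->
  (forall p, In p l -> ~ Nat.divide p y) ->
  Nat.divide (lprod l) (x * y) -> Nat.divide (lprod l) x.
Proof.
  revert x. induction l as [|p l IH]; simpl; intros x Hl Hy Hd; [apply Nat.divide_1_l|].
  assert (Hp : prime.prime p = true) by (apply Hl; now left).
  pose proof (PrimeArith.prime_ge2 p Hp) as Hp2.
  assert (Hpx : Nat.divide p x).
  { assert (Hpd : Nat.divide p (x * y)).
    { eapply Nat.divide_trans; [|exact Hd]. apply Nat.divide_factor_l. }
    apply PrimeArith.prime_Euclid in Hpd; [|easy]. destruct Hpd as [|Hpd]; [easy|].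
    exfalso. apply (Hy p); auto. }
  destruct Hpx as [x' ->]. rewrite (Nat.mul_comm x' p) in *.
  apply Nat.mul_divide_mono_l. apply IH.
  - intros r Hr. apply Hl. now right.
  - intros r Hr. apply Hy. now right.
  - rewrite <- Nat.mul_assoc in Hd. apply Nat.mul_divide_cancel_l in Hd; [easy|lia].
Qed.

(** Recovers the factor coming from one block out of a product over all blocks; with disjoint blocks
    this makes distinct choices give distinct pairs (k, m). *)
Lemma lprod_factor_unique l l' x y : all_prime l -> all_prime l' -> 
  (forall p, In p l -> ~ Nat.divide p y) -> (forall p, In p l' -> ~ Nat.divide p x) ->
  (lprod l * x = lprod l' * y)%nat -> lprod l = lprod l'.
Proof.
  intros Hl Hl' Hy Hx E. apply Nat.divide_antisym.
  - apply (lprod_divide_cancel l (lprod l') y); auto. rewrite <- E. apply Nat.divide_factor_l.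
  - apply (lprod_divide_cancel l' (lprod l) x); auto. rewrite E. apply Nat.divide_factor_l.
Qed.

(** * Products of a fixed number of primes from one block, and their splittings *)

Fixpoint combos (B : list nat) (w : nat) : list nat :=
  match B with
  | [] => match w with O => [1%nat] | S _ => [] end
  | p :: B' =>
      match w with O => [] | S w' => map (Nat.mul p) (combos B' w') end ++ combos B' w
  end.

(* Pairs (k, m): k a product of [i], m a product of [v] elements of [B], all distinct. *)
Fixpoint splits (B : list nat) (i v : nat) : list (nat * nat) :=
  match B with
  | [] => match i, v with O, O => [(1, 1)%nat] | _, _ => [] end
  | p :: B' =>
      match i with O => [] | S i' => map (fun q => (p * fst q, snd q)%nat) (splits B' i' v) end ++
      match v with O => [] | S v' => map (fun q => (fst q, p * snd q)%nat) (splits B' i v') end ++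
      splits B' i v
  end.

Lemma combos_lprod B w n : In n (combos B w) ->
  exists l, incl l B /\ length l = w /\ n = lprod l.
Proof.
  revert w n. induction B as [|p B IH]; intros w n H.
  - destruct w; simpl in H; [|easy]. destruct H as [<-|[]]. exists []. repeat split. easy.
  - simpl in H. apply in_app_iff in H. destruct H as [H|H].
    + destruct w as [|w]; [easy|]. apply in_map_iff in H. destruct H as [n' [<- H]].
      destruct (IH _ _ H) as [l [H1 [H2 ->]]]. exists (p :: l). repeat split.
      * intros x [->|Hx]; [now left|right; auto].
      * simpl; now rewrite H2.
    + destruct (IH _ _ H) as [l [H1 [H2 ->]]]. exists l. repeat split; auto.
      intros x Hx. right; auto.
Qed.

Lemma splits_combos B i v k m : In (k, m) (splits B i v) ->
  In k (combos B i) /\ In m (combos B v) /\ In (k * m)%nat (combos B (i + v)).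
Proof.
  revert i v k m. induction B as [|p B IH]; intros i v k m H.
  - destruct i, v; simpl in H; try easy. destruct H as [E|[]].
    injection E as <- <-. simpl. auto.
  - cbn [splits] in H. apply in_app_iff in H. destruct H as [H|H].
    + destruct i as [|i]; [easy|]. apply in_map_iff in H. destruct H as [[k' m'] [E H]].
      injection E as <- <-. cbn [fst snd]. destruct (IH _ _ _ _ H) as [H1 [H2 H3]].
      split; [|split].
      * cbn [combos]. apply in_app_iff. left. now apply in_map.
      * cbn [combos]. apply in_app_iff. now right.
      * cbn [combos Nat.add]. apply in_app_iff. left. rewrite <- Nat.mul_assoc. now apply in_map.
    + apply in_app_iff in H. destruct H as [H|H].
      * destruct v as [|v]; [easy|]. apply in_map_iff in H. destruct H as [[k' m'] [E H]].
        injection E as <- <-. cbn [fst snd]. destruct (IH _ _ _ _ H) as [H1 [H2 H3]].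
        split; [|split].
        -- cbn [combos]. apply in_app_iff. now right.
        -- cbn [combos]. apply in_app_iff. left. now apply in_map.
        -- rewrite Nat.add_succ_r. cbn [combos]. apply in_app_iff. left.
           replace (k' * (p * m'))%nat with (p * (k' * m'))%nat by ring. now apply in_map.
      * destruct (IH _ _ _ _ H) as [H1 [H2 H3]].
        split; [|split]; cbn [combos]; apply in_app_iff; now right.
Qed.

Lemma NoDup_app_disjoint {A} (l l' : list A) :
  NoDup l -> NoDup l' -> (forall a, In a l -> In a l' -> False) -> NoDup (l ++ l').
Proof.
  induction l as [|a l IH]; simpl; intros Hl Hl' H; [easy|].
  inversion Hl; subst. constructor.
  - rewrite in_app_iff. intros [?|?]; [easy|]. eapply H; eauto.
  - apply IH; auto. intros b Hb. apply H. now right.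
Qed.

Lemma all_prime_incl l B : incl l B -> all_prime B -> all_prime l.
Proof. intros H HB p Hp. apply HB. auto. Qed.

Lemma prime_not_divide_combos p B w n : prime.prime p = true -> all_prime B -> ~ In p B ->
  In n (combos B w) -> ~ Nat.divide p n.
Proof.
  intros Hp HB Hn H Hd. apply combos_lprod in H. destruct H as [l [H1 [_ ->]]].
  apply Hn, H1. apply prime_divide_lprod; auto. now apply (all_prime_incl l B).
Qed.

(** The three branches are told apart by the head prime: it divides k, or m, or neither. *)
Lemma NoDup_splits B i v : NoDup B -> all_prime B -> NoDup (splits B i v).
Proof.
  revert i v. induction B as [|p B IH]; intros i v Hnd HB.
  - destruct i, v; simpl; repeat constructor; auto.
  - inversion Hnd as [|? ? Hp HndB]; subst.
    assert (Hpp : prime.prime p = true) by (apply HB; now left).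
    assert (HB' : all_prime B) by (intros q Hq; apply HB; now right).
    pose proof (PrimeArith.prime_ge2 p Hpp) as Hp2.
    assert (Hno : forall i v k m, In (k, m) (splits B i v) -> ~ Nat.divide p k /\ ~ Nat.divide p m).
    { intros i' v' k m H. apply splits_combos in H. destruct H as [H1 [H2 _]].
      split; eapply prime_not_divide_combos; eauto. }
    cbn [splits]. apply NoDup_app_disjoint; [| apply NoDup_app_disjoint |].
    + destruct i as [|i]; [constructor|]. apply NoDup_map_NoDup_ForallPairs; auto.
      intros [a b] [c d] _ _ E. injection E as E1 E2. f_equal; nia.
    + destruct v as [|v]; [constructor|]. apply NoDup_map_NoDup_ForallPairs; auto.
      intros [a b] [c d] _ _ E. injection E as E1 E2. f_equal; nia.
    + auto.
    + intros [k m] H1 H2. destruct v as [|v]; [easy|]. apply in_map_iff in H1.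
      destruct H1 as [[k' m'] [E H1]]. injection E as <- <-. apply Hno in H2.
      apply (proj2 H2). apply Nat.divide_factor_l.
    + intros [k m] H1 H2. destruct i as [|i]; [easy|]. apply in_map_iff in H1.
      destruct H1 as [[k' m'] [E H1]]. injection E as <- <-.
      apply in_app_iff in H2. destruct H2 as [H2|H2].
      * destruct v as [|v]; [easy|]. apply in_map_iff in H2.
        destruct H2 as [[k2 m2] [E H2]]. injection E as E1 E2. apply Hno in H2.
        apply (proj1 H2). rewrite E1. apply Nat.divide_factor_l.
      * apply Hno in H2. apply (proj1 H2). apply Nat.divide_factor_l.
Qed.

Lemma inv_INR_mul a b : / INR (a * b) = / INR a * / INR b.
Proof. rewrite mult_INR. apply Rinv_mult. Qed.

(* Elementary symmetric functions of the reciprocals. *)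
Definition esym (B : list nat) (w : nat) : R := Rsum (fun n => / INR n) (combos B w).

Lemma esym_nil_S w : esym [] (S w) = 0.
Proof. reflexivity. Qed.

Lemma esym_0 B : esym B 0 = 1.
Proof.
  unfold esym. induction B as [|p B IH]; [|exact IH].
  simpl. rewrite Rinv_1. ring.
Qed.

Lemma esym_cons p B w : esym (p :: B) (S w) = / INR p * esym B w + esym B (S w).
Proof.
  unfold esym. cbn [combos]. rewrite Rsum_app, Rsum_map. f_equal.
  rewrite <- Rsum_scal. apply Rsum_ext; intros; apply inv_INR_mul.
Qed.

Lemma esym_nonneg B w : 0 <= esym B w.
Proof. apply Rsum_nonneg; intros; apply inv_INR_nonneg. Qed.

Definition split_sum (B : list nat) (i v : nat) : R :=
  Rsum (fun q => / INR (fst q * snd q)) (splits B i v).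

Lemma split_sum_cons p B i v : split_sum (p :: B) i v =
  match i with O => 0 | S i' => / INR p * split_sum B i' v end +
  match v with O => 0 | S v' => / INR p * split_sum B i v' end + split_sum B i v.
Proof.
  unfold split_sum. cbn [splits]. rewrite !Rsum_app, <- Rplus_assoc. f_equal. f_equal.
  - destruct i as [|i]; [easy|]. rewrite Rsum_map, <- Rsum_scal. apply Rsum_ext.
    intros [k m] _. cbn [fst snd]. now rewrite <- Nat.mul_assoc, inv_INR_mul.
  - destruct v as [|v]; [easy|]. rewrite Rsum_map, <- Rsum_scal. apply Rsum_ext.
    intros [k m] _. cbn [fst snd].
    replace (k * (p * m))%nat with (p * (k * m))%nat by ring. now rewrite inv_INR_mul.
Qed.

Definition binom (i v : nat) : R := INR (fact (i + v)) / (INR (fact i) * INR (fact v)).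

Lemma binom_0_l v : binom 0 v = 1.
Proof. unfold binom. simpl. pose proof (INR_fact_neq_0 v). field. easy. Qed.

Lemma binom_0_r i : binom i 0 = 1.
Proof.
  unfold binom. rewrite Nat.add_0_r. simpl. pose proof (INR_fact_neq_0 i). field. easy.
Qed.

Lemma binom_SS i v : binom (S i) (S v) = binom i (S v) + binom (S i) v.
Proof.
  unfold binom. rewrite !Nat.add_succ_r, Nat.add_succ_l.
  rewrite (fact_simpl (S (i + v))), (fact_simpl i), (fact_simpl v), !mult_INR, !S_INR, plus_INR.
  pose proof (INR_fact_neq_0 i). pose proof (INR_fact_neq_0 v).
  pose proof (pos_INR i). pose proof (pos_INR v).
  field. repeat split; auto; lra.
Qed.

(** Each product of i + v distinct primes is split as k m in binomially many ways; the induction on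
    the block is Pascal's rule. *)
Lemma split_sum_binom B i v : split_sum B i v = binom i v * esym B (i + v).
Proof.
  revert i v. induction B as [|p B IH]; intros i v.
  - destruct i as [|i], v as [|v]; unfold split_sum; cbn [splits Rsum].
    + rewrite binom_0_l, esym_0. simpl. rewrite Rinv_1. ring.
    + cbn [Nat.add]. rewrite esym_nil_S. ring.
    + cbn [Nat.add]. rewrite esym_nil_S. ring.
    + cbn [Nat.add]. rewrite esym_nil_S. ring.
  - rewrite split_sum_cons. destruct i as [|i], v as [|v].
    + rewrite IH. cbn [Nat.add]. rewrite !esym_0. ring.
    + rewrite !IH. cbn [Nat.add]. rewrite esym_cons, !binom_0_l. ring.
    + rewrite !IH, !Nat.add_0_r, esym_cons, !binom_0_r. ring.
    + rewrite !IH. cbn [Nat.add]. rewrite esym_cons, !Nat.add_succ_r, binom_SS. ring.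
Qed.

(** (w + 1) e_(w+1) is the sum over w-subsets of their weight times the sum of 1/p over the primes
    left out. The w primes used remove at most w q from the full sum, so consecutive e_w have a
    ratio bounded below. *)
Lemma esym_newton B q w : 0 <= q -> (forall p, In p B -> / INR p <= q) ->
  esym B w * (Rsum (fun p => / INR p) B - INR w * q) <= INR (S w) * esym B (S w).
Proof.
  intros Hq. revert w. induction B as [|p B IH]; intros w HB.
  - rewrite esym_nil_S. destruct w; [rewrite esym_0|rewrite esym_nil_S]; simpl; lra.
  - assert (IH' : forall w, esym B w * (Rsum (fun p => / INR p) B - INR w * q)
        <= INR (S w) * esym B (S w)) by (intros; apply IH; intros; apply HB; now right).
    assert (Hz : / INR p <= q) by (apply HB; now left).
    pose proof (inv_INR_nonneg p) as Hz0.
    rewrite esym_cons. cbn [Rsum]. set (s := Rsum (fun p => / INR p) B) in *.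
    set (z := / INR p) in *. destruct w as [|w].
    + specialize (IH' 0%nat). rewrite !esym_0 in *. simpl in *. lra.
    + rewrite esym_cons. fold z. rewrite (S_INR (S w)).
      pose proof (IH' w) as H1. pose proof (IH' (S w)) as H2. rewrite (S_INR (S w)) in H2.
      rewrite S_INR in *. set (x := INR w) in *.
      pose proof (esym_nonneg B w) as E0.
      set (e0 := esym B w) in *. set (e1 := esym B (S w)) in *. set (e2 := esym B (S (S w))) in *.
      assert (0 <= z * e0 * (q - z)) by (apply Rmult_le_pos; [apply Rmult_le_pos; lra|lra]).
      assert (z * (e0 * (s - x * q)) <= z * ((x + 1) * e1)) by (apply Rmult_le_compat_l; lra).
      nra.
Qed.

(** * Factorials, the number of products, and the gain of one block *)

Lemma binom_ge i v : INR v ^ i / INR (fact i) <= binom i v.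
Proof.
  unfold binom. pose proof (INR_fact_lt_0 i). pose proof (INR_fact_lt_0 v).
  replace (INR v ^ i / INR (fact i))
    with (INR v ^ i * INR (fact v) / (INR (fact i) * INR (fact v))) by (field; lra).
  unfold Rdiv. apply Rmult_le_compat_r; [left; apply Rinv_0_lt_compat; nra|].
  clear H. induction i as [|i IH]; [simpl; lra|].
  rewrite Nat.add_succ_l, fact_simpl, mult_INR, <- tech_pow_Rmult, Rmult_assoc.
  apply Rmult_le_compat; auto.
  - apply pos_INR.
  - apply Rmult_le_pos; [apply pow_le, pos_INR|lra].
  - apply le_INR. lia.
Qed.

(** (1 + 1/n)^n <= e <= (1 + 1/n)^(n+1), the step of both Stirling-type inductions below. *)
Lemma pow_succ_ratio (n : nat) : (1 <= n)%nat ->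
  INR (S n) ^ n <= exp 1 * INR n ^ n /\ exp 1 * INR n ^ S n <= INR (S n) ^ S n.
Proof.
  intros Hn. assert (Hn' : 1 <= INR n) by (apply (le_INR 1); lia).
  pose proof (ln_succ_bounds n Hn) as [H1 H2].
  assert (HS : 0 < INR (S n)) by (apply lt_0_INR; lia).
  assert (Ep : forall k x, 0 < x -> x ^ k = exp (INR k * ln x)).
  { intros k x Hx. rewrite <- Rpower_pow by easy. reflexivity. }
  rewrite !Ep, <- !exp_plus by lra. rewrite S_INR in *. split; apply exp_le_exp.
  - assert (INR n * (ln (INR n + 1) - ln (INR n)) <= INR n * / INR n)
      by (apply Rmult_le_compat_l; lra).
    rewrite Rinv_r in H by lra. lra.
  - assert ((INR n + 1) * / (INR n + 1) <= (INR n + 1) * (ln (INR n + 1) - ln (INR n)))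
      by (apply Rmult_le_compat_l; lra).
    rewrite Rinv_r in H by lra. lra.
Qed.

Lemma fact_upper (n : nat) : INR (fact (S n)) * exp (INR n) <= INR (S n) ^ S (S n).
Proof.
  induction n as [|n IH].
  - simpl. rewrite exp_0. lra.
  - rewrite (fact_simpl (S n)), mult_INR.
    replace (exp (INR (S n))) with (exp (INR n) * exp 1) by (rewrite <- exp_plus, <- S_INR; easy).
    rewrite <- (tech_pow_Rmult (INR (S (S n))) (S (S n))).
    pose proof (pow_succ_ratio (S n) ltac:(lia)) as [_ H].
    apply Rle_trans with (INR (S (S n)) * (exp 1 * INR (S n) ^ S (S n))).
    + rewrite !Rmult_assoc. apply Rmult_le_compat_l; [apply pos_INR|].
      pose proof (exp_pos 1). nra.
    + apply Rmult_le_compat_l; [apply pos_INR|easy].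
Qed.

Lemma fact_lower (n : nat) : INR n ^ n <= INR (fact n) * exp (INR n).
Proof.
  destruct n as [|n]; [simpl; rewrite exp_0; lra|].
  induction n as [|n IH].
  - simpl. pose proof (exp_ineq1_le 1). lra.
  - rewrite (fact_simpl (S n)), mult_INR, (S_INR (S n)), exp_plus, <- (S_INR (S n)).
    rewrite <- tech_pow_Rmult, Rmult_assoc. apply Rmult_le_compat_l; [apply pos_INR|].
    pose proof (pow_succ_ratio (S n) ltac:(lia)) as [H _].
    eapply Rle_trans; [apply H|].
    pose proof (exp_pos 1). nra.
Qed.

(** Each choice of w elements has w! orderings among the P^w tuples. A real [P] lets the size of a
    block be replaced by the endpoint of its interval. *)
Lemma length_combos B w (P : R) : INR (length B) <= P ->
  INR (length (combos B w)) * INR (fact w) <= P ^ w.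
Proof.
  revert w P. induction B as [|p B IH]; intros w P HP.
  - simpl in HP. destruct w as [|w]; simpl; [lra|].
    rewrite Rmult_0_l. apply Rmult_le_pos; [lra|]. apply pow_le; lra.
  - cbn [length] in HP. rewrite S_INR in HP. pose proof (pos_INR (length B)) as H0.
    destruct w as [|w].
    + specialize (IH 0%nat (P - 1) ltac:(lra)). cbn [combos]. exact IH.
    + cbn [combos]. rewrite length_app, length_map, plus_INR.
      pose proof (IH w (P - 1) ltac:(lra)) as H1. pose proof (IH (S w) (P - 1) ltac:(lra)) as H2.
      (* The first two terms of the expansion of ((P - 1) + 1)^(w+1). *)
      assert (Hp : (P - 1) ^ S w + INR (S w) * (P - 1) ^ w <= P ^ S w).
      { clear -HP H0. induction w as [|w IHw]; [simpl; lra|].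
        rewrite <- (tech_pow_Rmult P (S w)). rewrite (S_INR (S w)).
        assert (0 <= (P - 1) ^ w) by (apply pow_le; lra).
        assert (0 <= INR (S w)) by apply pos_INR.
        assert (P * ((P - 1) ^ S w + INR (S w) * (P - 1) ^ w) <= P * P ^ S w)
          by (apply Rmult_le_compat_l; lra).
        assert (0 <= INR (S w) * (P - 1) ^ w) by now apply Rmult_le_pos.
        simpl pow in *. nra. }
      rewrite fact_simpl, mult_INR in H2 |- *.
      assert (INR (S w) * (INR (length (combos B w)) * INR (fact w)) <= INR (S w) * (P - 1) ^ w)
        by (apply Rmult_le_compat_l; [apply pos_INR|easy]).
      nra.
Qed.

Lemma esym_step B q w n : 0 <= q -> (forall p, In p B -> / INR p <= q) ->
  (n < w)%nat -> 0 < Rsum (fun p => / INR p) B - INR w * q ->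
  esym B n * ((Rsum (fun p => / INR p) B - INR w * q) / INR w) <= esym B (S n).
Proof.
  intros Hq HB Hn Hs. pose proof (esym_newton B q n Hq HB) as H.
  set (s := Rsum _ B) in *.
  assert (Hw : 0 < INR w) by (apply lt_0_INR; lia).
  assert (HSn : INR (S n) <= INR w) by (apply le_INR; lia).
  pose proof (esym_nonneg B n). pose proof (esym_nonneg B (S n)).
  rewrite S_INR in HSn.
  unfold Rdiv. rewrite <- Rmult_assoc. apply div_le_of; [lra|].
  apply Rle_trans with (esym B n * (s - INR n * q)); [apply Rmult_le_compat_l; nra|].
  eapply Rle_trans; [apply H|]. rewrite S_INR, Rmult_comm. apply Rmult_le_compat_l; lra.
Qed.

Lemma esym_pos B q w n : 0 <= q -> (forall p, In p B -> / INR p <= q) ->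
  (n <= w)%nat -> 0 < Rsum (fun p => / INR p) B - INR w * q -> 0 < esym B n.
Proof.
  intros Hq HB Hn Hs. induction n as [|n IH]; [rewrite esym_0; lra|].
  eapply Rlt_le_trans; [|apply (esym_step B q w n); auto].
  apply Rmult_lt_0_compat; [apply IH; lia|]. apply Rdiv_lt_0_compat; [lra|]. apply lt_0_INR; lia.
Qed.

(** Put I = i + 1 and w = I + v. Consecutive e_j up to w have ratio at least d = (s - w q)/w, so e_w
    >= d^(I/2) sqrt(e_v e_w). The number of splittings is at least v^I / I!, and the last hypothesis
    says I <= v sqrt d; what remains is I^I / I! >= e^i / (i + 1), by [fact_upper]. *)
Lemma block_gain B q i v : 0 <= q -> (forall p, In p B -> / INR p <= q) ->
  0 < Rsum (fun p => / INR p) B - INR (S i + v) * q ->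
  INR (S i) ^ 2 * INR (S i + v) <= INR v ^ 2 * (Rsum (fun p => / INR p) B - INR (S i + v) * q) ->
  exp (INR i) / INR (S i) * sqrt (esym B v * esym B (S i + v)) <= split_sum B (S i) v.
Proof.
  intros Hq HB Hs Hi. set (s := Rsum _ B) in *. set (w := (S i + v)%nat) in *.
  assert (Hw : 0 < INR w) by (apply lt_0_INR; unfold w; lia).
  set (d := (s - INR w * q) / INR w). assert (Hd : 0 < d) by now apply Rdiv_lt_0_compat.
  assert (Hchain : forall j, (j <= S i)%nat -> esym B v * d ^ j <= esym B (j + v)).
  { induction j as [|j IH]; intros Hj; [simpl; lra|].
    eapply Rle_trans; [|apply (esym_step B q w (j + v)); auto; unfold w; lia].
    fold s d. rewrite <- tech_pow_Rmult. specialize (IH ltac:(lia)). nra. }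
  specialize (Hchain (S i) (Nat.le_refl _)). fold w in Hchain.
  rewrite split_sum_binom. fold w.
  pose proof (esym_pos B q w w Hq HB (Nat.le_refl _) Hs) as Hew.
  pose proof (esym_pos B q w v Hq HB ltac:(unfold w; lia) Hs) as Hev.
  assert (HSi : 0 < INR (S i)) by (apply lt_0_INR; lia).
  assert (Hvd : INR (S i) <= INR v * sqrt d).
  { pose proof (pos_INR v). pose proof (sqrt_pos d).
    apply Rsqr_incr_0_var; [|now apply Rmult_le_pos].
    rewrite Rsqr_mult, Rsqr_sqrt by lra. unfold Rsqr, d.
    apply Rmult_le_reg_r with (INR w); [easy|].
    replace (INR v * INR v * ((s - INR w * q) / INR w) * INR w)
      with (INR v ^ 2 * (s - INR w * q)) by (field; lra). lra. }
  assert (Hb : exp (INR i) / INR (S i) <= binom (S i) v * sqrt d ^ S i).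
  { pose proof (INR_fact_lt_0 (S i)) as Hf.
    apply Rle_trans with (INR v ^ S i / INR (fact (S i)) * sqrt d ^ S i).
    - replace (INR v ^ S i / INR (fact (S i)) * sqrt d ^ S i)
        with ((INR v * sqrt d) ^ S i / INR (fact (S i))) by (rewrite Rpow_mult_distr; field; lra).
      apply le_div_of; [easy|]. apply Rle_trans with (INR (S i) ^ S i).
      + pose proof (fact_upper i) as H. rewrite <- tech_pow_Rmult in H.
        apply Rmult_le_reg_l with (INR (S i)); [easy|].
        replace (INR (S i) * (exp (INR i) / INR (S i) * INR (fact (S i))))
          with (INR (fact (S i)) * exp (INR i)) by (field; lra). easy.
      + apply pow_incr. lra.
    - apply Rmult_le_compat_r; [apply pow_le, sqrt_pos|apply binom_ge]. }
  apply Rle_trans with (binom (S i) v * sqrt d ^ S i * sqrt (esym B v * esym B w)).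
  - apply Rmult_le_compat_r; [apply sqrt_pos|easy].
  - assert (Hbn : 0 <= binom (S i) v).
    { eapply Rle_trans; [|apply binom_ge]. apply Rdiv_le_0_compat; [apply pow_le, pos_INR|].
      apply INR_fact_lt_0. }
    rewrite Rmult_assoc. apply Rmult_le_compat_l; [easy|].
    assert (Esd : sqrt d ^ S i * sqrt d ^ S i = d ^ S i)
      by (rewrite <- Rpow_mult_distr, sqrt_sqrt; lra).
    apply Rsqr_incr_0_var; [|lra].
    rewrite Rsqr_mult, Rsqr_sqrt by (left; now apply Rmult_lt_0_compat).
    unfold Rsqr at 1. rewrite Esd. unfold Rsqr. nra.
Qed.

(** * Several disjoint blocks at once *)

Fixpoint block_products (bs : list (list nat * nat)) : list nat :=
  match bs with
  | [] => [1%nat]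
  | (B, w) :: bs' => flat_map (fun a => map (Nat.mul a) (block_products bs')) (combos B w)
  end.

Fixpoint block_splits (i : nat) (bs : list (list nat * nat)) : list (nat * nat) :=
  match bs with
  | [] => [(1, 1)%nat]
  | (B, v) :: bs' =>
      flat_map (fun q => map (fun q' => (fst q * fst q', snd q * snd q')%nat) (block_splits i bs'))
        (splits B i v)
  end.

Definition add_to_blocks (i : nat) (bs : list (list nat * nat)) : list (list nat * nat) :=
  map (fun b => (fst b, i + snd b)%nat) bs.

Fixpoint disjoint_blocks (bs : list (list nat * nat)) : Prop :=
  match bs with
  | [] => True
  | (B, _) :: bs' => NoDup B /\ all_prime B /\
      (forall p B' v', In p B -> In (B', v') bs' -> ~ In p B') /\ disjoint_blocks bs'
  end.

Lemma block_products_lprod bs n : disjoint_blocks bs -> In n (block_products bs) ->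
  exists l, all_prime l /\ n = lprod l /\
    (forall p, In p l -> exists B v, In (B, v) bs /\ In p B).
Proof.
  revert n. induction bs as [|[B w] bs IH]; intros n Hbs H.
  - destruct H as [<-|[]]. exists []. repeat split; easy.
  - destruct Hbs as [_ [HB [_ Hbs]]]. cbn [block_products] in H.
    apply in_flat_map in H. destruct H as [a [Ha H]]. apply in_map_iff in H.
    destruct H as [x [<- Hx]]. destruct (IH _ Hbs Hx) as [l [H1 [-> H3]]].
    apply combos_lprod in Ha. destruct Ha as [l' [H4 [_ ->]]].
    exists (l' ++ l). split; [|split].
    + intros p Hp. apply in_app_iff in Hp. destruct Hp; auto.
    + now rewrite lprod_app.
    + intros p Hp. apply in_app_iff in Hp. destruct Hp as [Hp|Hp].
      * exists B, w. split; [now left|auto].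
      * destruct (H3 p Hp) as [B' [v' [H5 H6]]]. exists B', v'. split; [now right|easy].
Qed.

Lemma block_splits_products i bs k m : In (k, m) (block_splits i bs) ->
  In k (block_products (map (fun b => (fst b, i)) bs)) /\ In m (block_products bs) /\
  In (k * m)%nat (block_products (add_to_blocks i bs)).
Proof.
  revert k m. induction bs as [|[B v] bs IH]; intros k m H.
  - destruct H as [E|[]]. injection E as <- <-. simpl. auto.
  - cbn [block_splits] in H. apply in_flat_map in H. destruct H as [[k1 m1] [H1 H]].
    apply in_map_iff in H. destruct H as [[k2 m2] [E H2]]. cbn [fst snd] in E.
    injection E as <- <-. destruct (IH _ _ H2) as [H3 [H4 H5]].
    apply splits_combos in H1. destruct H1 as [H6 [H7 H8]].
    cbn [block_products add_to_blocks map fst snd]. repeat split.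
    + apply in_flat_map. exists k1. split; [easy|now apply in_map].
    + apply in_flat_map. exists m1. split; [easy|now apply in_map].
    + apply in_flat_map. exists (k1 * m1)%nat. split; [easy|].
      replace (k1 * k2 * (m1 * m2))%nat with (k1 * m1 * (k2 * m2))%nat by ring.
      now apply in_map.
Qed.

Lemma disjoint_blocks_map (g : list nat * nat -> nat) bs : disjoint_blocks bs ->
  disjoint_blocks (map (fun b => (fst b, g b)) bs).
Proof.
  induction bs as [|[B v] bs IH]; [easy|]. cbn [disjoint_blocks map fst].
  intros [H1 [H2 [H3 H4]]]. repeat split; auto.
  intros p B' v' Hp H. apply in_map_iff in H. destruct H as [[B'' v''] [E H]].
  injection E as <- _. eapply H3; eauto.
Qed.

Lemma Rsum_block_products bs :
  Rsum (fun n => / INR n) (block_products bs) =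
  fold_right (fun b x => esym (fst b) (snd b) * x) 1 bs.
Proof.
  induction bs as [|[B w] bs IH]; [simpl; rewrite Rinv_1; ring|].
  cbn [block_products fold_right fst snd]. rewrite <- IH, Rsum_flat_map.
  unfold esym. rewrite <- Rsum_scal_r. apply Rsum_ext; intros a _.
  rewrite Rsum_map, <- Rsum_scal. apply Rsum_ext; intros; apply inv_INR_mul.
Qed.

Lemma Rsum_block_splits i bs :
  Rsum (fun q => / INR (fst q * snd q)) (block_splits i bs) =
  fold_right (fun b x => split_sum (fst b) i (snd b) * x) 1 bs.
Proof.
  induction bs as [|[B w] bs IH]; [simpl; rewrite Rinv_1; ring|].
  cbn [block_splits fold_right fst snd]. rewrite <- IH, Rsum_flat_map.
  unfold split_sum. rewrite <- Rsum_scal_r. apply Rsum_ext; intros [k m] _.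
  rewrite Rsum_map, <- Rsum_scal. apply Rsum_ext; intros [k' m'] _. cbn [fst snd].
  rewrite <- inv_INR_mul. f_equal. f_equal. ring.
Qed.

Lemma length_block_products bs (K : R) : 0 <= K ->
  (forall B w, In (B, w) bs -> INR (length (combos B w)) <= K) ->
  INR (length (block_products bs)) <= K ^ length bs.
Proof.
  intros HK. induction bs as [|[B w] bs IH]; intros H; [simpl; lra|].
  cbn [block_products length].
  assert (E : length (flat_map (fun a => map (Nat.mul a) (block_products bs)) (combos B w))
    = (length (combos B w) * length (block_products bs))%nat).
  { induction (combos B w) as [|a l IHl]; [easy|].
    cbn [flat_map length]. rewrite length_app, length_map, IHl. lia. }
  rewrite E, mult_INR, <- tech_pow_Rmult.
  apply Rmult_le_compat; auto using pos_INR.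
  - apply H. now left.
  - apply IH. intros B' w' H'. apply H. now right.
Qed.

Lemma NoDup_flat_map {A B} (f : A -> list B) l : NoDup l ->
  (forall a, In a l -> NoDup (f a)) ->
  (forall a a' b, In a l -> In a' l -> In b (f a) -> In b (f a') -> a = a') ->
  NoDup (flat_map f l).
Proof.
  induction l as [|a l IH]; intros Hl Hf Hd; [constructor|].
  inversion Hl; subst. cbn [flat_map]. apply NoDup_app_disjoint.
  - apply Hf. now left.
  - apply IH; auto.
    + intros; apply Hf; now right.
    + intros a1 a2 b H3 H4. apply Hd; now right.
  - intros b Hb Hb'. apply in_flat_map in Hb'. destruct Hb' as [a' [Ha' Hb']].
    assert (a = a') by (apply (Hd a a' b); auto; [now left|now right]). subst. easy.
Qed.

(** The free function [w] covers both components of a pair: k takes a constant number of primes from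
    every block, m takes the numbers recorded in [bs]. *)
Lemma combos_not_divide B (w : list nat * nat -> nat) bs n p v : disjoint_blocks ((B, v) :: bs) ->
  In n (block_products (map (fun b => (fst b, w b)) bs)) -> In p B -> ~ Nat.divide p n.
Proof.
  intros [_ [HB [Hd Hbs]]] Hn Hp Hdiv.
  apply (disjoint_blocks_map w) in Hbs.
  destruct (block_products_lprod _ _ Hbs Hn) as [l [H1 [-> H3]]].
  apply prime_divide_lprod in Hdiv; auto.
  destruct (H3 p Hdiv) as [B' [v' [H4 H5]]]. apply in_map_iff in H4.
  destruct H4 as [[B'' v''] [E H4]]. injection E as <- _. eapply Hd; eauto.
Qed.

(** If two pairs agree, the parts supported on the first block agree by [lprod_factor_unique], since
    the remaining factors avoid its primes; inside one such part, multiplication by a positive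
    number is injective. *)
Lemma NoDup_block_splits i bs : disjoint_blocks bs -> NoDup (block_splits i bs).
Proof.
  induction bs as [|[B v] bs IH]; intros Hbs.
  - simpl. constructor; [easy|constructor].
  - assert (Hbs' := Hbs). destruct Hbs' as [HndB [HB [_ Hbs']]].
    cbn [block_splits].
    assert (Hsnd : map (fun b : list nat * nat => (fst b, snd b)) bs = bs).
    { clear. induction bs as [|[B v] bs IH]; simpl; congruence. }
    assert (Hpos : forall k m, In (k, m) (splits B i v) -> (1 <= k)%nat /\ (1 <= m)%nat).
    { intros k m H. apply splits_combos in H. destruct H as [H1 [H2 _]].
      apply combos_lprod in H1. apply combos_lprod in H2.
      destruct H1 as [l1 [H1 [_ ->]]], H2 as [l2 [H2 [_ ->]]].
      split; apply lprod_pos; eapply all_prime_incl; eauto. }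
    apply NoDup_flat_map.
    + now apply NoDup_splits.
    + intros [k m] H. apply NoDup_map_NoDup_ForallPairs; [|auto].
      destruct (Hpos k m H). intros [a b] [c d] _ _ E. injection E as E1 E2. cbn in *. f_equal; nia.
    + intros [k m] [k' m'] [x y] H1 H2 H3 H4. apply in_map_iff in H3. apply in_map_iff in H4.
      destruct H3 as [[a b] [E H3]], H4 as [[a' b'] [E' H4]]. cbn [fst snd] in *.
      rewrite <- E' in E. injection E as E1 E2.
      apply splits_combos in H1. apply splits_combos in H2.
      destruct H1 as [K1 [M1 _]], H2 as [K2 [M2 _]].
      apply block_splits_products in H3. apply block_splits_products in H4.
      destruct H3 as [A1 [B1 _]], H4 as [A2 [B2 _]].
      rewrite <- Hsnd in B1, B2.
      apply combos_lprod in K1. destruct K1 as [lk [K1 [_ ->]]].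
      apply combos_lprod in K2. destruct K2 as [lk' [K2 [_ ->]]].
      apply combos_lprod in M1. destruct M1 as [lm [M1 [_ ->]]].
      apply combos_lprod in M2. destruct M2 as [lm' [M2 [_ ->]]].
      f_equal.
      * apply (lprod_factor_unique lk lk' a a'); [apply (all_prime_incl lk B)|
          apply (all_prime_incl lk' B)| | |]; auto; intros r Hr.
        -- apply (combos_not_divide B (fun _ => i) bs a' r v); auto.
        -- apply (combos_not_divide B (fun _ => i) bs a r v); auto.
      * apply (lprod_factor_unique lm lm' b b'); [apply (all_prime_incl lm B)|
          apply (all_prime_incl lm' B)| | |]; auto; intros r Hr.
        -- apply (combos_not_divide B snd bs b' r v); auto.
        -- apply (combos_not_divide B snd bs b r v); auto.
Qed.

Lemma block_products_le i P bs n :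
  (forall B v p, In (B, v) bs -> In p B -> (p <= P)%nat) ->
  In n (block_products (map (fun b : list nat * nat => (fst b, i)) bs)) -> (n <= P ^ (i * length bs))%nat.
Proof.
  revert n. induction bs as [|[B v] bs IH]; intros n HP Hn.
  - destruct Hn as [<-|[]]. simpl. rewrite Nat.mul_0_r. simpl. lia.
  - cbn [map block_products fst] in Hn. apply in_flat_map in Hn. destruct Hn as [a [Ha Hn]].
    apply in_map_iff in Hn. destruct Hn as [x [<- Hx]].
    apply combos_lprod in Ha. destruct Ha as [l [H1 [H2 ->]]].
    cbn [length]. rewrite Nat.mul_succ_r, Nat.add_comm, Nat.pow_add_r.
    apply Nat.mul_le_mono.
    + rewrite <- H2. apply lprod_le. intros p Hp. apply (HP B v); [now left|auto].
    + apply IH; auto. intros B' v' p H'. apply (HP B' v'). now right.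
Qed.

(** n^j / j! increases for j <= n, so the bound for w also covers v and serves both resonators; then
    w! >= (w/e)^w turns it into (e n / w)^w. *)
Lemma length_combos_exp B n w v (c : R) : INR (length B) <= n -> (v <= w)%nat -> (1 <= w)%nat ->
  INR w <= n -> INR w * (1 + ln (n / INR w)) <= c -> INR (length (combos B v)) <= exp c.
Proof.
  intros HB Hvw Hw Hwn Hc. assert (Hw' : 1 <= INR w) by (apply (le_INR 1); lia).
  apply Rle_trans with (n ^ w / INR (fact w)).
  - assert (H : forall j, (v + j <= w)%nat -> n ^ v / INR (fact v) <= n ^ (v + j) / INR (fact (v + j))).
    { induction j as [|j IH]; intros Hj; [rewrite Nat.add_0_r; lra|].
      eapply Rle_trans; [apply IH; lia|]. rewrite Nat.add_succ_r, fact_simpl, mult_INR.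
      rewrite <- tech_pow_Rmult. pose proof (INR_fact_lt_0 (v + j)) as Hf.
      assert (HS : 0 < INR (S (v + j)) <= n).
      { split; [apply lt_0_INR; lia|]. apply Rle_trans with (INR w); [apply le_INR; lia|easy]. }
      apply Rle_trans with (n ^ (v + j) / INR (fact (v + j)) * (n / INR (S (v + j)))).
      - rewrite <- (Rmult_1_r (n ^ (v + j) / INR (fact (v + j)))) at 1.
        apply Rmult_le_compat_l; [apply Rdiv_le_0_compat; [apply pow_le; lra|easy]|].
        apply le_div_of; lra.
      - right. field. lra. }
    specialize (H (w - v)%nat ltac:(lia)). replace (v + (w - v))%nat with w in H by lia.
    eapply Rle_trans; [|apply H]. apply le_div_of; [apply INR_fact_lt_0|].
    now apply length_combos.
  - pose proof (INR_fact_lt_0 w) as Hf. pose proof (fact_lower w) as Hl.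
    apply div_le_of; [easy|].
    assert (E : n ^ w = exp (INR w * ln (n / INR w)) * INR w ^ w).
    { rewrite (Rmult_comm (INR w)). 
      rewrite <- (Rpower_pow w n), <- (Rpower_pow w (INR w)) by lra.
      unfold Rpower. rewrite <- exp_plus. f_equal. rewrite ln_div by lra. ring. }
    rewrite E.
    apply Rle_trans with (exp (INR w * ln (n / INR w)) * (INR (fact w) * exp (INR w))).
    + apply Rmult_le_compat_l; [left; apply exp_pos|easy].
    + replace (exp (INR w * ln (n / INR w)) * (INR (fact w) * exp (INR w)))
        with (exp (INR w * (1 + ln (n / INR w))) * INR (fact w)).
      * apply Rmult_le_compat_r; [lra|]. now apply exp_le_exp.
      * rewrite Rmult_plus_distr_l, Rmult_1_r, exp_plus. ring.
Qed.

(* The fourth clause makes the gain of the block at least [e^i / (i+1)] (Lemma [block_gain]);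
   the last one bounds the logarithm of the number of products of [S i + v] primes. *)
Definition rich_block (i : nat) (c : R) (B : list nat) (v : nat) : Prop :=
  exists q n : R, 0 <= q /\ (forall p, In p B -> / INR p <= q) /\
    0 < Rsum (fun p => / INR p) B - INR (S i + v) * q /\
    INR (S i) ^ 2 * INR (S i + v) <= INR v ^ 2 * (Rsum (fun p => / INR p) B - INR (S i + v) * q) /\
    INR (length B) <= n /\ INR (S i + v) <= n /\
    INR (S i + v) * (1 + ln (n / INR (S i + v))) <= c.

(** Both masses and the sum over pairs factor over the blocks, so the gains multiply. As k has [S i]
    primes from each block, it is at most [P ^ (S i * length bs)]; this must stay below N, because k
    runs over the terms of the Dirichlet polynomial. *)
Theorem block_resonator (i P : nat) (c : R) (bs : list (list nat * nat)) :
  disjoint_blocks bs ->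
  (forall B v, In (B, v) bs -> rich_block i c B v) ->
  (forall B v p, In (B, v) bs -> In p B -> (p <= P)%nat) ->
  exists (Rd F : list nat) (Q : list (nat * nat)), NoDup Q /\
    (forall k m, In (k, m) Q ->
       (1 <= k <= P ^ (S i * length bs))%nat /\ (1 <= m)%nat /\ In m Rd /\ In (k * m)%nat F) /\
    INR (length Rd) <= exp c ^ length bs /\ INR (length F) <= exp c ^ length bs /\
    0 < Rsum (fun m => / INR m) Rd * Rsum (fun m => / INR m) F /\
    (exp (INR i) / INR (S i)) ^ length bs *
      sqrt (Rsum (fun m => / INR m) Rd * Rsum (fun m => / INR m) F)
    <= Rsum (fun q => / INR (fst q * snd q)) Q.
Proof.
  intros Hd Hr HP.
  exists (block_products bs), (block_products (add_to_blocks (S i) bs)), (block_splits (S i) bs).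
  split; [now apply NoDup_block_splits|].
  split; [|split; [|split; [|]]].
  - intros k m H. apply block_splits_products in H. destruct H as [H1 [H2 H3]].
    assert (Hk : (1 <= k)%nat).
    { apply block_products_lprod in H1; [|now apply disjoint_blocks_map].
      destruct H1 as [l [H1 [-> _]]]. now apply lprod_pos. }
    assert (Hm : (1 <= m)%nat).
    { apply block_products_lprod in H2; [|easy].
      destruct H2 as [l [H2 [-> _]]]. now apply lprod_pos. }
    repeat split; auto. now apply block_products_le.
  - apply length_block_products; [left; apply exp_pos|].
    intros B v H. destruct (Hr B v H) as [q [n [_ [_ [_ [_ [H1 [H2 H3]]]]]]]].
    apply (length_combos_exp B n (S i + v)); auto; lia.
  - unfold add_to_blocks. rewrite <- (length_map (fun b => (fst b, (S i + snd b)%nat)) bs).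
    apply length_block_products; [left; apply exp_pos|].
    intros B w H. apply in_map_iff in H. destruct H as [[B' v] [E H]].
    injection E as <- <-. cbn [fst snd].
    destruct (Hr B' v H) as [q [n [_ [_ [_ [_ [H1 [H2 H3]]]]]]]].
    apply (length_combos_exp B' n (S i + v)); auto; lia.
  - rewrite !Rsum_block_products, Rsum_block_splits. clear Hd HP.
    set (g := exp (INR i) / INR (S i)).
    assert (Hg : 0 < g) by (apply Rdiv_lt_0_compat; [apply exp_pos|apply lt_0_INR; lia]).
    induction bs as [|[B v] bs IH].
    + simpl. rewrite Rmult_1_r, sqrt_1. lra.
    + destruct IH as [IH1 IH2]; [intros; apply Hr; now right|].
      destruct (Hr B v (or_introl eq_refl)) as [q [n [Hq [HB [Hs [Hi _]]]]]].
      pose proof (block_gain B q i v Hq HB Hs Hi) as Hb. fold g in Hb.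
      pose proof (esym_pos B q (S i + v) (S i + v) Hq HB (Nat.le_refl _) Hs) as Hew.
      pose proof (esym_pos B q (S i + v) v Hq HB ltac:(lia) Hs) as Hev.
      cbn [add_to_blocks map fold_right fst snd length]. fold (add_to_blocks (S i) bs).
      set (X := fold_right (fun b x => esym (fst b) (snd b) * x) 1 bs) in *.
      set (Y := fold_right (fun b x => esym (fst b) (snd b) * x) 1 (add_to_blocks (S i) bs)) in *.
      set (ev := esym B v) in *. set (ew := esym B (S i + v)) in *.
      replace (ev * X * (ew * Y)) with ((ev * ew) * (X * Y)) by ring.
      assert (Hvw : 0 < ev * ew) by now apply Rmult_lt_0_compat.
      split; [now apply Rmult_lt_0_compat|].
      rewrite sqrt_mult, <- tech_pow_Rmult by lra.
      pose proof (sqrt_pos (ev * ew)). pose proof (sqrt_pos (X * Y)).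
      replace (g * g ^ length bs * (sqrt (ev * ew) * sqrt (X * Y)))
        with ((g * sqrt (ev * ew)) * (g ^ length bs * sqrt (X * Y))) by ring.
      apply Rmult_le_compat; auto.
      * apply Rmult_le_pos; lra.
      * apply Rmult_le_pos; [apply pow_le; lra|lra].
Qed.

(** * Choice of parameters *)

(** Replaces ln p by ln b in [mertens_interval]. In the blocks used, ln a and ln b agree up to a
    factor 1 + O(eps), so little is lost. *)
Lemma primes_between_inv_sum (a b : nat) : (1 <= a <= b)%nat -> 0 < ln (INR b) ->
  (ln (INR b) - ln (INR a) - 7) / ln (INR b) <= Rsum (fun p => / INR p) (primes_between a b).
Proof.
  intros Hab Hb. apply div_le_of; [easy|].
  eapply Rle_trans; [apply (mertens_interval a b); lia|].
  rewrite <- Rsum_scal_r. apply Rsum_le. intros p Hp. apply in_primes_between in Hp.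
  assert (0 < INR p) by (apply lt_0_INR; lia).
  assert (ln (INR p) <= ln (INR b)) by (apply ln_le; [easy|apply le_INR; lia]).
  assert (0 < / INR p) by now apply Rinv_0_lt_compat.
  unfold Rdiv. nra.
Qed.

(** Here e^y plays log N and W is the logarithmic cost allotted to the block. The sum of 1/p is
    about eps U / y and w U is about W, so the gain condition reads I^2 <= eps W / y up to factors 1
    + O(eps), whatever U is. The count costs w log(b/w), about w U. *)
Lemma rich_block_primes (eps y U W : R) (a b i v : nat) :
  let w := INR (S i + v) in
  0 < eps <= 1 / 40 -> 1 <= y -> 1 <= U -> (1 <= a <= b)%nat ->
  y + U <= ln (INR a) <= y + U + 1 ->
  y + (1 + eps) * U <= ln (INR b) <= y + (1 + eps) * U + 1 ->
  8 <= eps ^ 2 * U -> y + (1 + eps) * U + 1 <= (1 + eps) * y -> 2 + 2 * ln y <= eps * U ->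
  exp (- U) <= eps * (eps * (1 - eps) * U / ((1 + eps) * y)) ->
  (1 - eps) * W <= w * U <= W -> W <= exp y -> exp y / y ^ 2 <= w ->
  INR (S i) <= eps * w ->
  INR (S i) ^ 2 <= (1 - eps) ^ 5 * eps * W / ((1 + eps) * y) ->
  rich_block i ((1 + 2 * eps) * W) (primes_between a b) v.
Proof.
  intros w Heps Hy HU Hab Ha Hb HU8 HUy HUz Hexp HwU HW Hw Hi Hi2.
  set (L := exp y) in *. assert (HL : 0 < L) by apply exp_pos.
  assert (Ha0 : 0 < INR a) by (apply lt_0_INR; lia).
  assert (Hb0 : 0 < INR b) by (apply lt_0_INR; lia).
  assert (Hy2 : 0 < y ^ 2) by (apply pow_lt; lra).
  assert (Hw0 : 0 < w).
  { eapply Rlt_le_trans; [|exact Hw]. now apply Rdiv_lt_0_compat. }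
  assert (Hlnb : 0 < ln (INR b)) by nra.
  exists (/ INR a), (INR b).
  fold w.
  set (s := Rsum (fun p => / INR p) (primes_between a b)).
  set (s0 := eps * (1 - eps) * U / ((1 + eps) * y)) in *.
  assert (Hs0 : 0 < s0).
  { apply Rdiv_lt_0_compat; [|nra]. repeat apply Rmult_lt_0_compat; lra. }
  assert (Hs : s0 <= s).
  { eapply Rle_trans; [|apply primes_between_inv_sum; auto].
    (* The Mertens error 7 and the rounding 1 of the endpoints together are at most eps^2 U. *)
    assert (Hn : eps * (1 - eps) * U <= ln (INR b) - ln (INR a) - 7) by nra.
    apply Rle_trans with (eps * (1 - eps) * U / ln (INR b)).
    - unfold s0, Rdiv. apply Rmult_le_compat_l; [repeat apply Rmult_le_pos; lra|].
      apply Rinv_le_contravar; lra.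
    - unfold Rdiv. apply Rmult_le_compat_r; [left; now apply Rinv_0_lt_compat|easy]. }
  (* The correction w q of [esym_newton]: w <= e^y and a >= e^(y+U), so it is at most e^(-U). *)
  assert (Hwq : w * / INR a <= eps * s0).
  { eapply Rle_trans; [|exact Hexp].
    assert (HwW : w <= L) by nra.
    apply Rle_trans with (L * / INR a).
    - apply Rmult_le_compat_r; [left; now apply Rinv_0_lt_compat|easy].
    - apply Rle_trans with (exp y * exp (- ln (INR a))).
      + rewrite exp_Ropp, exp_ln by easy. apply Rle_refl.
      + rewrite <- exp_plus. apply exp_le_exp. lra. }
  assert (Hsd : (1 - eps) * s0 <= s - w * / INR a) by lra.
  assert (HIpos : 0 < INR (S i)) by (apply lt_0_INR; lia).
  assert (Hv : (1 - eps) * w <= INR v).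
  { unfold w in *. rewrite plus_INR in *. lra. }
  repeat split.
  - left. now apply Rinv_0_lt_compat.
  - intros p Hp. apply in_primes_between in Hp. apply Rinv_le_contravar; [easy|apply le_INR; lia].
  - nra.
  - apply Rle_trans with (((1 - eps) * w) ^ 2 * ((1 - eps) * s0)).
    (* The five factors 1 - eps: two from v against w, one from w q, one inside [s0], one from w U
       against W. *)
    + assert (Hsw : (1 - eps) ^ 5 * eps * W / ((1 + eps) * y) <= (1 - eps) ^ 2 * w * ((1 - eps) * s0)).
      { unfold s0.
        replace ((1 - eps) ^ 2 * w * ((1 - eps) * (eps * (1 - eps) * U / ((1 + eps) * y))))
          with ((1 - eps) ^ 4 * eps * (w * U) / ((1 + eps) * y)) by (field; nra).
        unfold Rdiv. apply Rmult_le_compat_r; [left; apply Rinv_0_lt_compat; nra|].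
        replace ((1 - eps) ^ 5 * eps * W) with ((1 - eps) ^ 4 * eps * ((1 - eps) * W)) by ring.
        apply Rmult_le_compat_l; [|lra]. apply Rmult_le_pos; [apply pow_le; lra|lra]. }
      replace (((1 - eps) * w) ^ 2 * ((1 - eps) * s0))
        with (((1 - eps) ^ 2 * w * ((1 - eps) * s0)) * w) by ring.
      apply Rmult_le_compat_r; lra.
    + apply Rmult_le_compat; [apply pow_le; nra|nra| |easy].
      apply pow_incr. split; [nra|easy].
  - apply le_INR. unfold primes_between. 
    eapply Nat.le_trans; [apply filter_length_le|]. rewrite length_seq. lia.
  - apply Rle_trans with L; [nra|].
    rewrite <- (exp_ln (INR b)) by easy. apply exp_le_exp. nra.
  - assert (Hln : 1 + ln (INR b / w) <= (1 + 2 * eps) * U).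
    { rewrite ln_div by easy.
      assert (y - 2 * ln y <= ln w).
      { replace (y - 2 * ln y) with (ln (L / y ^ 2)).
        - apply ln_le; [now apply Rdiv_lt_0_compat|easy].
        - rewrite ln_div by easy. unfold L. rewrite ln_exp, ln_pow by lra. simpl. ring. }
      lra. }
    apply Rle_trans with (w * ((1 + 2 * eps) * U)); [apply Rmult_le_compat_l; lra|]. nra.
Qed.

Lemma disjoint_prime_blocks (a v : nat -> nat) (s n : nat) :
  (forall j, (a j <= a (S j))%nat) ->
  disjoint_blocks (map (fun j => (primes_between (a j) (a (S j)), v j)) (seq s n)).
Proof.
  intros Ha.
  assert (Hmono : forall j k, (j <= k)%nat -> (a j <= a k)%nat).
  { intros j k H. induction H; auto. eapply Nat.le_trans; eauto. }
  revert s. induction n as [|n IH]; intros s; [easy|].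
  cbn [seq map disjoint_blocks]. split; [|split; [|split; [|apply IH]]].
  - apply NoDup_filter, seq_NoDup.
  - intros p Hp. now apply in_primes_between in Hp.
  - intros p B' v' Hp HB Hp'. apply in_map_iff in HB. destruct HB as [j [E Hj]].
    injection E as <- _. apply in_seq in Hj.
    apply in_primes_between in Hp. apply in_primes_between in Hp'.
    pose proof (Hmono (S s) j ltac:(lia)). lia.
Qed.

(** * Inequalities for large parameters, and the final choice *)

Definition eventually_large (P : R -> Prop) : Prop := exists M, forall x, M <= x -> P x.

Lemma eventually_large_and P Q :
  eventually_large P -> eventually_large Q -> eventually_large (fun x => P x /\ Q x).
Proof.
  intros [M HM] [M' HM']. exists (Rmax M M'). intros x Hx.
  pose proof (Rmax_l M M'). pose proof (Rmax_r M M'). split; [apply HM|apply HM']; lra.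
Qed.

Lemma exp_dominates_linear (a b c : R) : 0 < c ->
  eventually_large (fun x => a * x + b <= exp (c * x)).
Proof.
  intros Hc. exists (Rmax 1 (2 * (Rabs a + Rabs b) / (c * c) * 2)). intros x Hx.
  pose proof (Rmax_l 1 (2 * (Rabs a + Rabs b) / (c * c) * 2)).
  pose proof (Rmax_r 1 (2 * (Rabs a + Rabs b) / (c * c) * 2)) as H2.
  assert (Hx1 : 1 <= x) by lra.
  pose proof (Rle_abs a). pose proof (Rle_abs b). pose proof (Rabs_pos a). pose proof (Rabs_pos b).
  set (A := Rabs a + Rabs b) in *.
  apply Rle_trans with (A * x); [unfold A; nra|].
  (* [exp (c x) >= (1 + c x / 2)^2 >= c^2 x^2 / 4] *)
  assert (He : c * c * x * x / 4 <= exp (c * x)).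
  { replace (c * x) with (c * x / 2 + c * x / 2) by field. rewrite exp_plus.
    pose proof (exp_ineq1_le (c * x / 2)). assert (0 < c * x) by nra. nra. }
  eapply Rle_trans; [|exact He].
  assert (HA : 4 * A <= c * c * x).
  { apply Rle_trans with (c * c * (2 * A / (c * c) * 2)).
    - right. field. lra.
    - apply Rmult_le_compat_l; [nra|]. unfold A in *. lra. }
  nra.
Qed.

Lemma up_nat_bounds x : 0 <= x -> x < INR (Z.to_nat (up x)) <= x + 1.
Proof.
  intros Hx. destruct (archimed x) as [H1 H2].
  assert (0 <= up x)%Z by (apply le_IZR; simpl; lra).
  rewrite INR_IZR_INZ, Z2Nat.id by easy. lra.
Qed.

Lemma up_nat_mono x x' : 0 <= x <= x' -> (Z.to_nat (up x) <= Z.to_nat (up x'))%nat.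
Proof.
  intros Hx. destruct (up_nat_bounds x ltac:(lra)). destruct (up_nat_bounds x' ltac:(lra)).
  apply Nat.lt_succ_r, INR_lt. rewrite S_INR. lra.
Qed.

(** Collects all losses of the construction. To first order they are 7 + 2 + 3 + 1 + 2 = 15 times e,
    so 17 leaves room; Bernoulli's inequality handles the seventh power. *)
Lemma constant_bound (e : R) : 0 < e <= 1 / 40 ->
  (1 - 17 * e) / 2 <= (1 - e) ^ 2 * ((1 - e) ^ 5 * (1 / 2 - e) / ((1 + e) * (1 + 2 * e))) * (1 - 3 * e).
Proof.
  intros He.
  assert (Hb : 1 - 7 * e <= (1 - e) ^ 7).
  { assert (Hb : forall n, 1 - INR n * e <= (1 - e) ^ n).
    { induction n as [|n IH]; [simpl; lra|]. rewrite S_INR, <- tech_pow_Rmult.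
      pose proof (pos_INR n).
      apply Rle_trans with ((1 - e) * (1 - INR n * e)); [nra|]. apply Rmult_le_compat_l; lra. }
    specialize (Hb 7%nat). simpl INR in Hb. lra. }
  replace ((1 - e) ^ 2 * ((1 - e) ^ 5 * (1 / 2 - e) / ((1 + e) * (1 + 2 * e))) * (1 - 3 * e))
    with ((1 - e) ^ 7 * ((1 / 2 - e) * (1 - 3 * e)) / ((1 + e) * (1 + 2 * e))) by (field; lra).
  apply le_div_of; [nra|].
  apply Rle_trans with ((1 - 7 * e) * ((1 / 2 - e) * (1 - 3 * e))).
  - nra.
  - apply Rmult_le_compat_r; [nra|easy].
Qed.

(** The tangent of ln at 2/e costs e x / 2, and the hypothesis on x absorbs the constant into
    another e x / 2. *)
Lemma sub_two_ln_ge (e x : R) : 0 < e < 1 -> 2 / e * (1 + ln (2 / e)) <= x -> 0 < x ->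
  (1 - e) * x <= x - 2 - ln x.
Proof.
  intros He Hx Hx0.
  pose proof (ln_le_sub1 (e * x / 2) ltac:(nra)) as Hl.
  replace (e * x / 2) with (x / (2 / e)) in Hl at 1 by (field; lra).
  assert (0 < 2 / e) by (apply Rdiv_lt_0_compat; lra).
  rewrite ln_div in Hl by lra.
  assert (1 + ln (2 / e) <= e / 2 * x).
  { apply Rmult_le_reg_l with (2 / e); [lra|]. 
    replace (2 / e * (e / 2 * x)) with x by (field; lra). lra. }
  lra.
Qed.

Lemma ln_up_nat (x u : R) : 0 <= u -> x = exp u ->
  (1 <= Z.to_nat (up x))%nat /\ u <= ln (INR (Z.to_nat (up x))) <= u + 1.
Proof.
  intros Hu ->. pose proof (exp_ineq1_le u). destruct (up_nat_bounds (exp u) ltac:(lra)) as [H1 H2].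
  split; [|split].
  - apply INR_le. simpl. lra.
  - rewrite <- (ln_exp u) at 1. apply ln_le; lra.
  - rewrite <- (ln_exp (u + 1)). apply ln_le; [lra|].
    rewrite exp_plus. pose proof (exp_ineq1_le 1). nra.
Qed.

(** With z = log log log N: [exp L] is N, the fourth clause keeps k within the Dirichlet polynomial,
    the fifth keeps both resonators below N^(1/2 - eps) frequencies, and the last is the logarithm
    of the total gain. *)
Lemma block_parameters (eps : R) : 0 < eps <= 1 / 40 -> eventually_large (fun z =>
  let y := exp z in let L := exp y in
  exists (i P : nat) (c : R) (bs : list (list nat * nat)),
    disjoint_blocks bs /\
    (forall B v, In (B, v) bs -> rich_block i c B v) /\
    (forall B v p, In (B, v) bs -> In p B -> (p <= P)%nat) /\
    INR (P ^ (S i * length bs)) <= exp L /\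
    INR (length bs) * c <= (1 / 2 - eps) * L /\
    sqrt ((1 - 17 * eps) / 2 * (L * z / y)) <= INR (length bs) * (INR i - ln (INR (S i)))).
Proof.
  intros He.
  set (h := ln (1 + eps)).
  assert (Hh : 0 < h <= eps).
  { unfold h. split; [rewrite <- ln_1; apply ln_increasing; lra|].
    pose proof (ln_le_sub1 (1 + eps) ltac:(lra)). lra. }
  assert (Heh : exp h = 1 + eps) by (apply exp_ln; lra).
  set (th0 := 2 / eps * (1 + ln (2 / eps))).
  assert (Hth0 : 1 <= th0).
  { unfold th0. assert (1 <= 2 / eps) by (apply le_div_of; lra).
    assert (0 <= ln (2 / eps)) by (rewrite <- ln_1; apply ln_le; lra). nra. }
  (* Chosen so that C8 y^2 <= L gives th >= th0, from D2 >= eps/2 and W >= h L / (4 z). *)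
  set (C8 := 8 * th0 ^ 2 / (eps * h)).
  assert (HC8 : 0 < C8) by (apply Rdiv_lt_0_compat; nra).
  (* The first three make T = y^eps absorb the Mertens error, 2 + 2 log y, and the smallness
     required of e^(-U); the fourth makes z small against y; the last four, once exponentiated,
     compare multiples of y^2 with L or sqrt L. *)
  destruct (eventually_large_and _ _ (exp_dominates_linear 0 (8 / eps ^ 2) eps (proj1 He))
    (eventually_large_and _ _ (exp_dominates_linear (2 / eps) (2 / eps) eps (proj1 He))
    (eventually_large_and _ _ (exp_dominates_linear 1 (ln (2 / eps ^ 2)) eps (proj1 He))
    (eventually_large_and _ _ (exp_dominates_linear (8 / h) 0 1 Rlt_0_1)
    (eventually_large_and _ _ (exp_dominates_linear 2 (- ln (2 * eps)) 1 Rlt_0_1)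
    (eventually_large_and _ _ (exp_dominates_linear 2 (ln C8) 1 Rlt_0_1)
    (eventually_large_and _ _ (exp_dominates_linear 4 (- 2 * ln eps) 1 Rlt_0_1)
    (exp_dominates_linear 4 (2 * ln (2 / h)) 1 Rlt_0_1)))))))) as [M HM].
  exists (Rmax 1 M). intros z Hz.
  assert (Hz1 : 1 <= z) by (pose proof (Rmax_l 1 M); lra).
  assert (HzM : M <= z) by (pose proof (Rmax_r 1 M); lra).
  destruct (HM z HzM) as [E2 [E3 [E5 [E6 [E7 [E8 [E9 E10]]]]]]]. clear HM Hz HzM M.
  rewrite ?Rmult_1_l in E6, E7, E8, E9, E10.
  intros y L. fold y in E6, E7, E8, E9, E10.
  set (T := exp (eps * z)) in *.
  assert (Hy0 : 0 < y) by apply exp_pos.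
  assert (Hlny : ln y = z) by apply ln_exp.
  assert (Hzy : z + 1 <= y) by (unfold y; pose proof (exp_ineq1_le z); lra).
  assert (HT1 : 1 <= T) by (unfold T; pose proof (exp_ineq1_le (eps * z)); nra).
  assert (HL0 : 0 < L) by apply exp_pos.
  assert (Hy2 : 0 < y ^ 2) by (apply pow_lt; lra).
  assert (Ey2 : y ^ 2 = exp (2 * z)).
  { replace (2 * z) with (z + z) by ring. rewrite exp_plus. fold y. ring. }
  assert (HT8 : 8 <= eps ^ 2 * T).
  { apply Rmult_le_reg_l with (/ eps ^ 2); [apply Rinv_0_lt_compat, pow_lt; lra|].
    rewrite <- Rmult_assoc, Rinv_l by (apply pow_nonzero; lra). unfold Rdiv in E2. lra. }
  (* the powers of [y] that [L = e^y] has to absorb *)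
  assert (F7 : y ^ 2 / (2 * eps) <= L).
  { apply Rle_trans with (exp (2 * z + - ln (2 * eps))); [|now apply exp_le_exp].
    rewrite exp_plus, <- Ey2, exp_Ropp, exp_ln by lra. apply Rle_refl. }
  assert (F8 : C8 * y ^ 2 <= L).
  { apply Rle_trans with (exp (2 * z + ln C8)); [|now apply exp_le_exp].
    rewrite exp_plus, <- Ey2, exp_ln by lra. lra. }
  set (sL := exp (y / 2)).
  assert (EsL : sL * sL = L) by (unfold sL; rewrite <- exp_plus; unfold L; f_equal; field).
  assert (HsL : 0 < sL) by apply exp_pos.
  assert (F9 : y ^ 2 / eps <= sL).
  { apply Rle_trans with (exp (2 * z + - ln eps)); [|apply exp_le_exp; lra].
    rewrite exp_plus, <- Ey2, exp_Ropp, exp_ln by lra. apply Rle_refl. }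
  assert (F10 : 2 / h * y ^ 2 <= sL).
  { apply Rle_trans with (exp (2 * z + ln (2 / h))); [|apply exp_le_exp; lra].
    rewrite exp_plus, <- Ey2, exp_ln by (apply Rdiv_lt_0_compat; lra). lra. }
  (* So many steps of ratio 1 + eps = e^h take U from y^eps to at most y^(1 - eps). *)
  destruct (nfloor_ex ((1 - 2 * eps) * z / h)) as [J HJ].
  { apply Rdiv_le_0_compat; nra. }
  assert (HJh : INR J * h <= (1 - 2 * eps) * z).
  { apply Rle_trans with ((1 - 2 * eps) * z / h * h); [apply Rmult_le_compat_r; lra|].
    right; field; lra. }
  assert (HJh' : (1 - 2 * eps) * z - h <= INR J * h).
  { assert ((1 - 2 * eps) * z / h * h <= (INR J + 1) * h) by (apply Rmult_le_compat_r; lra).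
    replace ((1 - 2 * eps) * z / h * h) with ((1 - 2 * eps) * z) in H by (field; lra). lra. }
  assert (HJe : (1 - 3 * eps) * z <= INR J * eps).
  { pose proof (pos_INR J). assert (INR J * h <= INR J * eps) by (apply Rmult_le_compat_l; lra). nra. }
  assert (HJ1 : 1 <= INR J).
  { apply (le_INR 1). destruct J; [|lia]. simpl in HJe. nra. }
  assert (HJz : INR J <= z / h) by (apply le_div_of; nra).
  (* An equal share of the budget (1/2 - eps) L for each block, as a block costs (1 + 2 eps) W. *)
  set (W := (1 / 2 - eps) * L / ((1 + 2 * eps) * INR J)).
  assert (HWL : W <= L).
  { apply div_le_of; [nra|]. assert (L * 1 <= L * ((1 + 2 * eps) * INR J)) by (apply Rmult_le_compat_l; nra). nra. }
  assert (HW4 : h * L / (4 * z) <= W).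
  { apply Rle_trans with (L / (4 * INR J)).
    - apply le_div_of; [lra|].
      apply Rle_trans with (h * L / (4 * z) * (4 * (z / h))).
      + apply Rmult_le_compat_l; [|lra]. apply Rdiv_le_0_compat; nra.
      + right. field. lra.
    - unfold W. apply le_div_of; [nra|].
      replace (L / (4 * INR J) * ((1 + 2 * eps) * INR J)) with ((1 + 2 * eps) / 4 * L) by (field; lra).
      apply Rmult_le_compat_r; lra. }
  assert (HW0 : 0 < W) by (eapply Rlt_le_trans; [|exact HW4]; apply Rdiv_lt_0_compat; nra).
  set (U := fun j : nat => exp (eps * z + INR j * h)).
  assert (HUS : forall j, U (S j) = (1 + eps) * U j).
  { intros j. unfold U. rewrite S_INR, <- Heh, <- exp_plus. f_equal. ring. }
  assert (HUT : forall j, T <= U j).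
  { intros j. apply exp_le_exp. pose proof (pos_INR j). nra. }
  assert (HUJ : forall j, (j <= J)%nat -> U j * T <= y).
  { intros j Hj. unfold U, T, y. rewrite <- exp_plus. apply exp_le_exp.
    apply le_INR in Hj. assert (INR j * h <= INR J * h) by (apply Rmult_le_compat_r; lra). lra. }
  assert (HUmono : forall j k, (j <= k)%nat -> U j <= U k).
  { intros j k Hjk. apply exp_le_exp. apply le_INR in Hjk.
    assert (INR j * h <= INR k * h) by (apply Rmult_le_compat_r; lra). lra. }
  assert (HUy : forall j, (j <= J)%nat -> U j + 1 <= eps * y).
  { intros j Hj. specialize (HUJ j Hj). pose proof (HUT j).
    assert (HTe : 8 <= eps * T) by nra.
    assert (Hty : T <= y) by nra.
    assert (8 * U j <= eps * (U j * T)) by nra.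
    assert (eps * (U j * T) <= eps * y) by (apply Rmult_le_compat_l; lra).
    assert (8 <= eps * y) by nra. lra. }
  set (a := fun j => Z.to_nat (up (exp (y + U j)))).
  assert (Ha : forall j, (1 <= a j)%nat /\ y + U j <= ln (INR (a j)) <= y + U j + 1).
  { intros j. apply ln_up_nat; [|easy]. pose proof (HUT j). lra. }
  assert (Hamono : forall j k, (j <= k)%nat -> (a j <= a k)%nat).
  { intros j k Hjk. apply up_nat_mono. split; [left; apply exp_pos|].
    apply exp_le_exp. specialize (HUmono j k Hjk). lra. }
  set (D2 := (1 - eps) ^ 5 * eps / (1 + eps)).
  assert (Hp5 : 3 / 4 <= (1 - eps) ^ 5 <= 1).
  { split; [|rewrite <- (pow1 5); apply pow_incr; lra].
    apply Rle_trans with ((39 / 40) ^ 5); [lra|apply pow_incr; lra]. }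
  assert (HD2 : eps / 2 <= D2 <= 1).
  { unfold D2. split; [apply le_div_of|apply div_le_of]; nra. }
  set (th := sqrt (D2 * W / y)).
  assert (HDW : 0 <= D2 * W / y) by (apply Rdiv_le_0_compat; nra).
  assert (Eth : th * th = D2 * W / y) by now apply sqrt_sqrt.
  assert (Hth_pos : 0 <= th) by apply sqrt_pos.
  assert (Hth_low : th0 <= th).
  { apply Rsqr_incr_0_var; [|easy]. unfold Rsqr. rewrite Eth.
    apply le_div_of; [easy|].
    apply Rle_trans with (eps / 2 * (h * L / (4 * z))).
    - apply Rle_trans with (eps / 2 * (h * (C8 * y ^ 2) / (4 * z))).
      + replace (eps / 2 * (h * (C8 * y ^ 2) / (4 * z))) with (th0 * th0 * (y ^ 2 / z))
          by (unfold C8; field; lra).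
        apply Rmult_le_compat_l; [nra|]. apply le_div_of; nra.
      + apply Rmult_le_compat_l; [lra|]. unfold Rdiv.
        apply Rmult_le_compat_r; [left; apply Rinv_0_lt_compat; lra|]. apply Rmult_le_compat_l; lra.
    - apply Rmult_le_compat; try lra. apply Rdiv_le_0_compat; nra. }
  assert (Hth_sL : th <= sL).
  { apply Rsqr_incr_0_var; [|lra]. unfold Rsqr. rewrite Eth, EsL.
    apply div_le_of; [easy|].
    apply Rle_trans with (1 * L); [apply Rmult_le_compat; lra|].
    rewrite Rmult_comm. apply Rmult_le_compat_l; lra. }
  (* [th] is the largest real number allowed by the gain condition; its integer part is [S i]. *)
  destruct (nfloor_ex th Hth_pos) as [I HI].
  destruct I as [|i]; [simpl in HI; lra|].
  (* [up] is strictly above its argument, so its predecessor is the integer part. *)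
  set (w := fun j => pred (Z.to_nat (up (W / U j)))).
  assert (HU0 : forall j, 0 < U j) by (intros; apply exp_pos).
  assert (Hw : forall j, (j <= J)%nat ->
    (1 - eps) * W <= INR (w j) * U j <= W /\ L / y ^ 2 <= INR (w j)).
  { intros j Hj. specialize (HU0 j). specialize (HUJ j Hj). pose proof (HUT j) as HUTj.
    assert (Hx0 : 0 < W / U j) by now apply Rdiv_lt_0_compat.
    destruct (up_nat_bounds (W / U j) ltac:(lra)) as [H1 H2].
    assert (Ew : INR (w j) = INR (Z.to_nat (up (W / U j))) - 1).
    { unfold w. destruct (Z.to_nat (up (W / U j))) as [|n]; [simpl in H1; lra|].
      rewrite S_INR. simpl pred. ring. }
    assert (HxL : 2 * (L / y ^ 2) <= W / U j).
    { apply le_div_of; [easy|]. eapply Rle_trans; [|exact HW4].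
      assert (HUy' : U j <= y).
      { apply Rle_trans with (U j * T); [|easy].
        rewrite <- (Rmult_1_r (U j)) at 1. apply Rmult_le_compat_l; lra. }
      apply Rle_trans with (2 * (L / y ^ 2) * y).
      - apply Rmult_le_compat_l; [|easy]. apply Rmult_le_pos; [lra|]. apply Rdiv_le_0_compat; lra.
      - apply le_div_of; [lra|].
        replace (2 * (L / y ^ 2) * y * (4 * z)) with ((8 * z) * (L / y)) by (field; lra).
        apply Rle_trans with (h * y * (L / y)); [|right; field; lra].
        apply Rmult_le_compat_r; [apply Rdiv_le_0_compat; lra|].
        apply Rle_trans with (h * (8 / h * z + 0)); [right; field; lra|].
        apply Rmult_le_compat_l; lra. }
    assert (HxE : 1 <= eps * (W / U j)).
    { apply Rle_trans with (eps * (2 * (L / y ^ 2))); [|apply Rmult_le_compat_l; lra].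
      apply Rle_trans with (eps * (2 * (y ^ 2 / (2 * eps) / y ^ 2))); [right; field; lra|].
      apply Rmult_le_compat_l; [lra|]. apply Rmult_le_compat_l; [lra|].
      unfold Rdiv at 1 3. apply Rmult_le_compat_r; [left; now apply Rinv_0_lt_compat|easy]. }
    assert (EW : W / U j * U j = W) by (field; lra).
    set (x := W / U j) in *.
    split; [split|].
    - rewrite Ew, <- EW at 1. rewrite <- Rmult_assoc. apply Rmult_le_compat_r; lra.
    - rewrite Ew, <- EW. apply Rmult_le_compat_r; lra.
    - rewrite Ew. assert (eps * x <= 1 / 2 * x) by (apply Rmult_le_compat_r; lra). lra. }
  assert (HI_small : forall j, (j <= J)%nat -> INR (S i) <= eps * INR (w j)).
  { intros j Hj. destruct (Hw j Hj) as [_ H]. 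
    apply Rle_trans with sL; [lra|].
    apply Rle_trans with (eps * (L / y ^ 2)); [|apply Rmult_le_compat_l; lra].
    rewrite <- EsL.
    replace (eps * (sL * sL / y ^ 2)) with (sL * (sL / (y ^ 2 / eps))) by (field; lra).
    rewrite <- (Rmult_1_r sL) at 1. apply Rmult_le_compat_l; [lra|].
    apply le_div_of; [apply Rdiv_lt_0_compat; lra|lra]. }
  assert (HIw : forall j, (j <= J)%nat -> (S i + (w j - S i) = w j)%nat).
  { intros j Hj. specialize (HI_small j Hj).
    assert (INR (S i) <= INR (w j)).
    { pose proof (pos_INR (w j)).
      assert (eps * INR (w j) <= 1 * INR (w j)) by (apply Rmult_le_compat_r; lra). lra. }
    apply INR_le in H. lia. }
  exists i, (a J), ((1 + 2 * eps) * W),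
    (map (fun j => (primes_between (a j) (a (S j)), (w j - S i)%nat)) (seq 0 J)).
  rewrite length_map, length_seq.
  split; [|split; [|split; [|split; [|split]]]].
  - apply (disjoint_prime_blocks a (fun j => (w j - S i)%nat)). intros j. apply Hamono. lia.
  - intros B v HB. apply in_map_iff in HB. destruct HB as [j [E Hj]]. apply in_seq in Hj.
    injection E as <- <-.
    destruct (Hw j ltac:(lia)) as [Hw1 Hw2].
    pose proof (HUT j) as HUTj. destruct (Ha j) as [Ha1 Ha2]. destruct (Ha (S j)) as [Ha3 Ha4].
    pose proof (HUy (S j) ltac:(lia)) as HUyj. rewrite HUS in *.
    apply (rich_block_primes eps y (U j) W); rewrite ?(HIw j) by lia; auto; try lra.
    + apply Rle_trans with (eps ^ 2 * T); [easy|]. apply Rmult_le_compat_l; [apply pow_le|]; lra.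
    + rewrite Hlny. apply Rle_trans with (eps * T); [|apply Rmult_le_compat_l; lra].
      apply Rle_trans with (eps * (2 / eps * z + 2 / eps)); [right; field; lra|].
      apply Rmult_le_compat_l; lra.
    + apply Rle_trans with (exp (- (1 * z + ln (2 / eps ^ 2)))); [apply exp_le_exp; lra|].
      assert (He2 : 0 < eps ^ 2) by (apply pow_lt; lra).
      rewrite exp_Ropp, exp_plus, Rmult_1_l, exp_ln by (apply Rdiv_lt_0_compat; lra). fold y.
      replace (/ (y * (2 / eps ^ 2))) with (eps * (eps * (1 / 2) / y)) by (field; lra).
      apply Rmult_le_compat_l; [lra|].
      apply le_div_of; [apply Rmult_lt_0_compat; lra|].
      replace (eps * (1 / 2) / y * ((1 + eps) * y)) with (eps * ((1 + eps) / 2)) by (field; lra).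
      rewrite Rmult_assoc. apply Rmult_le_compat_l; [lra|].
      apply Rle_trans with ((1 - eps) * 1); [lra|]. apply Rmult_le_compat_l; lra.
    + apply HI_small. lia.
    + apply Rle_trans with (th ^ 2); [apply pow_incr; pose proof (pos_INR (S i)); lra|].
      right. replace (th ^ 2) with (th * th) by ring. rewrite Eth. unfold D2. field. lra.
  - intros B v p HB Hp. apply in_map_iff in HB. destruct HB as [j [E Hj]]. apply in_seq in Hj.
    injection E as <- _. apply in_primes_between in Hp.
    pose proof (Hamono (S j) J ltac:(lia)). lia.
  - destruct (Ha J) as [Ha1 Ha2]. assert (HaJ : 0 < INR (a J)) by (apply lt_0_INR; lia).
    rewrite pow_INR, <- Rpower_pow by easy. unfold Rpower. apply exp_le_exp.
    pose proof (HUy J (Nat.le_refl _)).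
    assert (eps * y <= 1 / 2 * y) by (apply Rmult_le_compat_r; lra).
    assert (HlnP : ln (INR (a J)) <= 2 * y) by lra.
    rewrite mult_INR.
    assert (0 <= INR (S i)) by apply pos_INR.
    apply Rle_trans with (sL * (y / h) * (2 * y)).
    + apply Rmult_le_compat; [apply Rmult_le_pos; lra| |apply Rmult_le_compat; try lra|easy].
      * apply ln_nonneg_nat. lia.
      * eapply Rle_trans; [exact HJz|]. unfold Rdiv.
        apply Rmult_le_compat_r; [left; apply Rinv_0_lt_compat; lra|lra].
    + rewrite <- EsL. rewrite Rmult_assoc. apply Rmult_le_compat_l; [lra|].
      replace (y / h * (2 * y)) with (2 / h * y ^ 2) by (field; lra). easy.
  - right. unfold W. field. lra.
  - assert (HIl : (1 - eps) * th <= INR i - ln (INR (S i))).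
    { eapply Rle_trans; [apply (sub_two_ln_ge eps th); [lra|exact Hth_low|lra]|].
      assert (ln (INR (S i)) <= ln th) by (apply ln_le; [apply lt_0_INR; lia|lra]).
      rewrite S_INR in HI at 2. rewrite S_INR in HI. lra. }
    apply Rle_trans with (INR J * ((1 - eps) * th)); [|apply Rmult_le_compat_l; lra].
    apply Rsqr_incr_0_var; [|repeat apply Rmult_le_pos; lra].
    assert (HLzy : 0 <= L * z / y) by (apply Rdiv_le_0_compat; [apply Rmult_le_pos|]; lra).
    rewrite Rsqr_sqrt by (apply Rmult_le_pos; lra).
    replace (INR J * ((1 - eps) * th))² with (INR J ^ 2 * (1 - eps) ^ 2 * (th * th)) by (unfold Rsqr; ring).
    rewrite Eth.
    (* J^2 W is J times a constant near 1/2 times L, and eps J >= (1 - 3 eps) z turns the remaining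
       J into z. *)
    set (D3 := (1 - eps) ^ 5 * (1 / 2 - eps) / ((1 + eps) * (1 + 2 * eps))).
    replace (INR J ^ 2 * (1 - eps) ^ 2 * (D2 * W / y))
      with ((1 - eps) ^ 2 * D3 * (L / y) * (INR J * eps)) by (unfold D2, D3, W; field; lra).
    apply Rle_trans with ((1 - eps) ^ 2 * D3 * (1 - 3 * eps) * (L * z / y)).
    + apply Rmult_le_compat_r; [easy|]. now apply constant_bound.
    + replace ((1 - eps) ^ 2 * D3 * (1 - 3 * eps) * (L * z / y))
        with ((1 - eps) ^ 2 * D3 * (L / y) * ((1 - 3 * eps) * z)) by (field; lra).
      apply Rmult_le_compat_l; [|easy].
      assert (0 < D3) by (apply Rdiv_lt_0_compat; apply Rmult_lt_0_compat; try apply pow_lt; lra).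
      assert (0 < L / y) by now apply Rdiv_lt_0_compat.
      apply Rmult_le_pos; [|lra]. apply Rmult_le_pos; [apply pow_le; lra|lra].
Qed.

Lemma choose_epsilon (c : R) : c < 1 / sqrt 2 -> exists g eps : R,
  c <= g /\ 0 <= g /\ 0 < eps <= 1 / 40 /\ (g + eps) ^ 2 <= (1 - 17 * eps) / 2.
Proof.
  intros Hc. set (g := Rmax c (1 / 2)).
  assert (Hs2 : 0 < sqrt 2) by (apply sqrt_lt_R0; lra).
  assert (Ess : sqrt 2 * sqrt 2 = 2) by (apply sqrt_sqrt; lra).
  assert (Hg : 1 / 2 <= g) by apply Rmax_r.
  assert (Hg' : g < 1 / sqrt 2).
  { apply Rmax_lub_lt; [easy|]. apply Rmult_lt_reg_r with (sqrt 2); [easy|].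
    replace (1 / sqrt 2 * sqrt 2) with 1 by (field; lra). nra. }
  assert (Hgs : g * sqrt 2 < 1).
  { apply Rmult_lt_reg_r with (/ sqrt 2); [now apply Rinv_0_lt_compat|].
    rewrite Rmult_assoc, Rinv_r by lra. unfold Rdiv in Hg'. lra. }
  assert (Hg2 : g ^ 2 < 1 / 2).
  { assert (H0 : 0 <= g * sqrt 2) by (apply Rmult_le_pos; lra).
    assert (H : g * sqrt 2 * (g * sqrt 2) < 1) by nra.
    replace (g * sqrt 2 * (g * sqrt 2)) with (g ^ 2 * (sqrt 2 * sqrt 2)) in H by ring.
    rewrite Ess in H. lra. }
  (* Since 2 g + eps + 17/2 < 12, the gap 1/2 - g^2 covers both the losses of the construction and
     an extra eps in the exponent. *)
  exists g, (Rmin (1 / 40) ((1 / 2 - g ^ 2) / 12)).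
  pose proof (Rmin_l (1 / 40) ((1 / 2 - g ^ 2) / 12)).
  pose proof (Rmin_r (1 / 40) ((1 / 2 - g ^ 2) / 12)).
  assert (0 < Rmin (1 / 40) ((1 / 2 - g ^ 2) / 12)) by (apply Rmin_glb_lt; lra).
  set (eps := Rmin (1 / 40) ((1 / 2 - g ^ 2) / 12)) in *.
  repeat split; try lra.
  - apply Rmax_l.
  - nra.
Qed.

(* zeta_half t = zeta(1/2 + i t).  "max over integers l in [sqrt N, N log N] is >= X"
   is stated as "some such integer l attains a value >= X". *)
Theorem theorem1p2 :
  forall alpha c : R, 0 < alpha -> c < 1 / sqrt 2 ->
  exists N0 : nat, forall N : nat, (1 <= N)%nat -> (N0 <= N)%nat ->
    exists l : Z,
      sqrt (INR N) <= IZR l /\ IZR l <= INR N * ln (INR N) /\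
      exp (c * sqrt (ln (INR N) * ln (ln (ln (INR N))) / ln (ln (INR N))))
        <= Cmod (zeta_half (alpha * IZR l)).
Proof.
  intros alpha c Ha Hc.
  destruct (choose_epsilon c Hc) as [g [eps [Hcg [Hg [He Hge]]]]].
  destruct (resonance_principle alpha Ha) as [K [HK Hres]].
  destruct (block_parameters eps He) as [M1 HM1].
  destruct (exp_dominates_linear 2 0 (eps / 2) ltac:(lra)) as [M2 HM2].
  destruct (exp_dominates_linear 1 0 (1 / 2) ltac:(lra)) as [M3 HM3].
  (* Once S >= S0, the spare factor e^(eps S) beats the constants of [resonance_principle]. *)
  set (S0 := ln (65 + 2 * K) / eps).
  set (z0 := Rmax 1 (Rmax M1 (Rmax M2 (Rmax M3 (S0 ^ 2))))).
  destruct (nat_ceil (exp (exp (exp z0))) ltac:(left; apply exp_pos)) as [N0 [HN0 _]].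
  exists N0. intros N _ HN.
  assert (HNr : exp (exp (exp z0)) <= INR N).
  { eapply Rle_trans; [exact HN0|]. now apply le_INR. }
  set (L := ln (INR N)). set (y := ln L). set (z := ln y).
  assert (HN_pos : 0 < INR N) by (eapply Rlt_le_trans; [apply exp_pos|exact HNr]).
  assert (HL : exp (exp z0) <= L).
  { unfold L. rewrite <- (ln_exp (exp (exp z0))). apply ln_le; [apply exp_pos|easy]. }
  assert (HL_pos : 0 < L) by (eapply Rlt_le_trans; [apply exp_pos|exact HL]).
  assert (Hy : exp z0 <= y).
  { unfold y. rewrite <- (ln_exp (exp z0)). apply ln_le; [apply exp_pos|easy]. }
  assert (Hy_pos : 0 < y) by (eapply Rlt_le_trans; [apply exp_pos|exact Hy]).
  assert (Hz : z0 <= z).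
  { unfold z. rewrite <- (ln_exp z0). apply ln_le; [apply exp_pos|easy]. }
  assert (ENL : exp L = INR N) by now apply exp_ln.
  assert (ELy : exp y = L) by now apply exp_ln.
  assert (Eyz : exp z = y) by now apply exp_ln.
  assert (Hz_all : 1 <= z /\ M1 <= z /\ M2 <= z /\ M3 <= z /\ S0 ^ 2 <= z).
  { pose proof (Rmax_l 1 (Rmax M1 (Rmax M2 (Rmax M3 (S0 ^ 2))))).
    pose proof (Rmax_r 1 (Rmax M1 (Rmax M2 (Rmax M3 (S0 ^ 2))))).
    pose proof (Rmax_l M1 (Rmax M2 (Rmax M3 (S0 ^ 2)))).
    pose proof (Rmax_r M1 (Rmax M2 (Rmax M3 (S0 ^ 2)))).
    pose proof (Rmax_l M2 (Rmax M3 (S0 ^ 2))). pose proof (Rmax_r M2 (Rmax M3 (S0 ^ 2))).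
    pose proof (Rmax_l M3 (S0 ^ 2)). pose proof (Rmax_r M3 (S0 ^ 2)).
    unfold z0 in Hz. repeat split; lra. }
  destruct Hz_all as [Hz1 [HzM1 [HzM2 [HzM3 HzS]]]].
  assert (Hzy : z + 1 <= y) by (rewrite <- Eyz; pose proof (exp_ineq1_le z); lra).
  assert (HyL : y + 1 <= L) by (rewrite <- ELy; pose proof (exp_ineq1_le y); lra).
  assert (HLN : L + 1 <= INR N) by (rewrite <- ENL; pose proof (exp_ineq1_le L); lra).
  set (S := sqrt (L * z / y)).
  change (exists l : Z, sqrt (INR N) <= IZR l /\ IZR l <= INR N * L /\
    exp (c * S) <= Cmod (zeta_half (alpha * IZR l))).
  assert (HLzy : 0 <= L * z / y) by (apply Rdiv_le_0_compat; nra).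
  assert (HS : S0 <= S).
  { assert (Hyy : y <= L * z / y).
    { pose proof (HM3 y ltac:(lra)) as H.
      assert (EL : exp (1 / 2 * y) * exp (1 / 2 * y) = L).
      { rewrite <- exp_plus, <- ELy. f_equal. field. }
      apply le_div_of; [easy|]. nra. }
    assert (HS2 : S0 ^ 2 <= S * S) by (unfold S; rewrite sqrt_sqrt; lra).
    assert (0 <= S) by apply sqrt_pos. nra. }
  assert (HS_pos : 0 <= S) by apply sqrt_pos.
  assert (HexpS : 65 + 2 * K <= exp (eps * S)).
  { rewrite <- (exp_ln (65 + 2 * K)) by lra. apply exp_le_exp.
    replace (ln (65 + 2 * K)) with (eps * S0) by (unfold S0; field; lra).
    apply Rmult_le_compat_l; lra. }
  (* If no admissible l works, zeta is below e^(g S) at all l in [sqrt N, N); these l are admissible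
     because log N >= 1. *)
  apply NNPP. intros Hno.
  assert (HV : forall l : nat, sqrt (INR N) <= INR l -> (l < N)%nat ->
    Cmod (zeta_half (alpha * INR l)) <= exp (g * S)).
  { intros l Hl HlN. apply Rnot_lt_le. intros Hlt. apply Hno. exists (Z.of_nat l).
    rewrite <- INR_IZR_INZ. apply lt_INR in HlN. split; [easy|split].
    - nra.
    - left. eapply Rle_lt_trans; [|exact Hlt]. apply exp_le_exp. now apply Rmult_le_compat_r. }
  destruct (HM1 z HzM1) as [i [P [d [bs [Hd [Hr [HP [HPN [Hdc Hgain]]]]]]]]].
  rewrite Eyz, ELy, ENL in *.
  destruct (block_resonator i P d bs Hd Hr HP) as [Rd [F [Q [HQ1 [HQ2 [HlR [HlF [HE HNum]]]]]]]].
  assert (HN1 : (1 <= N)%nat) by (apply INR_le; simpl; lra).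
  assert (HQ3 : forall k m, In (k, m) Q ->
    (1 <= k <= N)%nat /\ (1 <= m)%nat /\ In m Rd /\ In (k * m)%nat F).
  { intros k m H. destruct (HQ2 k m H) as [[H1 H2] H3]. split; [|easy].
    split; [easy|]. apply INR_le in HPN. lia. }
  pose proof (Hres N (exp (g * S)) Rd F Q HN1 ltac:(left; apply exp_pos) HV HQ1 HQ3) as Hup.
  pose proof (Rle_trans _ _ _ HNum Hup) as Hfin. clear HNum Hup.
  apply Rmult_le_reg_r in Hfin; [|now apply sqrt_lt_R0].
  assert (Hlow : exp (g * S) * exp (eps * S) <= (exp (INR i) / INR (Datatypes.S i)) ^ length bs).
  { assert (HSi : 0 < INR (Datatypes.S i)) by (apply lt_0_INR; lia).
    assert (E : (exp (INR i) / INR (Datatypes.S i)) ^ length bs =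
      exp (INR (length bs) * (INR i - ln (INR (Datatypes.S i))))).
    { rewrite <- Rpower_pow by (apply Rdiv_lt_0_compat; [apply exp_pos|easy]).
      unfold Rpower. rewrite ln_div, ln_exp by (try apply exp_pos; easy). reflexivity. }
    rewrite E, <- exp_plus. apply exp_le_exp.
    eapply Rle_trans; [|exact Hgain].
    apply Rle_trans with (sqrt ((g + eps) ^ 2 * (L * z / y))).
    - rewrite sqrt_mult, sqrt_pow2 by (try apply pow2_ge_0; lra). fold S. lra.
    - apply sqrt_le_1_alt. now apply Rmult_le_compat_r. }
  (* At most N^(1/2 - eps) frequencies, and the squared logarithm is below N^eps. *)
  assert (Hsmall : sqrt (INR (length Rd) * INR (length F)) * ln (INR N + 2) ^ 2 / sqrt (INR N) <= 1).
  { set (J := length bs) in *.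
    assert (HJ0 : 0 <= exp d ^ J) by (apply pow_le; left; apply exp_pos).
    assert (H1 : sqrt (INR (length Rd) * INR (length F)) <= exp ((1 / 2 - eps) * L)).
    { apply Rle_trans with (exp d ^ J).
      - rewrite <- (sqrt_square (exp d ^ J)) by easy. apply sqrt_le_1_alt.
        apply Rmult_le_compat; auto using pos_INR.
      - rewrite <- Rpower_pow by apply exp_pos. unfold Rpower. rewrite ln_exp.
        now apply exp_le_exp. }
    assert (H2 : ln (INR N + 2) <= 2 * L).
    { apply Rle_trans with (ln (INR N * INR N)); [apply ln_le; nra|]. rewrite ln_mult by easy.
      fold L. lra. }
    assert (H3 : 0 <= ln (INR N + 2)) by (rewrite <- ln_1; apply ln_le; lra).
    pose proof (HM2 L ltac:(lra)) as H4.
    assert (H5 : ln (INR N + 2) ^ 2 <= exp (eps * L)).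
    { replace (eps * L) with (eps / 2 * L + eps / 2 * L) by field. rewrite exp_plus. nra. }
    assert (EsN : sqrt (INR N) = exp (1 / 2 * L)).
    { rewrite <- ENL. replace L with (1 / 2 * L + 1 / 2 * L) at 1 by field.
      rewrite exp_plus. apply sqrt_square. left; apply exp_pos. }
    rewrite EsN. apply div_le_of; [apply exp_pos|].
    apply Rle_trans with (exp ((1 / 2 - eps) * L) * exp (eps * L)).
    - apply Rmult_le_compat; auto using sqrt_pos. apply pow2_ge_0.
    - rewrite <- exp_plus. right. rewrite Rmult_1_l. f_equal. ring. }
  (* With X = e^(g S) >= 1, the gain (65 + 2K) X exceeds the upper bound 64 X + 2K. *)
  assert (Hg1 : 1 <= exp (g * S)).
  { pose proof (exp_ineq1_le (g * S)). nra. }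
  set (X := exp (g * S)) in *.
  set (t := sqrt (INR (length Rd) * INR (length F)) * ln (INR N + 2) ^ 2 / sqrt (INR N)) in *.
  replace (K * sqrt (INR (length Rd) * INR (length F)) * ln (INR N + 2) ^ 2 / sqrt (INR N))
    with (K * t) in Hfin by (unfold t, Rdiv; ring).
  assert (K * t <= K * 1) by (apply Rmult_le_compat_l; lra).
  assert (X * (65 + 2 * K) <= X * exp (eps * S)) by (apply Rmult_le_compat_l; lra).
  assert (K * 1 <= K * X) by (apply Rmult_le_compat_l; lra).
  lra.
Qed.
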